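(* Let $(X,C,\nabla)$ be an affine surface of genus $g$ with $n$ cone points, and let $L^\bullet$ be the two-term complex of sheaves (in degrees $0$ and $1$) $$T_X(-C)\xrightarrow{\ \mathcal L_\nabla\ }\Omega_X(C),\qquad \mathcal L_\nabla(v)=L_v\nabla .$$ There is a natural identification of the tangent space of the moduli space $\mathcal A_{g,n}$ at $(X,C,\nabla)$ with the first hypercohomology $\mathbb H^1(L^\bullet)$.
   Context: An affine surface is a triple $(X,C,\nabla)$ with $X$ a closed connected Riemann surface, $C\subset X$ a finite set (''cone points''), and $\nabla\colon\Omega_X\to\Omega_X\otimes\Omega_X(C)$ a holomorphic connection with regular singularities along $C$ ($\mathbb C$-linear, satisfying the Leibniz rule). $\mathcal A_{g,n}$ ($2g-2+n>0$) is the fine moduli space (in the stack sense) of genus $g$ affine surfaces with $n$ labelled cone points: families over $B$ are smooth proper families of pointed curves $(\mathcal X\to B,\mathcal C)$ with a relative connection on $\Omega_{\mathcal X/B}$ with at worst simple poles along the sections $\mathcal C$. It is an affine bundle over $\mathcal M_{g,n}$. By the universal property its tangent space at $(X,C,\nabla)$ is the space of first-order deformations of $(X,C,\nabla)$: isomorphism classes of families $(\mathcal X,\mathcal C,\widetilde\nabla)$ over $B=\operatorname{Spec}\mathbb C[\epsilon]/(\epsilon^2)$ with an identification of the restriction to the closed point with $(X,C,\nabla)$. The Lie derivative is $L_v\nabla=\frac{d}{dt}(\Phi^t_v)^*\nabla|_{t=0}$, $\Phi_v^t$ the flow of $v$; it is a one-form since the difference of two connections is a one-form. $\mathbb H^1(L^\bullet)$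 is the quotient of the cocycles $(\chi,\eta')\in C^1(T_X(-C))\oplus C^0(\Omega_X(C))$ (Čech cochains) with $\delta\chi=0$, $\mathcal L_\nabla(\chi)=\delta\eta'$ by the coboundaries $(\delta\psi,\mathcal L_\nabla\psi)$, $\psi\in C^0(T_X(-C))$; here $(\delta\eta)_{\alpha\beta}=\eta_\beta-\eta_\alpha$. The natural map from deformations to $\mathbb H^1(L^\bullet)$: choose an open cover $V_\alpha$ of $\mathcal X$, $U_\alpha=V_\alpha\cap X$, trivializations $F_\alpha\colon V_\alpha\to U_\alpha\times B$ over $B$ restricting to the identity on $X$ and making $\mathcal C$ horizontal, and nowhere-zero one-forms $\omega_\alpha$ on $U_\alpha$ with $\nabla\omega_\alpha=\eta_\alpha\otimes\omega_\alpha$. With $F_{\alpha\beta}=F_\alpha\circ F_\beta^{-1}$, the vector field $\chi_{\alpha\beta}$ is defined by $F_{\alpha\beta}^*h=h+\epsilon\chi_{\alpha\beta}(h)$ for holomorphic functions $h$, and $\eta'_\alpha$ by $((F_\alpha)_*\widetilde\nabla)\omega_\alpha=(\eta_\alpha+\epsilon\eta'_\alpha)\otimes\omega_\alpha$. The deformation is sent to the class of $(\chi,\eta')$. *)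

(* Defs.v *)
From HB Require Import structures.
From mathcomp Require Import all_boot all_order all_algebra.
From mathcomp Require Import complex.
From mathcomp Require Import all_classical all_reals.
From mathcomp Require Import topology normedtype sequences.

Set Implicit Arguments.
Unset Strict Implicit.
Unset Printing Implicit Defensive.

Import Order.TTheory GRing.Theory Num.Theory.
Import numFieldNormedType.Exports.

Local Open Scope classical_set_scope.
Local Open Scope ring_scope.

Definition Cx (R : realType) : numFieldType := R[i].

(* [sqz K m] is K[e_1, ..., e_m] / (e_i e_j)_{i,j}: the pair (a, u) stands for
   a + \sum_i u_i e_i. *)

Definition sqz (K : comNzRingType) (m : nat) : Type := (K * 'rV[K]_m)%type.

HB.instance Definition _ (K : comNzRingType) (m : nat) :=
  GRing.Zmodule.copy (sqz K m) (K * 'rV[K]_m)%type.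

Section SquareZeroExtension.
Context (K : comNzRingType) (m : nat).

Definition sqz_one : sqz K m := (1, 0).
Definition sqz_mul (a b : sqz K m) : sqz K m :=
  (a.1 * b.1, a.1 *: b.2 + b.1 *: a.2).

Lemma sqz_mulA : associative sqz_mul.
Proof.
move=> [a u] [b v] [c w]; rewrite /sqz_mul /=; congr pair; first exact: mulrA.
by rewrite !scalerDr !scalerA addrA [c * a]mulrC [c * b]mulrC.
Qed.

Lemma sqz_mulC : commutative sqz_mul.
Proof. by move=> a b; rewrite /sqz_mul mulrC addrC. Qed.

Lemma sqz_mul1 : left_id sqz_one sqz_mul.
Proof. by move=> [a u]; rewrite /sqz_mul /= mul1r scale1r scaler0 addr0. Qed.

Lemma sqz_mulDl : left_distributive sqz_mul +%R.
Proof.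
move=> [a u] [b v] [c w]; rewrite /sqz_mul /=; congr pair; first exact: mulrDl.
by rewrite scalerDl scalerDr addrACA.
Qed.

Lemma sqz_1neq0 : sqz_one != 0.
Proof. by apply/eqP => -[/eqP]; rewrite oner_eq0. Qed.

HB.instance Definition _ := GRing.Zmodule_isComNzRing.Build (sqz K m)
  sqz_mulA sqz_mulC sqz_mul1 sqz_mulDl sqz_1neq0.

End SquareZeroExtension.

(* [A R m] is the ring of functions of the base B_m = Spec C[e_1..e_m]/(e_i e_j):
   B_0 is a reduced point and B_1 = Spec C[e]/(e^2). *)

Definition A (R : realType) (m : nat) : comNzRingType := sqz (Cx R) m.

Definition acst (R : realType) (m : nat) (a : Cx R) : A R m := (a, 0).
Definition aeps (R : realType) (m : nat) (i : 'I_m) : A R m := (0, delta_mx 0 i).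

(* The local algebra map with e_i |-> \sum_j M_ij e_j; the closed point of B_m
   is the case m' = 0 and the projection of B_m' to the point is m = 0. *)
Definition base_map (R : realType) (m m' : nat) (M : 'M[Cx R]_(m, m'))
  (a : A R m) : A R m' := (a.1, a.2 *m M).

(* Holomorphic means locally the sum of a convergent power series. *)

Definition holo_at (R : realType) (f : Cx R -> Cx R) (p : Cx R) : Prop :=
  exists r : Cx R, 0 < r /\ exists a : nat -> Cx R,
    forall z, `|z - p| < r ->
      (fun k => \sum_(i < k) a i * (z - p) ^+ i) @ \oo --> f z.

Definition holoA_on (R : realType) (m : nat) (W : set (Cx R))
    (f : Cx R -> A R m) : Prop :=
  forall p, W p -> holo_at (fun z => (f z).1) p /\
    forall i, holo_at (fun z => (f z).2 ord0 i) p.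

Definition holoA_near (R : realType) (m : nat) (p : Cx R)
    (f : Cx R -> A R m) : Prop :=
  exists W : set (Cx R), [/\ open W, W p & holoA_on W f].

(* Smooth families of curves over B_m with sections through the labelled points
   c_i. As B_m is a fat point, such a family is a sheaf of A_m-algebras on the
   topological space X that is locally isomorphic to the sheaf of A_m-valued
   holomorphic functions on an open subset of C. The sheaf is given by its
   stalks together with the sections over each open set, seen as functions to
   the stalks. For m = 0 this is a Riemann surface with marked points.

   In [is_chart], [G y f] is the germ at y of the function that is f in the
   coordinate phi. *)

Definition is_chart (R : realType) (X : topologicalType) (m : nat)
    (stalk : X -> comNzRingType) (str : forall x, A R m -> stalk x)
    (sect : set X -> (forall x, stalk x) -> Prop)
    (U : set X) (phi : X -> Cx R)
    (G : forall y, (Cx R -> A R m) -> stalk y) : Prop :=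
  [/\ [/\ open U,
          forall V, open V -> V `<=` U -> open (phi @` V),
          forall W, open W -> open (U `&` phi @^-1` W) &
          forall y y', U y -> U y' -> phi y = phi y' -> y = y'],
      forall y, U y ->
       [/\ forall a, G y (fun=> a) = str y a,
           forall f g, holoA_near (phi y) f -> holoA_near (phi y) g ->
             G y (fun z => f z + g z) = G y f + G y g,
           forall f g, holoA_near (phi y) f -> holoA_near (phi y) g ->
             G y (fun z => f z * g z) = G y f * G y g,
           forall f, holoA_near (phi y) f ->
             (G y f = 0 <-> \forall z \near phi y, f z = 0) &
           forall a, exists f, holoA_near (phi y) f /\ G y f = a] &
      forall V s, open V -> V `<=` U ->
        (sect V s <-> exists f, holoA_on (phi @` V) f /\
                        forall y, V y -> s y = G y f)].

Record curve (R : realType) (X : topologicalType) (n : nat) (c : 'I_n -> X)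
    (m : nat) := Curve {
  stalk : X -> comNzRingType;
  str : forall x, {rmorphism A R m -> stalk x};
  sect : set X -> (forall x, stalk x) -> Prop;
  along : forall i, {rmorphism stalk (c i) -> A R m};
  sect_ext : forall U s s', (forall x, U x -> s x = s' x) ->
    sect U s -> sect U s';
  sect_res : forall U V s, open U -> open V -> V `<=` U ->
    sect U s -> sect V s;
  sect_glue : forall U s, open U ->
    (forall x, U x -> exists V, [/\ open V, V x, V `<=` U & sect V s]) ->
    sect U s;
  curve_chart : forall x, exists U phi G,
    U x /\ is_chart str sect U phi G;
  along_str : forall i a, along i (str (c i) a) = a }.

Arguments str {R X n c m}.
Arguments sect {R X n c m}.
Arguments along {R X n c m}.

Section Tensors.
Context (R : realType) (X : topologicalType) (n : nat) (c : 'I_n -> X) (m : nat).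
Context (P : curve R c m).

Definition vec x := stalk P x -> stalk P x.
Definition cov x := vec x -> stalk P x.
Definition bil x := vec x -> vec x -> stalk P x.

(* The stalk at x of the relative tangent sheaf: A_m-linear derivations. *)
Definition is_vec x (D : vec x) : Prop :=
  [/\ forall a b, D (a + b) = D a + D b,
      forall a b, D (a * b) = D a * b + a * D b &
      forall k, D (str P x k) = 0].

(* Relative one-forms are dual to vector fields, and sections of the square of
   the (invertible) sheaf of one-forms are bilinear forms on vector fields.
   Values outside [is_vec] are irrelevant. *)
Definition is_cov x (w : cov x) : Prop :=
  (forall D E, is_vec D -> is_vec E ->
     w (fun a => D a + E a) = w D + w E) /\
  (forall f D, is_vec D -> w (fun a => f * D a) = f * w D).

Definition is_bil x (q : bil x) : Prop :=
  forall D, is_vec D -> is_cov (q D) /\ is_cov (fun E => q E D).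

Definition vfield := forall x, vec x.
Definition form1 := forall x, cov x.
Definition form2 := forall x, bil x.

Definition is_vfield (U : set X) (v : vfield) : Prop :=
  (forall x, U x -> is_vec (v x)) /\
  forall V s, open V -> V `<=` U -> sect P V s ->
    sect P V (fun x => v x (s x)).

Definition is_form1 (U : set X) (w : form1) : Prop :=
  (forall x, U x -> is_cov (w x)) /\
  forall V v, open V -> V `<=` U -> is_vfield V v ->
    sect P V (fun x => w x (v x)).

Definition is_form2 (U : set X) (q : form2) : Prop :=
  (forall x, U x -> is_bil (q x)) /\
  forall V v v', open V -> V `<=` U -> is_vfield V v -> is_vfield V v' ->
    sect P V (fun x => q x (v x) (v' x)).

Definition off (U : set X) : set X := U `\` range c.

Definition vanishes_along (U : set X) (s : forall x, stalk P x) : Prop :=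
  forall i, U (c i) -> along P i (s (c i)) = 0.

(* The sections over U of T(-C), Omega(C) and Omega (x) Omega(C), where C is the
   divisor of the marked sections. The last two are the sections w over U \ C
   such that u w extends across C for all functions u vanishing along C. *)
Definition is_vfield_zero (U : set X) (v : vfield) : Prop :=
  is_vfield U v /\
  forall i, U (c i) -> forall a, along P i (v (c i) a) = 0.

Definition is_form1_pole (U : set X) (w : form1) : Prop :=
  is_form1 (off U) w /\
  forall V u, open V -> V `<=` U -> sect P V u -> vanishes_along V u ->
    exists w', is_form1 V w' /\
      forall x, off V x -> forall D, is_vec D -> w' x D = u x * w x D.

Definition is_form2_pole (U : set X) (q : form2) : Prop :=
  is_form2 (off U) q /\
  forall V u, open V -> V `<=` U -> sect P V u -> vanishes_along V u ->
    exists q', is_form2 V q' /\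
      forall x, off V x -> forall D E, is_vec D -> is_vec E ->
        q' x D E = u x * q x D E.

Definition eq_off (U : set X) (w w' : form1) : Prop :=
  forall x, off U x -> forall D, is_vec D -> w x D = w' x D.

Definition bracket x (v D : vec x) : vec x := fun a => v (D a) - D (v a).

Definition lie_cov x (v : vec x) (w : cov x) : cov x :=
  fun D => v (w D) - w (bracket v D).

Definition lie_bil x (v : vec x) (q : bil x) : bil x :=
  fun D E => v (q D E) - q (bracket v D) E - q D (bracket v E).

End Tensors.

(* An affine surface is the case m = 0. The connection is a morphism of sheaves off
   the cone points, hence given on stalks there. Its A_m-linearity follows from
   additivity and the Leibniz rule. *)

Record affine_family (R : realType) (X : topologicalType) (n : nat)
    (c : 'I_n -> X) (m : nat) := AffineFamily {
  curve_of :> curve R c m;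
  nabla : forall x, cov curve_of x -> bil curve_of x;
  nabla_ext : forall x (w w' : cov curve_of x), off c setT x ->
    is_cov w -> is_cov w' -> (forall D, is_vec D -> w D = w' D) ->
    forall D E, is_vec D -> is_vec E -> nabla w D E = nabla w' D E;
  nablaD : forall x (w w' : cov curve_of x), off c setT x ->
    is_cov w -> is_cov w' ->
    forall D E, is_vec D -> is_vec E ->
      nabla (fun F => w F + w' F) D E = nabla w D E + nabla w' D E;
  nabla_leibniz : forall x (f : stalk curve_of x) (w : cov curve_of x),
    off c setT x -> is_cov w ->
    forall D E, is_vec D -> is_vec E ->
      nabla (fun F => f * w F) D E = D f * w E + f * nabla w D E;
  nabla_sect : forall U w, open U -> is_form1 U w ->
    is_form2_pole U (fun x => nabla (w x)) }.

Arguments nabla {R X n c m}.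

Section LieDerivative.
Context (R : realType) (X : topologicalType) (n : nat) (c : 'I_n -> X).
Context (S : affine_family R c 0).

(* "s = L_v nabla on U". The flow acts by
     ((Phi^t)^* nabla) w = (Phi^t)^* (nabla ((Phi^-t)^* w)),
   whose derivative at t = 0 is L_v (nabla w) - nabla (L_v w); this is
   O-linear in w, and s is the one-form with s (x) w equal to it. *)
Definition is_lie_nabla (U : set X) (v : vfield S) (s : form1 S) : Prop :=
  forall x, off c U x -> forall w : cov S x, is_cov w ->
  forall D E, is_vec D -> is_vec E ->
    s x D * w E = lie_bil (v x) (nabla S x w) D E
                  - nabla S x (lie_cov (v x) w) D E.

End LieDerivative.

(* The genus is the dimension of the space of global holomorphic one-forms. *)
Definition has_genus (R : realType) (X : topologicalType) (n : nat)
    (c : 'I_n -> X) (S : curve R c 0) (g : nat) : Prop :=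
  exists b : 'I_g -> form1 S, (forall k, is_form1 setT (b k)) /\
    forall w, is_form1 setT w -> exists! a : 'rV[Cx R]_g,
      forall x (D : vec S x), is_vec D ->
        w x D = \sum_k str S x (acst 0 (a ord0 k)) * b k x D.

Section Morphisms.
Context (R : realType) (X : topologicalType) (n : nat) (c : 'I_n -> X).
Context (m m' : nat).

(* Morphisms over U, and over the base change given by M, of families of pointed
   curves; the underlying map of topological spaces is the identity. *)
Definition is_mor (M : 'M[Cx R]_(m, m')) (P : curve R c m) (P' : curve R c m')
    (U : set X) (f : forall x, stalk P x -> stalk P' x) : Prop :=
  [/\ forall x, U x ->
        [/\ forall a b, f x (a + b) = f x a + f x b,
            forall a b, f x (a * b) = f x a * f x b &
            forall k, f x (str P x k) = str P' x (base_map M k)],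
      forall V s, open V -> V `<=` U -> sect P V s ->
        sect P' V (fun x => f x (s x)) &
      forall i, U (c i) -> forall a,
        along P' i (f (c i) a) = base_map M (along P i a)].

(* Compatibility of vector fields, one-forms and their squares with f: every
   vector field of P' is a combination of vector fields related to vector
   fields of P, so that w' is determined by w as its pullback. *)
Definition rel_vec (P : curve R c m) (P' : curve R c m') x
    (f : stalk P x -> stalk P' x) (D : vec P x) (D' : vec P' x) : Prop :=
  forall a, D' (f a) = f (D a).

Definition rel_cov (P : curve R c m) (P' : curve R c m') x
    (f : stalk P x -> stalk P' x) (w : cov P x) (w' : cov P' x) : Prop :=
  forall D D', is_vec D -> is_vec D' -> rel_vec f D D' -> w' D' = f (w D).

Definition rel_bil (P : curve R c m) (P' : curve R c m') x
    (f : stalk P x -> stalk P' x) (q : bil P x) (q' : bil P' x) : Prop :=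
  forall D D' E E', is_vec D -> is_vec D' -> is_vec E -> is_vec E' ->
    rel_vec f D D' -> rel_vec f E E' -> q' D' E' = f (q D E).

Definition is_affine_mor (M : 'M[Cx R]_(m, m')) (S : affine_family R c m)
    (S' : affine_family R c m') (f : forall x, stalk S x -> stalk S' x) : Prop :=
  is_mor M setT f /\
  forall x, off c setT x -> forall (w : cov S x) (w' : cov S' x),
    is_cov w -> is_cov w' -> rel_cov (@f x) w w' ->
    rel_bil (@f x) (nabla S x w) (nabla S' x w').

End Morphisms.

(* A deformation of S over B_m: a family with an identification of its
   restriction to the closed point with S. *)
Record deformation (R : realType) (X : topologicalType) (n : nat)
    (c : 'I_n -> X) (S : affine_family R c 0) (m : nat) := Deformation {
  total :> affine_family R c m;
  rho : forall x, stalk total x -> stalk S x;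
  rho_mor : is_affine_mor 0 rho;
  rho_surj : forall x b, exists a, rho (x := x) a = b;
  rho_ker : forall x (a : stalk total x), rho a = 0 ->
    exists b : 'I_m -> stalk total x,
      a = \sum_i str total x (aeps R i) * b i }.

Section TangentSpace.
Context (R : realType) (X : topologicalType) (n : nat) (c : 'I_n -> X).
Context (S : affine_family R c 0).

(* D' is the base change of D by M. Over the identity of the closed fibre, such
   a morphism is automatically cartesian. *)
Definition is_base_change (m m' : nat) (M : 'M[Cx R]_(m, m'))
    (D : deformation S m) (D' : deformation S m') : Prop :=
  exists f : forall x, stalk D x -> stalk D' x, is_affine_mor M f /\
    forall x a, rho (f x a) = rho a.

Definition iso_def (m : nat) (D D' : deformation S m) : Prop :=
  exists f : forall x, stalk D x -> stalk D' x,
    [/\ is_affine_mor 1%:M f, forall x a, rho (f x a) = rho a &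
        forall x, bijective (f x)].

(* The vector space structure of the tangent space: the sum of D1 and D2 is the
   base change by e_1, e_2 |-> e of the family over B_2 restricting to them
   along e_1 |-> e, e_2 |-> 0 and e_1 |-> 0, e_2 |-> e, and multiplication by
   the scalar k is the base change by e |-> k e. *)
Definition def_sum (D1 D2 D3 : deformation S 1) : Prop :=
  exists E : deformation S 2,
    [/\ is_base_change (delta_mx 0 0) E D1,
        is_base_change (delta_mx 1 0) E D2 &
        is_base_change (const_mx 1) E D3].

Definition def_scale (k : Cx R) (D D' : deformation S 1) : Prop :=
  is_base_change k%:M D D'.

(* Tangent vectors are isomorphism classes of first-order deformations. *)
Record tangent := Tangent {
  tclass :> deformation S 1 -> Prop;
  tclassP : exists D, forall D', tclass D' <-> iso_def D D' }.

Definition tangent_sum (t1 t2 t3 : tangent) : Prop :=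
  exists D1 D2 D3, [/\ t1 D1, t2 D2, t3 D3 & def_sum D1 D2 D3].

Definition tangent_scale (k : Cx R) (t t' : tangent) : Prop :=
  exists D D', [/\ t D, t' D' & def_scale k D D'].

End TangentSpace.

(* Cech hypercohomology of L, as the direct limit over all open covers. *)

Section Hypercohomology.
Context (R : realType) (X : topologicalType) (n : nat) (c : 'I_n -> X).
Context (S : affine_family R c 0).

Definition open_cover (I : Type) (U : I -> set X) : Prop :=
  (forall i, open (U i)) /\ forall x, exists i, U i x.

Record cochain := Cochain {
  idx : Type;
  opens : idx -> set X;
  chi : idx -> idx -> vfield S;
  eta : idx -> form1 S }.

Definition is_cocycle (z : cochain) : Prop :=
  let U := @opens z in
  [/\ open_cover U,
      forall i j, is_vfield_zero (U i `&` U j) (chi i j),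
      forall i, is_form1_pole (U i) (eta i),
      forall i j k x, U i x -> U j x -> U k x -> forall a,
        chi j k a - chi i k a + chi i j a = 0 :> stalk S x &
      forall i j, is_lie_nabla (U i `&` U j) (chi i j)
        (fun x D => eta j D - eta i D)].

(* Equality in the direct limit: the pullbacks to some common refinement differ
   by a coboundary. *)
Definition cohomologous (z z' : cochain) : Prop :=
  exists (K : Type) (W : K -> set X) (r : K -> idx z) (r' : K -> idx z')
         (psi : K -> vfield S),
  [/\ open_cover W,
      forall k, W k `<=` opens (r k) `&` opens (r' k),
      forall k, is_vfield_zero (W k) (psi k),
      forall k l x, W k x -> W l x -> forall a : stalk S x,
        chi (r' k) (r' l) a - chi (r k) (r l) a = psi l x a - psi k x a &
      forall k, is_lie_nabla (W k) (psi k)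
        (fun x D => eta (r' k) D - eta (r k) D)].

Definition cochain_add (z z' : cochain) : cochain :=
  Cochain (fun p : idx z * idx z' => opens p.1 `&` opens p.2)
    (fun p q x a => chi p.1 q.1 a + chi p.2 q.2 a)
    (fun p x D => eta p.1 D + eta p.2 D).

Definition cochain_scale (k : Cx R) (z : cochain) : cochain :=
  Cochain (@opens z)
    (fun i j x a => str S x (acst 0 k) * chi i j a)
    (fun i x D => str S x (acst 0 k) * eta i D).

Record H1 := HClass {
  hclass :> cochain -> Prop;
  hclassP : exists2 z, is_cocycle z &
    forall z', hclass z' <-> is_cocycle z' /\ cohomologous z z' }.

Definition H1_sum (h1 h2 h3 : H1) : Prop :=
  exists z1 z2, [/\ h1 z1, h2 z2 & h3 (cochain_add z1 z2)].

Definition H1_scale (k : Cx R) (h h' : H1) : Prop :=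
  exists z, h z /\ h' (cochain_scale k z).

(* A trivialization F : V -> U x B_1 that is the identity on X and makes the
   sections horizontal is given by the pullback j of functions by pr_1 o F; on
   functions, F^* (h0 + e h1) = j h0 + e j h1. *)
Definition is_trivialization (D : deformation S 1) (U : set X)
    (j : forall x, stalk S x -> stalk D x) : Prop :=
  is_mor (0 : 'M_(0, 1)) U j /\
  forall x, U x -> (forall h, rho (j x h) = h) /\
    bijective (fun h : stalk S x * stalk S x =>
      j x h.1 + str D x (aeps R ord0) * j x h.2).

Definition nowhere_zero (U : set X) (w : form1 S) : Prop :=
  forall x, U x -> exists D, is_vec D /\ w x D = 1.

(* [z] is obtained from the deformation D by choices of trivializations j_i and
   of one-forms w_i with nabla w_i = y_i (x) w_i. With F_ij = F_i o F_j^-1, the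
   equation F_ij^* h = h + e chi_ij(h) is F_i^* h = F_j^* (h + e chi_ij(h)), and
   the equation ((F_i)_* nabla~) w_i = (y_i + e eta_i) (x) w_i is stated after
   pulling everything back by F_i. *)
Definition represents (D : deformation S 1) (z : cochain) : Prop :=
  let U := @opens z in
  let e x : stalk D x := str D x (aeps R ord0) in
  exists (j : idx z -> forall x, stalk S x -> stalk D x)
         (w y : idx z -> form1 S),
  [/\ open_cover U,
      forall i, is_trivialization (U i) (j i),
      forall i, [/\ is_form1 (U i) (w i), nowhere_zero (U i) (w i),
        is_form1_pole (U i) (y i) &
        forall x, off c (U i) x -> forall F G, is_vec F -> is_vec G ->
          nabla S x (w i x) F G = y i x F * w i x G],
      forall i k x, U i x -> U k x -> forall h : stalk S x,
        j i x h = j k x h + e x * j k x (chi i k h) &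
      forall i x, off c (U i) x -> is_cov (eta i (x := x)) /\
        forall (w' y' t' : cov D x),
          is_cov w' -> is_cov y' -> is_cov t' ->
          rel_cov (j i x) (w i x) w' -> rel_cov (j i x) (y i x) y' ->
          rel_cov (j i x) (eta i (x := x)) t' ->
        forall F G, is_vec F -> is_vec G ->
          nabla D x w' F G = (y' F + e x * t' F) * w' G].

End Hypercohomology.

(* Main.v *)
Require Import Defs.
From HB Require Import structures.
From mathcomp Require Import all_boot all_order all_algebra.
From mathcomp Require Import complex.
From mathcomp Require Import all_classical all_reals.
From mathcomp Require Import topology normedtype sequences.
From mathcomp Require Import ring lra.

Set Implicit Arguments.
Unset Strict Implicit.
Unset Printing Implicit Defensive.

Import Order.TTheory GRing.Theory Num.Theory.
Import numFieldNormedType.Exports.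

Local Open Scope classical_set_scope.
Local Open Scope ring_scope.

(* Locally on X a deformation over B_m = Spec C[e_1..e_m]/(e_i e_j) is trivial: the
   reduction of a coordinate z of the total family is a coordinate of X, and replacing
   z by z - \sum_l e_l s_l, where c_i^* z = z (c_i) + \sum_l e_l s_l, makes the section
   c_i horizontal. A trivialization turns the stalks of the deformation into
   O[e_1..e_m]/(e_i e_j). Two of them differ by an automorphism 1 + \sum_l e_l chi_l,
   with chi_l a derivation vanishing at C, and the connection is that of X plus
   \sum_l e_l eta_l; transporting it along the automorphism gives
   L_chi_l nabla = delta eta_l, and a change of trivializations changes (chi, eta) by
   a coboundary. Conversely, a cocycle glues the families U_i x B_m with the
   connections nabla + \sum_l e_l eta_{i,l}. Working over B_m for all m at once, the
   base change by a matrix M acts on the components (chi_l, eta_l) by M, so the case of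
   B_2 gives the compatibility with sums. *)

(** * Holomorphic functions of one variable *)

(** Tangent vectors at a point are algebraic derivations of a stalk, with no continuity assumed. The
    analysis serves to show that d/dz acts on germs and on sections, and that it spans all
    derivations: a derivation killing z has values divisible by every power of z - p, hence zero.
    Since [holo_at] only asserts convergence, a germ is re-encoded by its remainders and one
    constant K that controls both the radius 1/K and their growth. Closure under an operation is
    then a recursion for the remainders and a new constant, without integrals.

    The definition of a deformation prescribes the kernel of the reduction but not flatness over
    A_m. Flatness is recovered from the charts of the total family; it is what makes a
    multiplicative lift of functions into a trivialization of the stalk.

    A hypercohomology class contains cocycles on arbitrary covers, whereas the natural map asks for
    a nowhere-zero form on each member of the cover. The relation [rep1], which mentions no such
    forms, mediates between the two. *)

Section Analysis.
Context (R : realType).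
Local Notation C := (Cx R).
Implicit Types (f g : C -> C) (p q : C).

(** The norm of [R[i]] takes its values in [R[i]] itself. A modulus in the real field brings the
    estimates below within reach of [lra] and [nra]. *)
Definition cmod (z : C) : R := complex.Re `|z|.

Lemma cmodE (z : C) : `|z| = ((cmod z)%:C)%C :> C.
Proof.
have : `|z| \is Num.real by exact: normr_real.
by rewrite /cmod => h; rewrite RRe_real.
Qed.

Lemma cmod_ge0 z : 0 <= cmod z.
Proof. by have := normr_ge0 z; rewrite cmodE ler0c. Qed.

Lemma cmodM x y : cmod (x * y) = cmod x * cmod y.
Proof. by apply: (@complexI R); rewrite rmorphM /= -!cmodE normrM. Qed.

Lemma cmodD x y : cmod (x + y) <= cmod x + cmod y.
Proof. by rewrite -lecR rmorphD /= -!cmodE ler_normD. Qed.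

Lemma cmodN x : cmod (- x) = cmod x.
Proof. by rewrite /cmod normrN. Qed.

Lemma cmod0 : cmod 0 = 0.
Proof. by rewrite /cmod normr0. Qed.

Lemma cmod1 : cmod 1 = 1.
Proof. by rewrite /cmod normr1. Qed.

Lemma cmod_eq0 x : cmod x = 0 -> x = 0.
Proof. by move=> h; apply/normr0_eq0; rewrite cmodE h. Qed.

Lemma cmod_gt0 x : x != 0 -> 0 < cmod x.
Proof.
by move=> h; rewrite lt0r cmod_ge0 andbT; apply: contra h => /eqP/cmod_eq0 ->.
Qed.

Lemma cmodX x k : cmod (x ^+ k) = cmod x ^+ k.
Proof. by elim: k => [|k ih]; rewrite ?expr0 ?cmod1 // !exprS cmodM ih. Qed.

Lemma cmod_nat k : cmod (k%:R) = k%:R.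
Proof.
elim: k => [|k ih]; first by rewrite cmod0.
apply: (@complexI R); rewrite -cmodE normr_nat rmorph_nat //.
Qed.

Lemma cmodV x : cmod x^-1 = (cmod x)^-1.
Proof.
have [->|h] := eqVneq x 0; first by rewrite invr0 cmod0 invr0.
apply: (mulfI (x := cmod x)); first by rewrite gt_eqF ?cmod_gt0.
by rewrite -cmodM !divff ?cmod1 // gt_eqF ?cmod_gt0.
Qed.

Lemma cmod_real (x : R) : cmod ((x%:C)%C) = `|x|.
Proof. by rewrite /cmod normc_def /= expr0n /= addr0 sqrtr_sqr. Qed.

Lemma lt_Re (e : C) (r : R) : 0 < e -> (((r%:C)%C : C) < e) = (r < complex.Re e).
Proof. by move=> /gtr0_real er; rewrite -{1}(RRe_real er) ltcR. Qed.

Lemma Re_gt0 (e : C) : 0 < e -> 0 < complex.Re e.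
Proof. by move=> e0; rewrite -lt_Re. Qed.

Lemma nearCP (p : C) (P : C -> Prop) :
  (\forall z \near p, P z) <-> exists e : R, 0 < e /\ forall z, cmod (z - p) < e -> P z.
Proof.
split.
  move=> /nbhs_ballP [e /= e0 h]; exists (complex.Re e); split; first exact: Re_gt0.
  move=> z hz; apply: h; rewrite -ball_normE /= distrC cmodE.
  by rewrite lt_Re.
move=> [e [e0 h]]; apply/nbhs_ballP; exists ((e%:C)%C) => /=; first by rewrite ltcR.
by move=> z; rewrite -ball_normE /= distrC cmodE ltcR => /h.
Qed.

Lemma cvgCP (u : nat -> C) (l : C) :
  u @ \oo --> l <-> forall e : R, 0 < e -> exists N, forall k, (N <= k)%N -> cmod (u k - l) < e.
Proof.
split.
  move=> /cvgrPdist_lt h e e0.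
  have [|N _ hN] := h ((e%:C)%C); first by rewrite ltcR.
  by exists N => k /hN /=; rewrite distrC cmodE ltcR.
move=> h; apply/cvgrPdist_lt => e e0; have [|N hN] := h (complex.Re e); first exact: Re_gt0.
by exists N => // k /= /hN; rewrite distrC cmodE lt_Re.
Qed.

Lemma geo_small (c t e : R) : 0 <= t -> t < 1 -> 0 < e ->
  exists N, forall k, (N <= k)%N -> c * t ^+ k < e.
Proof.
move=> t0 t1 e0.
have h : (fun k => c * t ^+ k) @ \oo --> c * 0.
  by apply: cvgMl_tmp; apply: cvg_expr; rewrite ger0_norm.
move/cvgrPdist_lt : h => /(_ _ e0) [N _ hN]; exists N => k /hN /=.
by rewrite mulr0 sub0r normrN; apply: le_lt_trans; exact: ler_norm.
Qed.

Lemma geo_sum (t : R) k : 0 <= t -> t <= 1/2 -> \sum_(i < k) t ^+ i <= 2.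
Proof.
move=> t0 t1; have h : (1 - t) * (\sum_(i < k) t ^+ i) <= 1.
  have := subrX1 t k; have := exprn_ge0 k t0; nra.
have : 0 <= \sum_(i < k) t ^+ i by apply: sumr_ge0 => i _; exact: exprn_ge0.
nra.
Qed.

(* The Taylor expansion of [f] at [p], encoded by its coefficients [a] and its
   successive remainders [h k]: f = a_0 + ... + (z-p)^k h_k. *)
Definition taylor (f : C -> C) (p : C) (a : nat -> C) (h : nat -> C -> C) (K : R) :=
  [/\ 0 < K, forall z, cmod (z - p) * K < 1 -> h 0%N z = f z,
      forall k z, cmod (z - p) * K < 1 -> h k z = a k + (z - p) * h k.+1 z &
      forall k z, cmod (z - p) * K < 1 -> cmod (h k z) <= K ^+ k.+1].

Lemma taylor_sum f p a h K : taylor f p a h K -> forall k z, cmod (z - p) * K < 1 ->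
  f z = \sum_(i < k) a i * (z - p) ^+ i + (z - p) ^+ k * h k z.
Proof.
move=> [K0 h0 hS hb] k z hz; elim: k => [|k ->].
  by rewrite big_ord0 add0r expr0 mul1r h0.
by rewrite big_ord_recr /= (hS k z hz) exprS; ring.
Qed.

Lemma taylor_center f p a h K : taylor f p a h K -> forall k, h k p = a k.
Proof.
move=> [K0 _ hS _] k.
by rewrite (hS k p) ?subrr ?cmod0 ?mul0r ?ltr01 // addr0.
Qed.

Lemma taylor_coef f p a h K : taylor f p a h K -> forall k, cmod (a k) <= K ^+ k.+1.
Proof.
move=> tf k; rewrite -(taylor_center tf); case: tf => [K0 _ _ hb].
by apply: hb; rewrite subrr cmod0 mul0r ltr01.
Qed.

Lemma taylor_val f p a h K : taylor f p a h K -> f p = a 0%N.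
Proof.
move=> tf; rewrite -(taylor_center tf); case: tf => [K0 h0 _ _].
by rewrite h0 // subrr cmod0 mul0r ltr01.
Qed.

(** A larger constant shrinks the disc and weakens the bounds, so two expansions at a point can
    always share a constant. *)
Lemma taylor_le f p a h K K' : taylor f p a h K -> K <= K' -> taylor f p a h K'.
Proof.
move=> [K0 h0 hS hb] le; have lt z : cmod (z - p) * K' < 1 -> cmod (z - p) * K < 1.
  by apply: le_lt_trans; apply: ler_wpM2l => //; exact: cmod_ge0.
split => [|z /lt|k z /lt|k z /lt].
- exact: lt_le_trans le.
- exact: h0.
- exact: hS.
- move/hb/le_trans; apply; apply: lerXn2r => //; rewrite nnegrE ltW //.
  exact: lt_le_trans le.
Qed.

(** The error after k terms is at most K (|z-p| K)^k, a null sequence on the disc |z-p| K < 1. *)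
Lemma taylor_holo f p a h K : taylor f p a h K -> holo_at f p.
Proof.
move=> tf; have [K0 h0 hS hb] := tf.
exists (((K^-1)%:C)%C); split; first by rewrite ltcR invr_gt0.
exists a => z; rewrite cmodE ltcR => hz.
have {}hz : cmod (z - p) * K < 1 by rewrite -ltr_pdivlMr // mul1r.
apply/cvgCP => e e0.
have [|N hN] := geo_small K _ hz e0; first by rewrite mulr_ge0 ?cmod_ge0 ?ltW.
exists N => k /hN; apply: le_lt_trans.
rewrite (taylor_sum tf k hz) opprD addrA subrr add0r cmodN cmodM cmodX exprMn.
apply: (@le_trans _ _ (cmod (z - p) ^+ k * K ^+ k.+1)).
  by rewrite ler_wpM2l ?exprn_ge0 ?cmod_ge0 // hb.
by rewrite exprS mulrCA.
Qed.

(** Convergence at a single point at distance t from p bounds |a_k| t^k; on the disc of radius t/2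
    the tails are then dominated by a geometric series of ratio at most 1/2. *)
Lemma holo_taylor f p : holo_at f p -> exists a h K, taylor f p a h K.
Proof.
move=> [r [r0 [a ha]]]; pose s := complex.Re r; have s0 : 0 < s by exact: Re_gt0.
have cv z : cmod (z - p) < s -> (fun k => \sum_(i < k) a i * (z - p) ^+ i) @ \oo --> f z.
  by move=> hz; apply: ha; rewrite cmodE lt_Re.
have [t tE] : exists t, t = s / 2 by exists (s / 2).
have t0 : 0 < t by rewrite tE divr_gt0.
(* At p + t two consecutive partial sums are eventually within 1 of the limit, so the terms are
   eventually at most 2; the finitely many earlier terms are added to the bound. *)
have [M [M0 hM]] : exists M, 0 < M /\ forall k, cmod (a k) * t ^+ k <= M.
  have tp : cmod (p + (t%:C)%C - p) = t by rewrite addrC addKr cmod_real ger0_norm ?ltW.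
  have /cv/cvgCP /(_ 1 ltr01) [N hN] : cmod (p + (t%:C)%C - p) < s.
    by rewrite tp tE ltr_pdivrMr //; lra.
  have {}hN : forall k, (N <= k)%N -> cmod (a k) * t ^+ k <= 2.
    move=> k lek; have := hN _ lek; have := hN _ (leqW lek).
    rewrite big_ord_recr /=.
    set S := \sum_(i < k) _; set u := a k * _ => h1 h2 /=.
    have -> : cmod (a k) * t ^+ k = cmod u by rewrite cmodM cmodX tp.
    have -> : u = (S + u - f (p + (t%:C)%C)) + - (S - f (p + (t%:C)%C)) by ring.
    apply: (le_trans (cmodD _ _)); rewrite cmodN; lra.
  have hs : 0 <= \sum_(i < N) cmod (a i) * t ^+ i.
    by apply: sumr_ge0 => i _; rewrite mulr_ge0 ?cmod_ge0 ?exprn_ge0 ?ltW.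
  exists (2 + \sum_(i < N) cmod (a i) * t ^+ i); split; first lra.
  move=> k; case: (ltnP k N) => [ltk|/hN]; last lra.
  rewrite (bigD1 (Ordinal ltk)) //=.
  have : 0 <= \sum_(i < N | i != Ordinal ltk) cmod (a i) * t ^+ i.
    by apply: sumr_ge0 => i _; rewrite mulr_ge0 ?cmod_ge0 ?exprn_ge0 ?ltW.
  lra.
have est z k : cmod (z - p) <= t / 2 ->
    cmod (f z - \sum_(i < k) a i * (z - p) ^+ i) <= 2 * M * (cmod (z - p) / t) ^+ k.
  move=> hz; set q := cmod (z - p) / t.
  have q0 : 0 <= q by rewrite divr_ge0 ?cmod_ge0 ?ltW.
  have q1 : q <= 1 / 2 by rewrite ler_pdivrMr //; lra.
  (* The value f z is replaced, up to e, by a partial sum of length k + N, which leaves a finite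
     tail T to estimate. *)
  apply/ler_addgt0Pr => e e0.
  have /cvgCP /(_ e e0) [N hN] : (fun k => \sum_(i < k) a i * (z - p) ^+ i) @ \oo --> f z.
    by apply: cv; apply: le_lt_trans hz _; lra.
  have := hN (k + N)%N (leq_addl _ _); rewrite big_split_ord /=.
  set S := \sum_(i < k) _; set T := \sum_(i < N) _ => hT.
  have -> : f z - S = T + - (S + T - f z) by ring.
  apply: (le_trans (cmodD _ _)); rewrite cmodN; apply: lerD; last exact: ltW.
  have -> : T = (z - p) ^+ k * \sum_(i < N) a (k + i)%N * (z - p) ^+ i.
    by rewrite mulr_sumr; apply: eq_bigr => i _; rewrite exprD; ring.
  rewrite cmodM cmodX.
  have le : cmod (\sum_(i < N) a (k + i)%N * (z - p) ^+ i) <= 2 * M / t ^+ k.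
    apply: (@le_trans _ _ (\sum_(i < N) M / t ^+ k * q ^+ i)); last first.
      rewrite -mulr_sumr; apply: (@le_trans _ _ (M / t ^+ k * 2)).
        by apply: ler_wpM2l; [rewrite divr_ge0 ?exprn_ge0 ?ltW | exact: geo_sum].
      by rewrite mulrAC [M * 2]mulrC.
    elim: (N) => [|j ih]; first by rewrite !big_ord0 cmod0.
    rewrite !big_ord_recr /=; apply: (le_trans (cmodD _ _)); apply: lerD => //.
    rewrite cmodM cmodX.
    have := hM (k + j)%N; rewrite exprD -ler_pdivlMr ?mulr_gt0 ?exprn_gt0 // => h.
    apply: (le_trans (ler_wpM2r (exprn_ge0 _ (cmod_ge0 _)) h)).
    rewrite le_eqVlt; apply/orP; left; apply/eqP; rewrite !invfM /q expr_div_n; ring.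
  apply: (le_trans (ler_wpM2l (exprn_ge0 _ (cmod_ge0 _)) le)).
  rewrite expr_div_n le_eqVlt; apply/orP; left; apply/eqP; ring.
(* Off p the remainder is forced by division; at p the recursion forces the value a_k. *)
pose h k z := if z == p then a k else
  (f z - \sum_(i < k) a i * (z - p) ^+ i) / (z - p) ^+ k.
(* The term 2/t keeps z within t/2 of p, while 2M <= K and 1/t <= K give 2M / t^k <= K^(k+1). *)
pose K := 2 / t + 2 * M + 1.
have Kt : 2 / t <= K.
  have : 0 < 2 / t by rewrite divr_gt0.
  rewrite /K; lra.
have K0 : 0 < K by apply: lt_le_trans Kt; rewrite divr_gt0.
have hK z : cmod (z - p) * K < 1 -> cmod (z - p) <= t / 2.
  move=> hz; have := ler_wpM2l (cmod_ge0 (z - p)) Kt => h1.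
  have {h1 hz} : cmod (z - p) * (2 / t) <= 1 by exact: le_trans h1 (ltW hz).
  by rewrite mulrA ler_pdivrMr // mul1r; lra.
have tV : t^-1 <= K.
  have h1 : 0 < t^-1 by rewrite invr_gt0.
  by apply: le_trans Kt; lra.
have bnd k : 2 * M / t ^+ k <= K ^+ k.+1.
  rewrite exprS; apply: ler_pM.
  - by rewrite mulr_ge0 ?ltW.
  - by rewrite invr_ge0 exprn_ge0 ?ltW.
  - have : 0 < 2 / t by rewrite divr_gt0.
    rewrite /K; lra.
  - rewrite -exprVn; apply: lerXn2r => //; rewrite nnegrE ?invr_ge0; exact: ltW.
exists a, h, K; split => //.
- move=> z hz; rewrite /h; case: eqP => [->|_].
    have e3 : cmod (f p - a 0%N) <= 0.
      have := est p 1%N; rewrite big_ord_recr big_ord0 /= expr0 mulr1 add0r.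
      by rewrite subrr cmod0 mul0r expr1 mulr0; apply; rewrite divr_ge0 ?ltW.
    have /eqP : cmod (f p - a 0%N) == 0 by rewrite eq_le e3 cmod_ge0.
    by move/cmod_eq0/eqP; rewrite subr_eq0 => /eqP.
  by rewrite big_ord0 subr0 expr0 divr1.
- move=> k z hz; rewrite /h; case: eqP => [->|/eqP ne]; first by rewrite subrr mul0r addr0.
  have nz : z - p != 0 by rewrite subr_eq0.
  have nzk : (z - p) ^+ k != 0 by rewrite expf_neq0.
  by rewrite big_ord_recr /= exprS; field; rewrite nz nzk.
- move=> k z hz; rewrite /h; case: eqP => [e|/eqP ne].
    apply: le_trans (bnd k); rewrite ler_pdivlMr ?exprn_gt0 //.
    have := hM k; lra.
  have nz : z - p != 0 by rewrite subr_eq0.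
  have nzk : (z - p) ^+ k != 0 by rewrite expf_neq0.
  apply: le_trans (bnd k).
  rewrite cmodM cmodV cmodX ler_pdivrMr ?exprn_gt0 ?cmod_gt0 //.
  have := est z k (hK z hz); rewrite expr_div_n; move/le_trans; apply.
  by rewrite le_eqVlt; apply/orP; left; apply/eqP; ring.
Qed.


End Analysis.

(** * Sums, products, quotients and derivatives of convergent power series *)

Section HoloAlgebra.
Context (R : realType).
Local Notation C := (Cx R).
Implicit Types (f g : C -> C) (p q : C).

Lemma holo_taylor2 f g p : holo_at f p -> holo_at g p ->
  exists a h b l K, taylor f p a h K /\ taylor g p b l K.
Proof.
move=> /holo_taylor [a [h [K tf]]] /holo_taylor [b [l [L tg]]].
have [K0 _ _ _] := tf; have [L0 _ _ _] := tg.
exists a, h, b, l, (K + L); split.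
  by apply: (taylor_le tf); rewrite lerDl ltW.
by apply: (taylor_le tg); rewrite lerDr ltW.
Qed.

Lemma taylor_cst (c p : C) : exists K,
  taylor (fun=> c) p (fun k => if k is 0%N then c else 0) (fun k z => if k is 0%N then c else 0) K.
Proof.
exists (cmod c + 1); have := cmod_ge0 c => h; split => //; first lra.
  by case=> [|k] z _; rewrite mulr0 addr0.
case=> [|k] z _; rewrite ?cmod0 ?exprn_ge0 ?expr1 //; lra.
Qed.

Lemma holo_cst (c p : C) : holo_at (fun=> c : C) p.
Proof. by have [K /taylor_holo] := taylor_cst c p. Qed.

Lemma taylor_shift f p a h K : taylor f p a h K -> exists K',
  taylor (fun z => (z - p) * f z) p (fun k => if k is k'.+1 then a k' else 0)
    (fun k z => if k is k'.+1 then h k' z else (z - p) * f z) K'.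
Proof.
move=> tf; have [K0 h0 hS hb] := tf.
exists (K + 1); have lt z : cmod (z - p) * (K + 1) < 1 -> cmod (z - p) * K < 1.
  by have := cmod_ge0 (z - p); nra.
split => //; first lra.
- by case=> [|k] z /lt hz; [rewrite add0r h0 | exact: hS].
- case=> [|k] z hz /=.
    have := hb 0%N z (lt _ hz); rewrite h0 ?lt // !expr1 cmodM.
    have := cmod_ge0 (z - p); have := cmod_ge0 (f z); have := lt _ hz; nra.
  apply: le_trans (hb k z (lt _ hz)) _.
  apply: (@le_trans _ _ ((K + 1) ^+ k.+1)).
    by apply: lerXn2r; rewrite ?nnegrE; lra.
  by rewrite [leRHS]exprS ler_peMl ?exprn_ge0 //; lra.
Qed.

Lemma taylorD f g p a h b l K : taylor f p a h K -> taylor g p b l K ->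
  taylor (fun z => f z + g z) p (fun k => a k + b k) (fun k z => h k z + l k z) (2 * K).
Proof.
move=> [K0 h0 hS hb] [_ l0 lS lb].
have lt z : cmod (z - p) * (2 * K) < 1 -> cmod (z - p) * K < 1.
  by have := cmod_ge0 (z - p); nra.
split=> [|z /lt hz|k z /lt hz|k z /lt hz]; first lra.
- by rewrite h0 ?l0.
- by rewrite (hS k z hz) (lS k z hz) mulrDr addrACA.
apply: (le_trans (cmodD _ _)); have := hb k z hz; have := lb k z hz => u v.
apply: (@le_trans _ _ (2 * K ^+ k.+1)); first lra.
rewrite exprMn; apply: ler_wpM2r; first by rewrite exprn_ge0 ?ltW.
by rewrite exprS ler_peMr //; apply: exprn_ege1; lra.
Qed.

Lemma holoD f g p : holo_at f p -> holo_at g p -> holo_at (fun z => f z + g z) p.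
Proof.
by move=> hf hg; have [a [h [b [l [K [tf tg]]]]]] := holo_taylor2 hf hg; have /taylor_holo := taylorD tf tg.
Qed.

Lemma succ_le_exp2 k : (k.+1%:R : R) <= 2 ^+ k.
Proof.
elim: k => [|k ih]; first by rewrite expr0.
rewrite exprS -natr1; have : (1 : R) <= 2 ^+ k by apply: exprn_ege1; lra.
lra.
Qed.

(** The k-th remainder of a product consists of k+1 summands, each of size at most K^(k+2). With k+1
    <= 2^k their sum is at most K^2 (2K)^k, which explains the constant 2K + K^2. *)
Lemma taylorM f g p a h b l K : taylor f p a h K -> taylor g p b l K ->
  taylor (fun z => f z * g z) p (fun k => \sum_(i < k.+1) a i * b (k - i)%N)
    (fun k z => h k z * l 0%N z + \sum_(i < k) a i * l (k - i)%N z)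
    (2 * K + K ^+ 2).
Proof.
move=> tf tg; have [K0 h0 hS hb] := tf; have [_ l0 lS lb] := tg.
have ca := taylor_coef tf.
have K2 : 0 < K ^+ 2 by rewrite exprn_gt0.
have lt z : cmod (z - p) * (2 * K + K ^+ 2) < 1 -> cmod (z - p) * K < 1.
  by have := cmod_ge0 (z - p); nra.
split=> [|z /lt hz|k z /lt hz|k z /lt hz]; first lra.
- by rewrite big_ord0 addr0 h0 ?l0.
- rewrite (hS k z hz) (lS 0%N z hz).
  rewrite big_ord_recr /= subnn [\sum_(i < k.+1) a i * l _ _]big_ord_recr /= subSnn.
  have -> : \sum_(i < k) a i * l (k - i)%N z =
      \sum_(i < k) a i * b (k - i)%N + (z - p) * \sum_(i < k) a i * l (k.+1 - i)%N z.
    rewrite mulr_sumr -big_split /=; apply: eq_bigr => i _.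
    by rewrite (lS _ _ hz) subSn 1?ltnW //; ring.
  ring.
- apply: (le_trans (cmodD _ _)).
  apply: (@le_trans _ _ (k.+1%:R * K ^+ k.+2)).
    rewrite -natr1 addrC mulrDl mul1r; apply: lerD; last first.
      rewrite cmodM [in leRHS]exprSr; apply: ler_pM; rewrite ?cmod_ge0 ?hb //.
      by have := lb 0%N z hz; rewrite expr1.
    have -> : k%:R * K ^+ k.+2 = \sum_(i < k) K ^+ k.+2.
      by rewrite sumr_const card_ord mulr_natl.
    elim/big_ind2 : _ => [|x1 x2 y1 y2 u v|i _]; first by rewrite cmod0.
      by apply: le_trans (cmodD _ _) _; apply: lerD.
    rewrite cmodM; have -> : k.+2 = (i.+1 + (k - i).+1)%N.
      by rewrite addSn addnS subnKC // ltnW.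
    by rewrite exprD; apply: ler_pM; rewrite ?cmod_ge0 ?lb ?ca.
  apply: (@le_trans _ _ (2 ^+ k * K ^+ k.+2)).
    by apply: ler_wpM2r; [rewrite exprn_ge0 ?ltW | exact: succ_le_exp2].
  apply: (@le_trans _ _ (K ^+ 2 * (2 * K) ^+ k)).
    by rewrite exprMn !exprS le_eqVlt; apply/orP; left; apply/eqP; ring.
  rewrite [leRHS]exprS; apply: ler_pM.
  - exact: ltW.
  - by rewrite exprn_ge0 // mulr_ge0 // ltW.
  - lra.
  - by apply: lerXn2r; rewrite ?nnegrE; lra.
Qed.

Lemma holoM f g p : holo_at f p -> holo_at g p -> holo_at (fun z => f z * g z) p.
Proof.
by move=> hf hg; have [a [h [b [l [K [tf tg]]]]]] := holo_taylor2 hf hg; have /taylor_holo := taylorM tf tg.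
Qed.

(** Adding 1/e to the constant confines the disc to |z-p| < e, where f and g agree. *)
Lemma taylor_eq f g p a h K e : taylor f p a h K -> 0 < e ->
  (forall z, cmod (z - p) < e -> f z = g z) -> taylor g p a h (K + e^-1).
Proof.
move=> tf e0 eqfg; have ei : 0 < e^-1 by rewrite invr_gt0.
have /(taylor_le tf) [K0 h0 hS hb] : K <= K + e^-1 by lra.
split => // z hz; rewrite h0 // eqfg //.
have [K1 _ _ _] := tf; have := cmod_ge0 (z - p) => ?.
rewrite -[ltRHS]mul1r -ltr_pdivrMr //; nra.
Qed.

Lemma holo_near f g p : (\forall z \near p, f z = g z) -> holo_at f p -> holo_at g p.
Proof.
move=> /nearCP [e [e0 eqfg]] /holo_taylor [a [h [K tf]]].
exact: taylor_holo (taylor_eq tf e0 eqfg).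
Qed.

Lemma holo_id (p : C) : holo_at id p.
Proof.
have [K tc] := taylor_cst 1 p; have [K' /taylor_holo hs] := taylor_shift tc.
apply: (@holo_near (fun z => (z - p) * 1 + p)); last exact: (holoD hs (holo_cst p p)).
by apply: filterE => z; rewrite mulr1 subrK.
Qed.

(** A geometric series in (z-p)/u with u = p - q: the remainders are (-1/u)^k / (z-q), and K = 2/|u|
    keeps z at distance at least |u|/2 from q. *)
Lemma holo_inv_sub (q p : C) : p != q -> holo_at (fun z => (z - q)^-1) p.
Proof.
move=> ne; pose u := p - q; have u0 : u != 0 by rewrite subr_eq0.
have nu : 0 < cmod u by exact: cmod_gt0.
have nui : 0 < (cmod u)^-1 by rewrite invr_gt0.
pose h k z := (- u^-1) ^+ k * (z - q)^-1.
have far z : cmod (z - p) * (2 / cmod u) < 1 -> cmod u / 2 <= cmod (z - q).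
  move=> hz; have /ltW {}hz : cmod (z - p) < cmod u / 2.
    by move: hz; rewrite mulrA ltr_pdivrMr // mul1r; lra.
  have : cmod u <= cmod (z - q) + cmod (z - p).
    by rewrite -[cmod (z - p)]cmodN -[u](_ : (z - q) + (- (z - p)) = _) ?cmodD // /u; ring.
  lra.
have nzq z : cmod (z - p) * (2 / cmod u) < 1 -> z - q != 0.
  move=> /far h1; apply/eqP => e; move: h1; rewrite e cmod0; lra.
apply: (@taylor_holo _ _ _ (fun k => (- u^-1) ^+ k / u) h (2 / cmod u)).
split=> [|z _|k z /nzq nz|k z hz]; first by rewrite divr_gt0.
- by rewrite /h expr0 mul1r.
- rewrite /h exprS.
  have -> : z - p = (z - q) - u by rewrite /u; ring.
  by field; rewrite nz u0.
- rewrite /h cmodM cmodX cmodN !cmodV exprSr; have zq := far z hz.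
  apply: ler_pM; rewrite ?exprn_ge0 ?invr_ge0 ?cmod_ge0 //.
    by apply: lerXn2r; rewrite ?nnegrE ?mulr_ge0 ?invr_ge0 ?cmod_ge0 //; lra.
  rewrite -[leRHS]invrK lef_pV2 ?posrE ?invr_gt0 ?divr_gt0 //; last lra.
  by rewrite invfM invrK mulrC.
Qed.

Lemma small_pt (e : R) : 0 < e -> exists d : C, d != 0 /\ cmod d < e.
Proof.
move=> e0; exists (((e / 2)%:C)%C); split.
  apply/eqP => /(congr1 (@cmod R)); rewrite cmod0 cmod_real ger0_norm; lra.
rewrite cmod_real ger0_norm; lra.
Qed.

Lemma taylor_cont f p a h K : taylor f p a h K -> forall k z, cmod (z - p) * K < 1 ->
  cmod (h k z - a k) <= cmod (z - p) * K ^+ k.+2.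
Proof.
move=> [K0 h0 hS hb] k z hz; rewrite hS // addrC addKr cmodM.
by apply: ler_wpM2l; rewrite ?cmod_ge0 ?hb.
Qed.

Lemma cmod_small_eq0 (x : C) (e B : R) : 0 < e ->
  (forall d : C, d != 0 -> cmod d < e -> cmod x <= cmod d * B) -> x = 0.
Proof.
move=> e0 h; apply/cmod_eq0/eqP; rewrite eq_le cmod_ge0 andbT.
apply/ler_addgt0Pr => t t0; rewrite add0r.
have B1 : 0 < `|B| + 1 by have := normr_ge0 B; lra.
have [|d [d0]] := @small_pt (Num.min e (t / (`|B| + 1))) _.
  by rewrite lt_min e0 divr_gt0.
rewrite lt_min => /andP [de dt]; apply: le_trans (h d d0 de) _.
move: dt; rewrite ltr_pdivlMr // => /ltW; apply: le_trans.
by apply: ler_wpM2l; [exact: cmod_ge0 | have := ler_norm B; lra].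
Qed.

(** Cancelling z - p determines the next remainder off p; its value at p follows because remainders
    are continuous there ([taylor_cont]). *)
Lemma taylor_uniq f p a h b l K : taylor f p a h K -> taylor f p b l K ->
  forall k, a k = b k /\ forall z, cmod (z - p) * K < 1 -> h k z = l k z.
Proof.
move=> tf tg; have [K0 h0 hS hb] := tf; have [_ l0 lS lb] := tg.
have hp : cmod (p - p) * K < 1 by rewrite subrr cmod0 mul0r ltr01.
suff H k : forall z, cmod (z - p) * K < 1 -> h k z = l k z.
  move=> k; split=> [|z]; last exact: H.
  by rewrite -(taylor_center tf) -(taylor_center tg) H.
elim: k => [|k ih] z hz; first by rewrite h0 ?l0.
have ak : a k = b k by rewrite -(taylor_center tf) -(taylor_center tg) ih.
have neq y : cmod (y - p) * K < 1 -> y - p != 0 -> h k.+1 y = l k.+1 y.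
  move=> hy ny; apply: (mulfI ny); apply: (addrI (a k)).
  by rewrite -hS // ak -lS // ih.
have [zp|] := eqVneq (z - p) 0; last exact: neq.
have -> : z = p by apply/eqP; rewrite -subr_eq0 zp.
rewrite (taylor_center tf) (taylor_center tg); apply/eqP; rewrite -subr_eq0; apply/eqP.
apply: (@cmod_small_eq0 _ K^-1 (2 * K ^+ k.+3)); first by rewrite invr_gt0.
move=> d d0 dK; have dp : p + d - p = d by rewrite addrC addKr.
have hd : cmod (p + d - p) * K < 1 by rewrite dp -ltr_pdivlMr // mul1r.
have := taylor_cont tf k.+1 hd; have := taylor_cont tg k.+1 hd.
rewrite (neq _ hd) ?dp // => u v.
have -> : a k.+1 - b k.+1 = (l k.+1 (p + d) - b k.+1) - (l k.+1 (p + d) - a k.+1) by ring.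
apply: (le_trans (cmodD _ _)); rewrite cmodN; lra.
Qed.

Lemma taylor_uniq_coef f p a h K b l L : taylor f p a h K -> taylor f p b l L -> a =1 b.
Proof.
move=> tf tg k; have [K0 _ _ _] := tf; have [L0 _ _ _] := tg.
have /(taylor_le tf) tf' : K <= K + L by lra.
have /(taylor_le tg) tg' : L <= K + L by lra.
by have [] := taylor_uniq tf' tg' k.
Qed.

Lemma taylor_flat f p a h K : taylor f p a h K -> (forall k, a k = 0) ->
  \forall z \near p, f z = 0.
Proof.
move=> tf a0; have [K0 h0 hS hb] := tf.
apply/nearCP; exists K^-1; split; first by rewrite invr_gt0.
move=> z hz; have {}hz : cmod (z - p) * K < 1 by rewrite -ltr_pdivlMr // mul1r.
apply/cmod_eq0/eqP; rewrite eq_le cmod_ge0 andbT; apply/ler_addgt0Pr => e e0.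
have [|N /(_ N (leqnn _)) hN] := geo_small K _ hz e0; first by rewrite mulr_ge0 ?cmod_ge0 ?ltW.
rewrite add0r; apply: le_trans (ltW hN).
rewrite (taylor_sum tf N hz) big1 ?add0r => [|i _]; last by rewrite a0 mul0r.
rewrite cmodM cmodX exprMn mulrCA -exprS.
by rewrite ler_wpM2l ?exprn_ge0 ?cmod_ge0 // hb.
Qed.

(** Divisibility by (z-p)^(k+1) makes the k-th Taylor coefficient vanish. This takes the place of
    continuity when the derivations of a stalk are classified. *)
Lemma holo_flat f p : holo_at f p ->
  (forall N, exists g, holo_at g p /\ \forall z \near p, f z = (z - p) ^+ N * g z) ->
  \forall z \near p, f z = 0.
Proof.
move=> /holo_taylor [a [h [K tf]]] fl; apply: (taylor_flat tf) => k.
have [g [/holo_taylor [b [l [L tg]]] /nearCP [e [e0 he]]]] := fl k.+1.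
suff [b' [l' [L' [tg' z0]]]] : exists b' l' L',
    taylor (fun z => (z - p) ^+ k.+1 * g z) p b' l' L' /\ forall i, (i < k.+1)%N -> b' i = 0.
  have tg'' := taylor_eq tg' e0 (fun z hz => esym (he z hz)).
  by rewrite (taylor_uniq_coef tf tg'') z0.
elim: (k.+1) => [|j [b' [l' [L' [/taylor_shift [L'' tg'] z0]]]]].
  exists b, l, L; split => //; have [L0 l0 lS lb] := tg; split => // z hz.
  by rewrite expr0 mul1r l0.
exists (fun k => if k is k'.+1 then b' k' else 0),
  (fun k z => if k is k'.+1 then l' k' z else (z - p) * ((z - p) ^+ j * g z)), L''; split.
  have [L0 l0 lS lb] := tg'; split => // z hz.
  by rewrite l0 // exprS mulrA.
by case=> // i; rewrite ltnS; exact: z0.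
Qed.

(** The quotient must be holomorphic on all of W in order to be a germ: at p its expansion is the
    shifted expansion of f, and elsewhere z - p is invertible. *)
Lemma holo_div f p (W : set C) : open W -> W p -> (forall q, W q -> holo_at f q) ->
  exists g, (forall q, W q -> holo_at g q) /\ forall z, f z = f p + (z - p) * g z.
Proof.
move=> oW Wp hf; have [a [h [K tf]]] := holo_taylor (hf p Wp).
have [K0 h0 hS hb] := tf.
pose g z := if z == p then a 1%N else (f z - f p) / (z - p).
have gE z : f z = f p + (z - p) * g z.
  rewrite /g; case: eqP => [->|/eqP ne]; first by rewrite subrr mul0r addr0.
  by rewrite mulrC divfK ?subr_eq0 // addrC subrK.
exists g; split; last exact: gE.
move=> q Wq; have [->|ne] := eqVneq q p.
  apply: (@taylor_holo _ _ _ (fun k => a k.+1) (fun k => h k.+1) (K + K ^+ 2)).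
  have K2 : 0 < K ^+ 2 by rewrite exprn_gt0.
  have lt z : cmod (z - p) * (K + K ^+ 2) < 1 -> cmod (z - p) * K < 1.
    by have := cmod_ge0 (z - p); nra.
  split=> [|z /lt hz|k z /lt hz|k z /lt hz]; first lra.
  - rewrite /g; case: eqP => [->|/eqP nz]; first by rewrite (taylor_center tf).
    rewrite (taylor_val tf) -(h0 z hz) (hS 0%N z hz); field; by rewrite subr_eq0.
  - exact: hS.
  - apply: le_trans (hb _ _ hz) _.
    have -> : K ^+ k.+2 = K ^+ 2 * K ^+ k by rewrite !exprS; ring.
    rewrite [leRHS]exprS; apply: ler_pM.
    - exact: ltW.
    - by rewrite exprn_ge0 // ltW.
    - lra.
    - by apply: lerXn2r; rewrite ?nnegrE; lra.
apply: (@holo_near (fun z => (f z + - f p) * (z - p)^-1)).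
  apply/nearCP; exists (cmod (q - p)); split; first by rewrite cmod_gt0 // subr_eq0.
  move=> z hz; rewrite /g; case: eqP => // zp; move: hz.
  by rewrite zp -cmodN opprB ltxx.
apply: holoM; last exact: holo_inv_sub.
by apply: holoD; [exact: hf | exact: holo_cst].
Qed.

(** The derivative is taken to be a Taylor coefficient, so that the algebraic rules are read off
    from the expansions; [taylor_uniq_coef] makes it independent of the expansion. Where f is not
    holomorphic it is a default value. *)
Definition dv (f : C -> C) (q : C) : C :=
  get [set b | exists a h K, taylor f q a h K /\ b = a 1%N].

Lemma dvE f q a h K : taylor f q a h K -> dv f q = a 1%N.
Proof.
move=> tf; rewrite /dv; case: xgetP => [b _ [a' [h' [K' [tf' ->]]]]|/(_ (a 1%N))].
  exact: taylor_uniq_coef tf' tf 1%N.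
by case; exists a, h, K.
Qed.

Lemma dv_cst (c q : C) : dv (fun=> c) q = 0.
Proof. by have [K /dvE] := taylor_cst c q. Qed.

Lemma dvD f g q : holo_at f q -> holo_at g q -> dv (fun z => f z + g z) q = dv f q + dv g q.
Proof.
move=> hf hg; have [a [h [b [l [K [tf tg]]]]]] := holo_taylor2 hf hg.
by rewrite (dvE (taylorD tf tg)) (dvE tf) (dvE tg).
Qed.

Lemma dvM f g q : holo_at f q -> holo_at g q ->
  dv (fun z => f z * g z) q = dv f q * g q + f q * dv g q.
Proof.
move=> hf hg; have [a [h [b [l [K [tf tg]]]]]] := holo_taylor2 hf hg.
rewrite (dvE (taylorM tf tg)) (dvE tf) (dvE tg) (taylor_val tf) (taylor_val tg).
by rewrite !big_ord_recr big_ord0 /= add0r addrC.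
Qed.

Lemma dv_near f g q : (\forall z \near q, f z = g z) -> holo_at f q -> dv f q = dv g q.
Proof.
move=> /nearCP [e [e0 he]] /holo_taylor [a [h [K tf]]].
by rewrite (dvE tf) (dvE (taylor_eq tf e0 he)).
Qed.

Lemma dv_id (q : C) : dv id q = 1.
Proof.
have [K tc] := taylor_cst 1 q; have [K' ts] := taylor_shift tc.
have h1 : holo_at (fun z : C => (z - q) * 1) q by exact: taylor_holo ts.
rewrite -(@dv_near (fun z => (z - q) * 1 + q) id).
- by rewrite (dvD h1 (holo_cst q q)) dv_cst (dvE ts) addr0.
- by apply: filterE => z; rewrite mulr1 subrK.
- exact: (holoD h1 (holo_cst q q)).
Qed.

(** Together with [taylor_lip], this replaces Cauchy's inequality in the proof that derivatives are
    holomorphic. *)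
Lemma dv_bound f q (e L : R) : holo_at f q -> 0 < e ->
  (forall z, cmod (z - q) < e -> cmod (f z - f q) <= cmod (z - q) * L) -> cmod (dv f q) <= L.
Proof.
move=> /holo_taylor [a [h [K tf]]] e0 lip; rewrite (dvE tf).
have [K0 h0 hS hb] := tf.
apply/ler_addgt0Pr => t t0.
have K3 : 0 < K ^+ 3 by rewrite exprn_gt0.
have [|d [d0]] := @small_pt (Num.min (Num.min e K^-1) (t / K ^+ 3)) _.
  by rewrite !lt_min e0 invr_gt0 K0 divr_gt0.
rewrite !lt_min => /andP [/andP [de dK] dt].
have dp : q + d - q = d by rewrite addrC addKr.
have hd : cmod (q + d - q) * K < 1 by rewrite dp -ltr_pdivlMr // mul1r.
have nd : 0 < cmod d by exact: cmod_gt0.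
have h1 : cmod (h 1%N (q + d)) <= L.
  have := lip (q + d); rewrite dp => /(_ de).
  rewrite (taylor_val tf) -(h0 _ hd) hS // addrC addKr dp cmodM.
  by rewrite ler_pM2l.
have := taylor_cont tf 1%N hd; rewrite dp => h2.
have h3 : cmod d * K ^+ 3 <= t by rewrite -ler_pdivlMr // ltW.
have -> : a 1%N = h 1%N (q + d) - (h 1%N (q + d) - a 1%N) by ring.
apply: (le_trans (cmodD _ _)); rewrite cmodN; lra.
Qed.

(** Unrolling the recursion N times at z and at q leaves z - q times a sum dominated by a geometric
    series of ratio at most 1/2, plus an error that tends to 0 with N. *)
Lemma taylor_lip f p a h K : taylor f p a h K -> forall k z q,
  cmod (z - p) * K <= 1 / 2 -> cmod (q - p) * K <= 1 / 2 ->
  cmod (h k z - h k q) <= cmod (z - q) * (2 * K ^+ k.+2).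
Proof.
move=> tf; have [K0 h0 hS hb] := tf; move=> k z q hz hq.
have hz' : cmod (z - p) * K < 1 by lra.
have hq' : cmod (q - p) * K < 1 by lra.
set w := q - p; set t := cmod w * K; have t0 : 0 <= t by rewrite mulr_ge0 ?cmod_ge0 ?ltW.
have tel N : h k z - h k q = (z - q) * (\sum_(j < N) w ^+ j * h (k + j).+1 z)
    + w ^+ N * (h (k + N)%N z - h (k + N)%N q).
  elim: N => [|N ->]; first by rewrite big_ord0 mulr0 add0r expr0 mul1r addn0.
  rewrite big_ord_recr /= (hS (k + N)%N z hz') (hS (k + N)%N q hq') addnS exprSr /w; ring.
apply/ler_addgt0Pr => e e0.
have t1 : t < 1 by rewrite /t /w; lra.
have [N /(_ N (leqnn _)) hN] := geo_small (2 * K ^+ k.+1) t0 t1 e0.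
rewrite (tel N); apply: (le_trans (cmodD _ _)); apply: lerD; last first.
  apply: le_trans (ltW hN).
  rewrite cmodM cmodX; apply: (@le_trans _ _ (cmod w ^+ N * (2 * K ^+ (k + N).+1))).
    apply: ler_wpM2l; first by rewrite exprn_ge0 ?cmod_ge0.
    apply: le_trans (cmodD _ _) _; rewrite cmodN.
    by have := hb (k + N)%N z hz'; have := hb (k + N)%N q hq'; lra.
  by rewrite /t exprMn -addSn exprD le_eqVlt; apply/orP; left; apply/eqP; ring.
rewrite cmodM; apply: ler_wpM2l; first exact: cmod_ge0.
apply: (@le_trans _ _ (\sum_(j < N) K ^+ k.+2 * t ^+ j)).
  elim/big_ind2 : _ => [|x1 x2 y1 y2 u v|j _]; first by rewrite cmod0.
    by apply: le_trans (cmodD _ _) _; apply: lerD.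
  rewrite cmodM cmodX /t exprMn mulrCA; apply: ler_wpM2l; first by rewrite exprn_ge0 ?cmod_ge0.
  by rewrite -exprD addSn addSn; exact: hb.
rewrite -mulr_sumr mulrC; apply: ler_wpM2r; first by rewrite exprn_ge0 // ltW.
by apply: geo_sum.
Qed.

(** Differentiating h_k = a_k + (z-p) h_(k+1) suggests (k+1) h_(k+1) + (z-p) h_(k+1)' as remainders
    of the derivative. The derivatives of the h_k are bounded by their Lipschitz constants on the
    disc of half the radius. *)
Lemma holo_dv f (W : set C) : open W -> (forall q, W q -> holo_at f q) ->
  forall p, W p -> holo_at (dv f) p.
Proof.
move=> oW hf p Wp; have [a [h [K0' tf0]]] := holo_taylor (hf p Wp).
have /nearCP [e [e0 he]] : \forall z \near p, W z by exact: open_nbhs_nbhs.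
have ei : 0 < e^-1 by rewrite invr_gt0.
pose K := K0' + e^-1.
have tf : taylor f p a h K by apply: (taylor_le tf0); rewrite /K; lra.
have [K00 _ _ _] := tf0.
have [K0 h0 hS hb] := tf.
have KW z : cmod (z - p) * K < 1 -> W z.
  move=> hz; apply: he; rewrite -[ltRHS]mul1r -ltr_pdivrMr //.
  by have := cmod_ge0 (z - p); rewrite /K in hz; nra.
have inball q : cmod (q - p) * K < 1 -> \forall z \near q, cmod (z - p) * K < 1.
  move=> hq; apply/nearCP; exists (K^-1 - cmod (q - p)); split.
    by rewrite subr_gt0 -[ltRHS]mul1r ltr_pdivlMr.
  move=> z hz; rewrite -ltr_pdivlMr // mul1r.
  have -> : z - p = (z - q) + (q - p) by ring.
  by apply: le_lt_trans (cmodD _ _) _; lra.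
have inball2 q : cmod (q - p) * (2 * K) < 1 -> exists d, 0 < d /\
    forall z, cmod (z - q) < d -> cmod (z - p) * K <= 1 / 2.
  move=> hq; exists ((2 * K)^-1 - cmod (q - p)); split.
    by rewrite subr_gt0 -[ltRHS]mul1r ltr_pdivlMr // mulr_gt0.
  move=> z hz; have lt : cmod (z - p) < (2 * K)^-1.
    have -> : z - p = (z - q) + (q - p) by ring.
    by apply: le_lt_trans (cmodD _ _) _; lra.
  have : cmod (z - p) * (2 * K) < 1 by rewrite -ltr_pdivlMr ?mulr_gt0 // mul1r.
  lra.
(* The remainders have to be differentiable on the whole disc: at p the expansion is shifted, at
   other points z - p can be divided out. *)
have hh k : forall q, cmod (q - p) * K < 1 -> holo_at (h k) q.
  elim: k => [|k ih] q hq.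
    apply: holo_near (hf q (KW q hq)).
    by move: (inball q hq); apply: filterS => z /h0.
  have [->|ne] := eqVneq q p.
    apply: (@taylor_holo _ _ _ (fun i => a (k.+1 + i)%N) (fun i => h (k.+1 + i)%N) (K + 1 + K ^+ k.+2)).
    have Kk : 0 < K ^+ k.+2 by rewrite exprn_gt0.
    have lt z : cmod (z - p) * (K + 1 + K ^+ k.+2) < 1 -> cmod (z - p) * K < 1.
      by have := cmod_ge0 (z - p); nra.
    split=> [|z hz|i z /lt hz|i z /lt hz]; first lra.
    - by rewrite addn0.
    - by rewrite addnS; exact: hS.
    - apply: le_trans (hb _ _ hz) _; rewrite -addSn exprD [leRHS]exprS.
      apply: ler_pM; [exact: ltW | by rewrite exprn_ge0 // ltW | lra |].
      by apply: lerXn2r; rewrite ?nnegrE; lra.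
  apply: (@holo_near (fun z => (h k z + - a k) * (z - p)^-1)).
    have [d [d0 hd]] : exists d, 0 < d /\ forall z, cmod (z - q) < d -> z != p.
      exists (cmod (q - p)); split; first by rewrite cmod_gt0 // subr_eq0.
      by move=> z; apply: contraTneq => ->; rewrite -cmodN opprB ltxx.
    have nz : \forall z \near q, z != p by apply/nearCP; exists d.
    near=> z; rewrite hS; first (rewrite addrC addKr mulrC mulKf // subr_eq0; near: z => //).
    near: z; exact: inball.
  apply: holoM; last exact: holo_inv_sub.
  by apply: holoD; [exact: ih | exact: holo_cst].
have dvh k q : cmod (q - p) * K < 1 -> dv (h k) q = h k.+1 q + (q - p) * dv (h k.+1) q.
  move=> hq.
  have hsub : holo_at (fun z : C => z + - p) q by apply: holoD; [exact: holo_id | exact: holo_cst].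
  rewrite (@dv_near (h k) (fun z => a k + (z + - p) * h k.+1 z)).
  - have hk1 := hh k.+1 q hq.
    rewrite (dvD (holo_cst _ _) (holoM hsub hk1)) dv_cst add0r (dvM hsub hk1).
    by rewrite (dvD (holo_id q) (holo_cst _ _)) dv_id dv_cst addr0 mul1r.
  - by move: (inball q hq); apply: filterS => z hz; rewrite hS.
  - exact: hh.
have dvb k q : cmod (q - p) * (2 * K) < 1 -> cmod (dv (h k) q) <= 2 * K ^+ k.+2.
  move=> hq; have [d [d0 hd]] := inball2 q hq.
  apply: (@dv_bound _ _ d) => //; first by apply: hh; have := cmod_ge0 (q - p); nra.
  by move=> z hz; apply: (taylor_lip tf); apply: hd => //; rewrite subrr cmod0.
(* The summand 2K halves the radius, as [dvb] requires. The bound (k+3) K^(k+2), with k+3 <= 3 2^k,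
   accounts for 3 K^2. *)
pose K' := 2 * K + 3 * K ^+ 2.
have K2 : 0 < K ^+ 2 by rewrite exprn_gt0.
have lt2 z : cmod (z - p) * K' < 1 -> cmod (z - p) * (2 * K) < 1.
  by rewrite /K'; have := cmod_ge0 (z - p); nra.
have lt z : cmod (z - p) * K' < 1 -> cmod (z - p) * K < 1.
  by rewrite /K'; have := cmod_ge0 (z - p); nra.
apply: (@taylor_holo _ _ _ (fun k => k.+1%:R * a k.+1)
  (fun k z => k.+1%:R * h k.+1 z + (z - p) * dv (h k.+1) z) K').
split=> [|z hz|k z hz|k z hz]; first by rewrite /K'; lra.
- rewrite mul1r -dvh ?lt //; apply: dv_near; last by apply: hh; exact: lt.
  by move: (inball z (lt z hz)); apply: filterS => y /h0.
- rewrite (hS k.+1) ?lt // (dvh k.+1) ?lt // -[k.+2%:R]natr1; ring.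
- apply: (@le_trans _ _ (k.+3%:R * K ^+ k.+2)).
    apply: (le_trans (cmodD _ _)); rewrite !cmodM cmod_nat.
    have u := hb k.+1 z (lt z hz); have v := dvb k.+1 z (lt2 z hz).
    have := cmod_ge0 (z - p); have := cmod_ge0 (dv (h k.+1) z) => y1 y2.
    have -> : (k.+3%:R : R) = k.+1%:R + 2 by rewrite -!natr1; ring.
    rewrite mulrDl; apply: lerD; first by rewrite ler_wpM2l.
    apply: (@le_trans _ _ (cmod (z - p) * (2 * K ^+ k.+3))); first by rewrite ler_wpM2l.
    rewrite exprSr; have : 0 < K ^+ k.+2 by rewrite exprn_gt0.
    have := lt2 z hz; nra.
  have hk : (k.+3%:R : R) <= 3 * 2 ^+ k.
    have := succ_le_exp2 k; rewrite -(natr1 k.+2) -(natr1 k.+1).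
    have : (1 : R) <= 2 ^+ k by apply: exprn_ege1; lra.
    lra.
  apply: (@le_trans _ _ (3 * 2 ^+ k * K ^+ k.+2)).
    by apply: ler_wpM2r; rewrite ?exprn_ge0 // ltW.
  have -> : 3 * 2 ^+ k * K ^+ k.+2 = (3 * K ^+ 2) * (2 * K) ^+ k.
    by rewrite exprMn !exprS; ring.
  rewrite [leRHS]exprS; apply: ler_pM.
  - by rewrite mulr_ge0 // ltW.
  - by rewrite exprn_ge0 // mulr_ge0 // ltW.
  - by rewrite /K'; lra.
  - by apply: lerXn2r; rewrite ?nnegrE /K'; lra.
Unshelve. all: by end_near.
Qed.

End HoloAlgebra.

(** * Functions with values in A_m *)

Section SqzTheory.
Context (K : comNzRingType) (m : nat).
Implicit Types (s t : sqz K m).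

Lemma sqz_eq s t : s.1 = t.1 -> (forall l, s.2 ord0 l = t.2 ord0 l) -> s = t.
Proof.
case: s t => [a u] [b v] /= -> h; congr pair.
by apply/rowP.
Qed.

Lemma sqz1D s t : (s + t).1 = s.1 + t.1. Proof. by []. Qed.
Lemma sqz2D s t l : (s + t).2 ord0 l = s.2 ord0 l + t.2 ord0 l.
Proof. by rewrite mxE. Qed.
Lemma sqz1N s : (- s).1 = - s.1. Proof. by []. Qed.
Lemma sqz2N s l : (- s).2 ord0 l = - s.2 ord0 l.
Proof. by rewrite mxE. Qed.
Lemma sqz10 : (0 : sqz K m).1 = 0. Proof. by []. Qed.
Lemma sqz20 l : (0 : sqz K m).2 ord0 l = 0. Proof. by rewrite mxE. Qed.
Lemma sqz1M s t : (s * t).1 = s.1 * t.1. Proof. by []. Qed.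
Lemma sqz2M s t l : (s * t).2 ord0 l = s.1 * t.2 ord0 l + t.1 * s.2 ord0 l.
Proof. by rewrite !mxE. Qed.
Lemma sqz11 : (1 : sqz K m).1 = 1. Proof. by []. Qed.
Lemma sqz21 l : (1 : sqz K m).2 ord0 l = 0. Proof. by rewrite mxE. Qed.

Definition sqzE := (sqz1D, sqz2D, sqz1N, sqz2N, sqz10, sqz20, sqz1M, sqz2M, sqz11, sqz21).

Lemma sqz1_sum (I : Type) (r : seq I) (F : I -> sqz K m) :
  (\sum_(i <- r) F i).1 = \sum_(i <- r) (F i).1.
Proof. by elim: r => [|i r ih]; rewrite ?big_nil // !big_cons sqz1D ih. Qed.

Lemma sqz2_sum (I : Type) (r : seq I) (F : I -> sqz K m) l :
  (\sum_(i <- r) F i).2 ord0 l = \sum_(i <- r) (F i).2 ord0 l.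
Proof.
elim: r => [|i r ih]; first by rewrite !big_nil sqz20.
by rewrite !big_cons sqz2D ih.
Qed.

Definition mk (a : K) (b : 'I_m -> K) : sqz K m := (a, \row_l b l).

Lemma mk1 a b : (mk a b).1 = a. Proof. by []. Qed.
Lemma mk2 a b l : (mk a b).2 ord0 l = b l. Proof. by rewrite mxE. Qed.

Lemma mk_eta s : mk s.1 (fun l => s.2 ord0 l) = s.
Proof. by apply: sqz_eq => // l; rewrite mk2. Qed.

End SqzTheory.

Lemma near_openP (T : topologicalType) (p : T) (P : T -> Prop) :
  (\forall z \near p, P z) <-> exists O, [/\ open O, O p & forall z, O z -> P z].
Proof.
split=> [h|[O [oO Op OP]]].
  exists (interior [set z | P z]); split; [exact: open_interior | exact: h |].
  by move=> z /interior_subset.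
by apply: filterS (open_nbhs_nbhs (conj oO Op)).
Qed.

Section HoloA.
Context (R : realType) (m : nat).
Local Notation C := (Cx R).
Implicit Types (f g : C -> A R m) (p : C) (W : set C).

Lemma holoA_onD W f g : holoA_on W f -> holoA_on W g -> holoA_on W (fun z => f z + g z).
Proof.
move=> hf hg p Wp; have [f1 f2] := hf p Wp; have [g1 g2] := hg p Wp.
split; first exact: holoD f1 g1.
move=> i; under eq_fun do rewrite sqz2D; exact: holoD (f2 i) (g2 i).
Qed.

Lemma holoA_onM W f g : holoA_on W f -> holoA_on W g -> holoA_on W (fun z => f z * g z).
Proof.
move=> hf hg p Wp; have [f1 f2] := hf p Wp; have [g1 g2] := hg p Wp.
split; first exact: holoM f1 g1.
move=> i; under eq_fun do rewrite sqz2M.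
exact: holoD (holoM f1 (g2 i)) (holoM g1 (f2 i)).
Qed.

Lemma holoA_on_cst W (a : A R m) : holoA_on W (fun=> a).
Proof. by move=> p _; split=> [|i]; exact: holo_cst. Qed.

Lemma holoA_on_sub W W' f : W' `<=` W -> holoA_on W f -> holoA_on W' f.
Proof. by move=> sub hf p /sub; exact: hf. Qed.

Lemma holoA_near2 p f g : holoA_near p f -> holoA_near p g ->
  exists W, [/\ open W, W p, holoA_on W f & holoA_on W g].
Proof.
move=> [W [oW Wp hf]] [W' [oW' Wp' hg]]; exists (W `&` W'); split.
- exact: openI.
- by split.
- by apply: holoA_on_sub hf => z [].
- by apply: holoA_on_sub hg => z [].
Qed.

Lemma holoA_nearD p f g : holoA_near p f -> holoA_near p g ->
  holoA_near p (fun z => f z + g z).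
Proof.
move=> hf hg; have [W [oW Wp wf wg]] := holoA_near2 hf hg.
by exists W; split; [exact: oW | exact: Wp | exact: holoA_onD].
Qed.

Lemma holoA_nearM p f g : holoA_near p f -> holoA_near p g ->
  holoA_near p (fun z => f z * g z).
Proof.
move=> hf hg; have [W [oW Wp wf wg]] := holoA_near2 hf hg.
by exists W; split; [exact: oW | exact: Wp | exact: holoA_onM].
Qed.

Lemma holoA_near_cst p (a : A R m) : holoA_near p (fun=> a).
Proof.
exists setT; split; [exact: openT | exact: I | exact: holoA_on_cst].
Qed.

(** In a coordinate of a family, these are the functions pulled back from the reduced curve by the
    trivialization which that coordinate defines. *)
Definition epsfree (h : C -> C) : C -> A R m := fun z => acst m (h z).

Lemma holoA_on_epsfree W h : (forall p, W p -> holo_at h p) -> holoA_on W (epsfree h).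
Proof.
move=> hh p Wp; split; first exact: hh.
by move=> i; under eq_fun do rewrite mxE; exact: holo_cst.
Qed.

Lemma holoA_on1 W f : holoA_on W f -> forall p, W p -> holo_at (fun z => (f z).1) p.
Proof. by move=> hf p /hf[]. Qed.

Lemma holoA_on2 W f l : holoA_on W f -> forall p, W p -> holo_at (fun z => (f z).2 ord0 l) p.
Proof. by move=> hf p /hf[_]; apply. Qed.

End HoloA.

(** * Charts and coordinates *)

Section Charts.
Context (R : realType) (X : topologicalType) (n : nat) (c : 'I_n -> X) (m : nat).
Context (P : curve R c m).

Section OneChart.
Context (U : set X) (phi : X -> Cx R) (G : forall y, (Cx R -> A R m) -> stalk P y).
Hypothesis ch : is_chart (@str _ _ _ _ _ P) (sect P) U phi G.
Implicit Types (f g : Cx R -> A R m).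

Lemma chart_open : open U. Proof. by case: ch => [[]]. Qed.

Lemma chart_img V : open V -> V `<=` U -> open (phi @` V).
Proof. by case: ch => [[_ h _ _] _ _]; exact: h. Qed.

Lemma chart_pre W : open W -> open (U `&` phi @^-1` W).
Proof. by case: ch => [[_ _ h _] _ _]; exact: h. Qed.

Lemma chart_str y a : U y -> G y (fun=> a) = str P y a.
Proof. by case: ch => [_ h _] /h []. Qed.

Lemma chartD y f g : U y -> holoA_near (phi y) f -> holoA_near (phi y) g ->
  G y (fun z => f z + g z) = G y f + G y g.
Proof. by case: ch => [_ h _] /h [_ + _ _ _]; apply. Qed.

Lemma chartM y f g : U y -> holoA_near (phi y) f -> holoA_near (phi y) g ->
  G y (fun z => f z * g z) = G y f * G y g.
Proof. by case: ch => [_ h _] /h [_ _ + _ _]; apply. Qed.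

Lemma chart0 y f : U y -> holoA_near (phi y) f ->
  (G y f = 0 <-> \forall z \near phi y, f z = 0).
Proof. by case: ch => [_ h _] /h [_ _ _ + _]; apply. Qed.

Lemma chart_surj y a : U y -> exists f, holoA_near (phi y) f /\ G y f = a.
Proof. by case: ch => [_ h _] /h [_ _ _ _]; apply. Qed.

Lemma chart_sect V s : open V -> V `<=` U ->
  (sect P V s <-> exists f, holoA_on (phi @` V) f /\ forall y, V y -> s y = G y f).
Proof. by case: ch => _ _; apply. Qed.

Lemma chart_near V y f : open V -> V `<=` U -> V y -> holoA_on (phi @` V) f ->
  holoA_near (phi y) f.
Proof.
move=> oV VU Vy hf; exists (phi @` V); split; [exact: chart_img | by exists y | exact: hf].
Qed.

(** The chart axioms characterize zero germs only, so equality is reduced to them by subtracting,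
    with -1 as a constant function. *)
Lemma chart_eq y f g : U y -> holoA_near (phi y) f -> holoA_near (phi y) g ->
  (G y f = G y g <-> \forall z \near phi y, f z = g z).
Proof.
move=> Uy hf hg; have hm : holoA_near (phi y) (fun z => (fun=> -1) z * g z).
  by apply: holoA_nearM hg; exact: holoA_near_cst.
have e : G y (fun z => f z + -1 * g z) = G y f - G y g.
  rewrite (chartD Uy hf hm) (chartM Uy (holoA_near_cst _ _) hg) chart_str // rmorphN1.
  by rewrite mulN1r.
have [h1 h2] := chart0 Uy (holoA_nearD hf hm).
split.
  move=> eq; move: h1; rewrite e eq subrr => /(_ erefl).
  by apply: filterS => z; rewrite mulN1r => /eqP; rewrite subr_eq0 => /eqP.
move=> h; apply/eqP; rewrite -subr_eq0 -e; apply/eqP; apply: h2.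
by move: h; apply: filterS => z ->; rewrite mulN1r subrr.
Qed.

Lemma chart_nbhd y (W : set (Cx R)) : U y -> open W -> W (phi y) ->
  exists V, [/\ open V, V y, V `<=` U & phi @` V `<=` W].
Proof.
move=> Uy oW Wy; exists (U `&` phi @^-1` W); split.
- exact: chart_pre.
- by split.
- by move=> z [].
- by move=> _ [z [_ Wz] <-].
Qed.

Lemma chart_sub V : open V -> V `<=` U -> is_chart (@str _ _ _ _ _ P) (sect P) V phi G.
Proof.
case: ch => [[oU img pre inj] loc sec] oV VU; split.
- split => //.
  + by move=> V' oV' sub; apply: img => // y /sub/VU.
  + move=> W oW; rewrite (_ : V `&` phi @^-1` W = V `&` (U `&` phi @^-1` W)).
      by apply: openI => //; exact: pre.
    by apply/seteqP; split => y [] // Vy; [split => //; split => //; exact: VU | case].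
  + by move=> y y' /VU Uy /VU; exact: inj.
- by move=> y /VU; exact: loc.
- by move=> V' s oV' sub; apply: sec => // y /sub/VU.
Qed.

Lemma chart_sum y k (F : 'I_k -> Cx R -> A R m) : U y ->
  (forall l, holoA_near (phi y) (F l)) ->
  holoA_near (phi y) (fun z => \sum_l F l z) /\
  G y (fun z => \sum_l F l z) = \sum_l G y (F l).
Proof.
move=> Uy; elim: k F => [|k ih] F hF.
  under eq_fun do rewrite big_ord0.
  by rewrite big_ord0 chart_str // rmorph0; split => //; exact: holoA_near_cst.
under eq_fun do rewrite big_ord_recl.
have [h1 h2] := ih (fun l => F (lift ord0 l)) (fun l => hF _).
split; first exact: (holoA_nearD (hF ord0) h1).
by rewrite big_ord_recl (chartD Uy (hF _) h1) h2.
Qed.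

Lemma chart_decomp y f : U y -> holoA_near (phi y) f ->
  G y f = G y (epsfree m (fun z => (f z).1)) +
    \sum_l str P y (aeps R l) * G y (epsfree m (fun z => (f z).2 ord0 l)).
Proof.
move=> Uy hf; have [W [oW Wy wf]] := hf.
have h0 : holoA_near (phi y) (epsfree m (fun z => (f z).1)).
  by exists W; split; [exact: oW | exact: Wy | exact/holoA_on_epsfree/holoA_on1].
have h1 l : holoA_near (phi y) (epsfree m (fun z => (f z).2 ord0 l)).
  by exists W; split; [exact: oW | exact: Wy | exact/holoA_on_epsfree/holoA_on2].
have h2 l := holoA_nearM (holoA_near_cst (phi y) (aeps R l)) (h1 l).
have [h3 e3] := chart_sum Uy h2.
have -> : \sum_l str P y (aeps R l) * G y (epsfree m (fun z => (f z).2 ord0 l)) =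
    G y (fun z => \sum_l (aeps R l * epsfree m (fun z => (f z).2 ord0 l) z)).
  rewrite e3; apply: eq_bigr => l _.
  by rewrite (chartM Uy (holoA_near_cst _ _) (h1 l)) chart_str.
rewrite -(chartD Uy h0 h3); congr (G y _); apply/funext => z.
apply: sqz_eq => [|l]; first by rewrite !sqzE sqz1_sum big1 ?addr0 // => i _; rewrite sqzE mul0r.
rewrite sqzE sqz2_sum /epsfree /= mxE add0r (bigD1 l) //= big1 ?addr0 => [|i ne].
  by rewrite !mxE !eqxx mul0r add0r mulr1.
by rewrite !mxE eqxx /= eq_sym (negbTE ne) mul0r mulr0 addr0.
Qed.

End OneChart.

Lemma sect_local U s : open U ->
  (forall x, U x -> exists V, [/\ open V, V x & forall V', open V' -> V' `<=` V -> V' `<=` U -> sect P V' s]) ->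
  sect P U s.
Proof.
move=> oU h; apply: sect_glue => // x Ux; have [V [oV Vx hV]] := h x Ux.
exists (U `&` V); split; [exact: openI | by split | by move=> y [] |].
by apply: hV; [exact: openI | move=> y [] | move=> y []].
Qed.

Lemma sectD U s t : open U -> sect P U s -> sect P U t -> sect P U (fun x => s x + t x).
Proof.
move=> oU hs ht; apply: sect_local => // x Ux.
have [W [phi [G [Wx ch]]]] := curve_chart P x.
exists W; split => // [|V oV VW VU]; first exact: chart_open ch.
have [f [hf ef]] := (chart_sect ch s oV VW).1 (sect_res oU oV VU hs).
have [g [hg eg]] := (chart_sect ch t oV VW).1 (sect_res oU oV VU ht).
apply/(chart_sect ch) => //; exists (fun z => f z + g z); split; first exact: (holoA_onD hf hg).
move=> y Vy; rewrite ef // eg // (chartD ch (VW y Vy)) //; exact: (chart_near ch oV VW Vy).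
Qed.

Lemma sectM U s t : open U -> sect P U s -> sect P U t -> sect P U (fun x => s x * t x).
Proof.
move=> oU hs ht; apply: sect_local => // x Ux.
have [W [phi [G [Wx ch]]]] := curve_chart P x.
exists W; split => // [|V oV VW VU]; first exact: chart_open ch.
have [f [hf ef]] := (chart_sect ch s oV VW).1 (sect_res oU oV VU hs).
have [g [hg eg]] := (chart_sect ch t oV VW).1 (sect_res oU oV VU ht).
apply/(chart_sect ch) => //; exists (fun z => f z * g z); split; first exact: (holoA_onM hf hg).
move=> y Vy; rewrite ef // eg // (chartM ch (VW y Vy)) //; exact: (chart_near ch oV VW Vy).
Qed.

Lemma sect_str U a : open U -> sect P U (fun x => str P x a).
Proof.
move=> oU; apply: sect_local => // x Ux.
have [W [phi [G [Wx ch]]]] := curve_chart P x.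
exists W; split => // [|V oV VW VU]; first exact: chart_open ch.
apply/(chart_sect ch) => //; exists (fun=> a); split; first exact: (@holoA_on_cst _ _ _ a).
by move=> y /VW Wy; rewrite (chart_str ch).
Qed.

Lemma sect0 U : open U -> sect P U (fun x => 0).
Proof.
move=> oU; apply: sect_ext (sect_str 0 oU) => x _; exact: rmorph0.
Qed.

Lemma sectN U s : open U -> sect P U s -> sect P U (fun x => - s x).
Proof.
move=> oU hs; apply: sect_ext (sectM oU (sect_str (-1) oU) hs) => x _.
by rewrite rmorphN1 mulN1r.
Qed.

Lemma sectB U s t : open U -> sect P U s -> sect P U t -> sect P U (fun x => s x - t x).
Proof. by move=> oU hs ht; apply: sectD => //; exact: sectN. Qed.

Lemma sect_sum U k (F : 'I_k -> forall x, stalk P x) : open U ->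
  (forall l, sect P U (F l)) -> sect P U (fun x => \sum_l F l x).
Proof.
move=> oU; elim: k F => [|k ih] F hF.
  by apply: sect_ext (sect0 oU) => x _; rewrite big_ord0.
apply: sect_ext (sectD oU (hF ord0) (ih (fun l => F (lift ord0 l)) _)) => [x _|l].
  by rewrite big_ord_recl.
exact: hF.
Qed.

(** Equality in one stalk spreads to a neighbourhood, because in a chart equality of germs is
    equality of functions near the point. *)
Lemma sect_agree U s t x : open U -> sect P U s -> sect P U t -> U x -> s x = t x ->
  exists V, [/\ open V, V x, V `<=` U & forall y, V y -> s y = t y].
Proof.
move=> oU hs ht Ux est; have [W [phi [G [Wx ch]]]] := curve_chart P x.
have oW := chart_open ch; have oV : open (U `&` W) by exact: openI.
have VW : U `&` W `<=` W by move=> y [].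
have Vx : (U `&` W) x by [].
have VU : U `&` W `<=` U by move=> y [].
have [f [hf ef]] := (chart_sect ch s oV VW).1 (sect_res oU oV VU hs).
have [g [hg eg]] := (chart_sect ch t oV VW).1 (sect_res oU oV VU ht).
have nf y (Vy : (U `&` W) y) := chart_near ch oV VW Vy hf.
have ng y (Vy : (U `&` W) y) := chart_near ch oV VW Vy hg.
have : \forall z \near phi x, f z = g z by apply/(chart_eq ch) => //; [exact: nf | exact: ng | rewrite -ef // -eg].
move=> /near_openP [O [oO Ox OE]].
have [V [oV' V'x V'W V'O]] := chart_nbhd ch Wx oO Ox.
exists (V `&` U); split; [exact: openI | by [] | by move=> y [] |].
move=> y [V'y Uy]; have Vy : (U `&` W) y by split => //; exact: V'W.
rewrite ef // eg //; apply/(chart_eq ch); [exact: V'W | exact: nf | exact: ng |].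
apply/near_openP; exists O; split=> //.
by apply: V'O; exists y.
Qed.

Lemma germ_ext x (a : stalk P x) : exists V s, [/\ open V, V x, sect P V s & s x = a].
Proof.
have [W [phi [G [Wx ch]]]] := curve_chart P x.
have [f [[O [oO Ox hf]] fa]] := chart_surj ch a Wx.
have [V [oV Vx VW VO]] := chart_nbhd ch Wx oO Ox.
exists V, (fun y => G y f); split=> //.
apply/(chart_sect ch) => //; exists f; split => //; exact: holoA_on_sub VO hf.
Qed.

End Charts.

Section Coordinates.
Context (R : realType) (X : topologicalType) (n : nat) (c : 'I_n -> X).
Context (S : curve R c 0).

Lemma A0_eq (a b : A R 0) : a.1 = b.1 -> a = b.
Proof. by move=> h; apply: sqz_eq => // -[]. Qed.

(** What the study of vector fields, forms and marked points takes from a chart: the function z, the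
    field d = d/dz that spans all derivations, and division by z - z(y) to first order. The last
    clause ties the algebra map [along] to the position of the marked point. *)
Definition is_coord (W : set X) (phi : X -> Cx R) (z : forall y, stalk S y) (d : vfield S) :=
  [/\ open W, sect S W z, is_vfield W d,
      forall y, W y -> [/\ d y (z y) = 1,
        forall D : vec S y, is_vec D -> forall a, D a = D (z y) * d y a &
        forall a, exists k b, a = str S y (acst 0 k) + (z y - str S y (acst 0 (phi y))) * b] &
      forall i, W (c i) -> along S i (z (c i)) = acst 0 (phi (c i))].

Lemma is_coord_sub W W' phi z d : open W' -> W' `<=` W -> is_coord W phi z d ->
  is_coord W' phi z d.
Proof.
move=> oW' sub [oW sz [vd sd] dd al]; split => //.
- exact: sect_res sz.
- split=> [x /sub/vd //|V s oV VW']; apply: sd => //; exact: subset_trans sub.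
- by move=> y /sub/dd.
- by move=> i /sub/al.
Qed.

Section OneChart.
Context (U : set X) (phi : X -> Cx R) (G : forall y, (Cx R -> A R 0) -> stalk S y).
Hypothesis ch : is_chart (@str _ _ _ _ _ S) (sect S) U phi G.
Implicit Types (f g : Cx R -> A R 0).

Let zc y : stalk S y := G y (epsfree 0 id).
(** This is d/dz on germs through a chosen representative; every germ over the chart has one, and
    [dcE] shows that the choice does not matter. *)
Let dc : vfield S := fun y a =>
  G y (epsfree 0 (dv (fun z => (xget (fun=> 0) [set f | holoA_near (phi y) f /\ G y f = a] z).1))).

Lemma holoA_dv p f : holoA_near p f -> holoA_near p (epsfree 0 (dv (fun z => (f z).1))).
Proof.
move=> [W [oW Wp hf]]; exists W; split; [exact: oW | exact: Wp |].
apply: holoA_on_epsfree => q Wq; exact: (holo_dv oW (holoA_on1 hf)).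
Qed.

Lemma holoA_id p : holoA_near p (epsfree 0 (@id (Cx R))).
Proof.
exists setT; split; [exact: openT | exact: I |].
by apply: holoA_on_epsfree => q _; exact: holo_id.
Qed.

Lemma dcE y f : U y -> holoA_near (phi y) f ->
  @dc y (G y f) = G y (epsfree 0 (dv (fun z => (f z).1))).
Proof.
move=> Uy hf; rewrite /dc; case: xgetP => [g _ [hg gf]|/(_ f)]; last by case.
apply/(chart_eq ch); [exact: Uy | exact: holoA_dv | exact: holoA_dv |].
have /near_openP [O [oO Op OE]] := (chart_eq ch Uy hg hf).1 gf.
have [W [oW Wp hgW]] := hg.
apply/near_openP; exists (O `&` W); split; [exact: openI | by split |].
move=> z [Oz Wz]; rewrite /epsfree; congr acst; apply: dv_near; last exact: (holoA_on1 hgW).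
by apply/near_openP; exists O; split => // w /OE ->.
Qed.

Lemma epsfree1 f : epsfree 0 (fun z => (f z).1) = f.
Proof. by apply/funext => z; exact: A0_eq. Qed.

Lemma dc_vec y : U y -> is_vec (@dc y).
Proof.
move=> Uy; split.
- move=> a b; have [f [hf <-]] := chart_surj ch a Uy; have [g [hg <-]] := chart_surj ch b Uy.
  rewrite -(chartD ch Uy hf hg) (dcE Uy (holoA_nearD hf hg)) (dcE Uy hf) (dcE Uy hg).
  rewrite -(chartD ch Uy (holoA_dv hf) (holoA_dv hg)).
  apply/(chart_eq ch); [exact: Uy | exact: (holoA_dv (holoA_nearD hf hg)) |
    exact: (holoA_nearD (holoA_dv hf) (holoA_dv hg)) |].
  have [W [oW Wp hfW hgW]] := holoA_near2 hf hg.
  apply/near_openP; exists W; split; [exact: oW | exact: Wp |] => z Wz.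
  apply: A0_eq; exact: (dvD (holoA_on1 hfW Wz) (holoA_on1 hgW Wz)).
- move=> a b; have [f [hf <-]] := chart_surj ch a Uy; have [g [hg <-]] := chart_surj ch b Uy.
  have df := holoA_dv hf; have dg := holoA_dv hg.
  rewrite -(chartM ch Uy hf hg) (dcE Uy (holoA_nearM hf hg)) (dcE Uy hf) (dcE Uy hg).
  rewrite -(chartM ch Uy df hg) -(chartM ch Uy hf dg).
  rewrite -(chartD ch Uy (holoA_nearM df hg) (holoA_nearM hf dg)).
  apply/(chart_eq ch); [exact: Uy | exact: (holoA_dv (holoA_nearM hf hg)) |
    exact: (holoA_nearD (holoA_nearM df hg) (holoA_nearM hf dg)) |].
  have [W [oW Wp hfW hgW]] := holoA_near2 hf hg.
  apply/near_openP; exists W; split; [exact: oW | exact: Wp |] => z Wz.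
  apply: A0_eq; exact: (dvM (holoA_on1 hfW Wz) (holoA_on1 hgW Wz)).
- move=> k; rewrite -(chart_str ch) // (dcE Uy (holoA_near_cst _ _)).
  have -> : epsfree 0 (dv (fun z : Cx R => ((fun=> k) z).1)) = fun=> 0.
    by apply/funext => z; apply: A0_eq; exact: dv_cst.
  by rewrite (chart_str ch) // rmorph0.
Qed.

Lemma dc_vfield : is_vfield U (@dc).
Proof.
split; first exact: dc_vec.
move=> V s oV VU ss; have [f [hf ef]] := (chart_sect ch s oV VU).1 ss.
apply/(chart_sect ch) => //; exists (epsfree 0 (dv (fun z => (f z).1))); split.
  apply: holoA_on_epsfree => q Wq.
  exact: (holo_dv (chart_img ch oV VU) (holoA_on1 hf)).
move=> y Vy; rewrite ef // dcE //; [exact: VU | exact: (chart_near ch oV VU Vy hf)].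
Qed.

Lemma dc_z y : U y -> @dc y (zc y) = 1.
Proof.
move=> Uy; rewrite /zc (dcE Uy (holoA_id _)).
have -> : epsfree 0 (dv (fun z => (epsfree 0 (@id (Cx R)) z).1)) = fun=> 1.
  by apply/funext => z; apply: A0_eq; exact: dv_id.
by rewrite (chart_str ch) // rmorph1.
Qed.

Lemma zc_div y a : U y -> exists k b, a = str S y (acst 0 k) + (zc y - str S y (acst 0 (phi y))) * b.
Proof.
move=> Uy; have [f [[W [oW Wp hf]] <-]] := chart_surj ch a Uy.
have [g [hg eg]] := holo_div oW Wp (holoA_on1 hf).
have hgA : holoA_near (phi y) (epsfree 0 g).
  by exists W; split; [exact: oW | exact: Wp | exact: holoA_on_epsfree].
exists (f (phi y)).1, (G y (epsfree 0 g)).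
have hc a' := holoA_near_cst (phi y) (a' : A R 0).
have hzp := holoA_nearD (holoA_id (phi y)) (hc (- acst 0 (phi y))).
rewrite -rmorphN -!(chart_str ch _ Uy) /zc -(chartD ch Uy (holoA_id _) (hc _)).
rewrite -(chartM ch Uy hzp hgA) -(chartD ch Uy (hc _) (holoA_nearM hzp hgA)).
congr (G y _); apply/funext => z; apply: A0_eq; exact: eg.
Qed.

(** Writing a = k + (z-p) b gives E a = (z-p) E b. By iteration E a is divisible by every power of z
    - p, and such a holomorphic germ vanishes. *)
Lemma der_flat y (E : vec S y) : U y -> is_vec E -> E (zc y) = 0 -> forall a, E a = 0.
Proof.
move=> Uy [eD eM eK] ez a.
have fl N : forall a, exists b, E a = (zc y - str S y (acst 0 (phi y))) ^+ N * b.
  elim: N => [|N ih] {}a; first by exists (E a); rewrite expr0 mul1r.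
  have [k [b ->]] := zc_div a Uy; have [b' eb'] := ih b.
  exists b'; rewrite eD eK add0r eM.
  have -> : E (zc y - str S y (acst 0 (phi y))) = 0.
    by rewrite -rmorphN eD eK ez addr0.
  by rewrite mul0r add0r eb' exprS mulrA.
have [f [hf ef]] := chart_surj ch (E a) Uy.
rewrite -ef; apply/(chart0 ch Uy hf).
have [W [oW Wp hfW]] := hf.
suff: \forall z \near phi y, (f z).1 = 0 by apply: filterS => z h; apply: A0_eq.
apply: holo_flat => [|N]; first exact: (holoA_on1 hfW Wp).
have [b] := fl N a; have [g [hg <-]] := chart_surj ch b Uy.
have hc a' := holoA_near_cst (phi y) (a' : A R 0).
have hzp := holoA_nearD (holoA_id (phi y)) (hc (- acst 0 (phi y))).
pose pw N := fun z : Cx R => (epsfree 0 (@id (Cx R)) z + - acst 0 (phi y)) ^+ N.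
have hpw N' : holoA_near (phi y) (pw N') /\
    G y (pw N') = (zc y - str S y (acst 0 (phi y))) ^+ N'.
  elim: N' => [|N' [h1 h2]].
    rewrite expr0 (_ : pw 0%N = fun=> 1); last by apply/funext => z; rewrite /pw expr0.
    by rewrite (chart_str ch _ Uy) rmorph1; split; [exact: hc |].
  have -> : pw N'.+1 = fun z => (epsfree 0 (@id (Cx R)) z + - acst 0 (phi y)) * pw N' z.
    by apply/funext => z; rewrite /pw exprS.
  split; first exact: (holoA_nearM hzp h1).
  rewrite (chartM ch Uy hzp h1) h2 exprS; congr (_ * _).
  by rewrite (chartD ch Uy (holoA_id _) (hc _)) (chart_str ch _ Uy) rmorphN.
have [h1 h2] := hpw N.
rewrite -h2 -(chartM ch Uy h1 hg) -ef => /(chart_eq ch Uy hf (holoA_nearM h1 hg)) eq.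
have [W' [oW' Wp' hgW]] := hg.
exists (fun z => (g z).1); split; first exact: (holoA_on1 hgW Wp').
apply: filterS eq => z ->; rewrite sqzE; congr (_ * _).
rewrite /pw; elim: (N) => [|N' ih]; first by rewrite !expr0.
by rewrite !exprS sqzE ih.
Qed.

(** An algebra map from the stalk to the constants can only evaluate z at the point: for any other
    value l the germ z - l is invertible, yet it would be sent to 0. *)
Lemma zc_along i : U (c i) -> along S i (zc (c i)) = acst 0 (phi (c i)).
Proof.
move=> Ui; set p := phi (c i); set a := along S i (zc (c i)).
apply: A0_eq; apply/eqP; case: eqVneq => // ne; exfalso.
pose l := a.1; have pl : p != l by rewrite eq_sym.
have /near_openP [O [oO Op OE]] : \forall q \near p, q != l.
  apply/nearCP; exists (cmod (p - l)); split; first by rewrite cmod_gt0 // subr_eq0.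
  by move=> z; apply: contraTneq => ->; rewrite -cmodN opprB ltxx.
have hi : holoA_near p (epsfree 0 (fun z => (z - l)^-1)).
  exists O; split; [exact: oO | exact: Op |].
  by apply: holoA_on_epsfree => q /OE; exact: holo_inv_sub.
have hc a' := holoA_near_cst p (a' : A R 0).
have hzl := holoA_nearD (holoA_id p) (hc (- acst 0 l)).
have e1 : (zc (c i) - str S (c i) (acst 0 l)) * G (c i) (epsfree 0 (fun z => (z - l)^-1)) = 1.
  rewrite -rmorphN -!(chart_str ch _ Ui) /zc -(chartD ch Ui (holoA_id _) (hc _)).
  rewrite -(chartM ch Ui hzl hi) -(rmorph1 (str S (c i))) -(chart_str ch _ Ui).
  apply/(chart_eq ch); [exact: Ui | exact: (holoA_nearM hzl hi) | exact: hc |].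
  apply/near_openP; exists O; split; [exact: oO | exact: Op |] => z /OE zl; apply: A0_eq.
  by rewrite sqzE /= divff // subr_eq0.
have := congr1 (along S i) e1.
rewrite rmorphM rmorphB along_str -/a rmorph1.
have -> : a - acst 0 l = 0 by apply: A0_eq; rewrite sqzE /= subrr.
by rewrite mul0r => /esym/eqP; rewrite oner_eq0.
Qed.

Lemma chart_coord : is_coord U phi zc (@dc).
Proof.
split.
- exact: chart_open ch.
- apply/(chart_sect ch) => //; first exact: chart_open ch.
  exists (epsfree 0 id); split; last by [].
  apply: holoA_on_epsfree => q _; exact: holo_id.
- exact: dc_vfield.
- move=> y Uy; split; [exact: dc_z | | by move=> a; exact: zc_div].
  move=> D vD a; have [dD dM dK] := vD; have [eD eM eK] := dc_vec Uy.
  (* The derivation D - D(z) d/dz kills z. *)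
  have := @der_flat y (fun a => D a - D (zc y) * @dc y a) Uy.
  move=> /(_ _ _ a) h; apply/eqP; rewrite -subr_eq0; apply/eqP; apply: h.
    split => [a1 a2|a1 a2|k].
    - by rewrite dD eD; ring.
    - by rewrite dM eM; ring.
    - by rewrite dK eK mulr0 subr0.
  by rewrite dc_z // mulr1 subrr.
- exact: zc_along.
Qed.

End OneChart.

Lemma coord_ex x : exists W phi z d, W x /\ is_coord W phi z d.
Proof.
have [U [phi [G [Ux ch]]]] := curve_chart S x.
by do 4!eexists; split; [exact: Ux | exact: chart_coord ch].
Qed.

End Coordinates.

(** * Vector fields, one-forms and connections at a point *)

Section Linear.
Context (R : realType) (X : topologicalType) (n : nat) (c : 'I_n -> X) (m : nat).
Context (P : curve R c m) (x : X).
Implicit Types (D E F : vec P x) (w : cov P x).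

Lemma vec_0 D : is_vec D -> D 0 = 0.
Proof. by move=> [_ _ dK]; have := dK 0; rewrite rmorph0. Qed.

Lemma vec_N D a : is_vec D -> D (- a) = - D a.
Proof.
move=> vD; have [dD _ _] := vD; apply/eqP; rewrite -addr_eq0 -dD addNr.
by rewrite vec_0.
Qed.

Lemma vec_sum D k (F : 'I_k -> stalk P x) : is_vec D -> D (\sum_l F l) = \sum_l D (F l).
Proof.
move=> vD; have [dD _ _] := vD; elim: k F => [|k ih] F; first by rewrite !big_ord0 vec_0.
by rewrite !big_ord_recl dD ih.
Qed.

Lemma vec_str D k a : is_vec D -> D (str P x k * a) = str P x k * D a.
Proof. by move=> [_ dM dK]; rewrite dM dK mul0r add0r. Qed.

Lemma is_vec0 : is_vec (fun=> 0 : stalk P x).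
Proof. by split => *; rewrite ?mul0r ?mulr0 ?addr0. Qed.

Lemma is_vecD D E : is_vec D -> is_vec E -> is_vec (fun a => D a + E a).
Proof.
move=> [dD dM dK] [eD eM eK]; split => [a b|a b|k].
- by rewrite dD eD addrACA.
- by rewrite dM eM; ring.
- by rewrite dK eK addr0.
Qed.

Lemma is_vecZ f D : is_vec D -> is_vec (fun a => f * D a).
Proof.
move=> [dD dM dK]; split => [a b|a b|k].
- by rewrite dD mulrDr.
- by rewrite dM; ring.
- by rewrite dK mulr0.
Qed.

Lemma is_vec_sum k (F : 'I_k -> vec P x) : (forall l, is_vec (F l)) ->
  is_vec (fun a => \sum_l F l a).
Proof.
elim: k F => [|k ih] F hF.
  under eq_fun do rewrite big_ord0; exact: is_vec0.
under eq_fun do rewrite big_ord_recl.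
by apply: is_vecD => //; exact: ih.
Qed.

Lemma bracket_vec D E : is_vec D -> is_vec E -> is_vec (bracket D E).
Proof.
move=> vD vE; have [dD dM dK] := vD; have [eD eM eK] := vE; split => [a b|a b|k].
- by rewrite /bracket eD dD dD eD; ring.
- by rewrite /bracket eM dM dD eD !dM !eM; ring.
- by rewrite /bracket eK dK (vec_0 vD) (vec_0 vE) subrr.
Qed.

Lemma covD w D E : is_cov w -> is_vec D -> is_vec E -> w (fun a => D a + E a) = w D + w E.
Proof. by move=> [h _]; exact: h. Qed.

Lemma covZ w f D : is_cov w -> is_vec D -> w (fun a => f * D a) = f * w D.
Proof. by move=> [_ h]; exact: h. Qed.

Lemma cov0 w : is_cov w -> w (fun=> 0) = 0.
Proof.
by move=> hw; have := covZ 0 hw is_vec0; rewrite !mul0r.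
Qed.

Lemma covN w D : is_cov w -> is_vec D -> w (fun a => - D a) = - w D.
Proof.
move=> hw vD; rewrite -mulN1r -covZ //; congr w; apply/funext => a; by rewrite mulN1r.
Qed.

Lemma cov_sum w k (F : 'I_k -> vec P x) : is_cov w -> (forall l, is_vec (F l)) ->
  w (fun a => \sum_l F l a) = \sum_l w (F l).
Proof.
move=> hw; elim: k F => [|k ih] F hF.
  rewrite big_ord0 -[RHS](cov0 hw); congr w; apply/funext => a; exact: big_ord0.
rewrite big_ord_recl -ih // -covD //; last exact: is_vec_sum.
congr w; apply/funext => a; exact: big_ord_recl.
Qed.

Lemma is_covD w w' : is_cov w -> is_cov w' -> is_cov (fun D => w D + w' D).
Proof.
move=> hw hw'; split => [D E vD vE|f D vD].
- by rewrite (covD hw) ?(covD hw') // addrACA.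
- by rewrite (covZ _ hw) ?(covZ _ hw') // mulrDr.
Qed.

Lemma is_covZ f w : is_cov w -> is_cov (fun D => f * w D).
Proof.
move=> hw; split => [D E vD vE|g D vD].
- by rewrite (covD hw) // mulrDr.
- by rewrite (covZ _ hw) // mulrCA.
Qed.

Lemma is_cov0 : is_cov (fun=> 0 : stalk P x).
Proof. by split => *; rewrite ?addr0 ?mulr0. Qed.

Lemma is_cov_sum k (F : 'I_k -> cov P x) : (forall l, is_cov (F l)) ->
  is_cov (fun a => \sum_l F l a).
Proof.
elim: k F => [|k ih] F hF.
  under eq_fun do rewrite big_ord0; exact: is_cov0.
under eq_fun do rewrite big_ord_recl.
by apply: is_covD => //; exact: ih.
Qed.

Lemma is_cov_eq w w' : (forall D, is_vec D -> w D = w' D) -> is_cov w -> is_cov w'.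
Proof.
move=> e hw; split => [D E vD vE|f D vD].
- by rewrite -!e ?(covD hw) //; exact: is_vecD.
- by rewrite -!e ?(covZ _ hw) //; exact: is_vecZ.
Qed.

Lemma lie_cov_cov (v : vec P x) w : is_vec v -> is_cov w -> is_cov (lie_cov v w).
Proof.
move=> hv hw; have [vD vM vK] := hv; split => [D E hD hE|f D hD]; rewrite /lie_cov.
- rewrite (covD hw) // vD.
  have -> : bracket v (fun a => D a + E a) = fun a => bracket v D a + bracket v E a.
    by apply/funext => a; rewrite /bracket vD; ring.
  by rewrite (covD hw) //; [ring | exact: bracket_vec | exact: bracket_vec].
- rewrite (covZ _ hw) // vM.
  have -> : bracket v (fun a => f * D a) = fun a => v f * D a + f * bracket v D a.
    by apply/funext => a; rewrite /bracket vM; ring.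
  rewrite (covD hw); [| exact: is_vecZ | by apply: is_vecZ; exact: bracket_vec].
  by rewrite !(covZ _ hw) //; [ring | exact: bracket_vec].
Qed.

(** The stalkwise properties of a connection. An affine family provides the bilinearity of nabla w
    only for sections w; [nabla_conn] transfers it to stalks. *)
Definition is_conn (nb : cov P x -> bil P x) : Prop :=
  [/\ forall w w', is_cov w -> is_cov w' -> (forall D, is_vec D -> w D = w' D) ->
        forall D E, is_vec D -> is_vec E -> nb w D E = nb w' D E,
      forall w w', is_cov w -> is_cov w' -> forall D E, is_vec D -> is_vec E ->
        nb (fun F => w F + w' F) D E = nb w D E + nb w' D E,
      forall f w, is_cov w -> forall D E, is_vec D -> is_vec E ->
        nb (fun F => f * w F) D E = D f * w E + f * nb w D E &
      forall w, is_cov w -> is_bil (nb w)].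

Section Conn.
Context (nb : cov P x -> bil P x) (hn : is_conn nb).

Lemma conn_ext w w' D E : is_cov w -> is_cov w' -> (forall D, is_vec D -> w D = w' D) ->
  is_vec D -> is_vec E -> nb w D E = nb w' D E.
Proof. by case: hn => h _ _ _ hw hw' e; exact: h. Qed.

Lemma connD w w' D E : is_cov w -> is_cov w' -> is_vec D -> is_vec E ->
  nb (fun F => w F + w' F) D E = nb w D E + nb w' D E.
Proof. by case: hn => _ h _ _ hw hw'; exact: h. Qed.

Lemma connZ f w D E : is_cov w -> is_vec D -> is_vec E ->
  nb (fun F => f * w F) D E = D f * w E + f * nb w D E.
Proof. by case: hn => _ _ h _ hw; exact: h. Qed.

Lemma conn_str k w D E : is_cov w -> is_vec D -> is_vec E ->
  nb (fun F => str P x k * w F) D E = str P x k * nb w D E.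
Proof. by move=> hw vD vE; rewrite connZ //; have [_ _ ->] := vD; rewrite mul0r add0r. Qed.

Lemma conn0 D E : is_vec D -> is_vec E -> nb (fun=> 0) D E = 0.
Proof.
move=> vD vE; have := conn_str 0 is_cov0 vD vE; by rewrite rmorph0 !mul0r.
Qed.

Lemma conn_covr w D : is_cov w -> is_vec D -> is_cov (nb w D).
Proof. by case: hn => _ _ _ h /h hw /hw[]. Qed.

Lemma conn_covl w E : is_cov w -> is_vec E -> is_cov (fun D => nb w D E).
Proof. by case: hn => _ _ _ h /h hw /hw[]. Qed.

Lemma conn_sum k (F : 'I_k -> cov P x) D E : (forall l, is_cov (F l)) ->
  is_vec D -> is_vec E -> nb (fun G => \sum_l F l G) D E = \sum_l nb (F l) D E.
Proof.
move=> + vD vE; elim: k F => [|k ih] F hF.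
  rewrite big_ord0 -[RHS](conn0 vD vE); congr (nb _ D E); apply/funext => a; exact: big_ord0.
rewrite big_ord_recl -ih // -connD //; last exact: is_cov_sum.
congr (nb _ D E); apply/funext => a; exact: big_ord_recl.
Qed.

End Conn.

Lemma is_bilD (q q' : bil P x) : is_bil q -> is_bil q' -> is_bil (fun D E => q D E + q' D E).
Proof.
move=> h h' D vD; have [h1 h2] := h D vD; have [h1' h2'] := h' D vD.
by split; exact: is_covD.
Qed.

Lemma is_bil_prod w w' : is_cov w -> is_cov w' -> is_bil (fun D E => w D * w' E).
Proof.
move=> hw hw' D vD; split; first exact: is_covZ.
by under eq_fun do rewrite mulrC; exact: is_covZ.
Qed.

Lemma is_bil_eq (q q' : bil P x) :
  (forall D E, is_vec D -> is_vec E -> q D E = q' D E) -> is_bil q -> is_bil q'.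
Proof.
move=> e h D vD; have [h1 h2] := h D vD.
split; [apply: is_cov_eq h1 | apply: is_cov_eq h2] => E vE; exact: e.
Qed.

End Linear.

(** * Trivialized stalks *)

Section Frames.
Context (R : realType) (X : topologicalType) (n : nat) (c : 'I_n -> X) (m : nat).
Context (S : curve R c 0) (P : curve R c m) (x : X).
Local Notation O := (stalk S x).

Definition sstr (k : A R m) : sqz O m :=
  mk (str S x (acst 0 k.1)) (fun l => str S x (acst 0 (k.2 ord0 l))).

(* A frame identifies the stalk of P with O[e_1..e_m]/(e_i e_j). In it, a derivation D
   of P is D_0 + \sum_l e_l D_l, where D_0 and D_l are [fv0] and [fv1]; likewise [fc0]
   and [fc1] are the components of a covector, and [vlift], [clift], [blift] rebuild
   tensors of P from their components. *)
Definition is_frame (K : stalk P x -> sqz O m) : Prop :=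
  [/\ forall a b, K (a + b) = K a + K b, forall a b, K (a * b) = K a * K b,
      forall k, K (str P x k) = sstr k & bijective K].

Definition frinv (K : stalk P x -> sqz O m) (t : sqz O m) : stalk P x :=
  xget 0 [set a | K a = t].

Definition fv0 K (D : vec P x) : vec S x := fun h => (K (D (frinv K (mk h (fun=> 0))))).1.
Definition fv1 K (D : vec P x) l : vec S x :=
  fun h => (K (D (frinv K (mk h (fun=> 0))))).2 ord0 l.

Definition vlift K (v0 : vec S x) (v1 : 'I_m -> vec S x) : vec P x := fun a =>
  frinv K (mk (v0 (K a).1) (fun l => v1 l (K a).1 + v0 ((K a).2 ord0 l))).

Definition vlift0 K (v : vec S x) := vlift K v (fun _ _ => 0).

Definition fc0 K (w : cov P x) : cov S x := fun F => (K (w (vlift0 K F))).1.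
Definition fc1 K (w : cov P x) l : cov S x := fun F => (K (w (vlift0 K F))).2 ord0 l.

Definition clift K (w0 : cov S x) (w1 : 'I_m -> cov S x) : cov P x := fun D =>
  frinv K (mk (w0 (fv0 K D)) (fun l => w1 l (fv0 K D) + w0 (fv1 K D l))).

Definition clift0 K (w : cov S x) := clift K w (fun _ _ => 0).

Definition blift K (q0 : bil S x) (q1 : 'I_m -> bil S x) : bil P x := fun D E =>
  frinv K (mk (q0 (fv0 K D) (fv0 K E)) (fun l => q1 l (fv0 K D) (fv0 K E) +
    q0 (fv1 K D l) (fv0 K E) + q0 (fv0 K D) (fv1 K E l))).

Definition twist (chi : 'I_m -> vec S x) (t : sqz O m) : sqz O m :=
  mk t.1 (fun l => t.2 ord0 l + chi l t.1).

(* The connection of P is that of S plus \sum_l e_l eta_l in the frame K. *)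
Definition conn_form K (nS : cov S x -> bil S x) (eta : 'I_m -> cov S x)
    (nP : cov P x -> bil P x) : Prop :=
  forall w D E, is_cov w -> is_vec D -> is_vec E ->
  K (nP w D E) = mk (nS (fc0 K w) (fv0 K D) (fv0 K E))
    (fun l => nS (fc1 K w l) (fv0 K D) (fv0 K E) + nS (fc0 K w) (fv1 K D l) (fv0 K E)
      + nS (fc0 K w) (fv0 K D) (fv1 K E l) + eta l (fv0 K D) * fc0 K w (fv0 K E)).

Lemma twist1 chi t : (twist chi t).1 = t.1. Proof. by []. Qed.
Lemma twist2 chi t l : (twist chi t).2 ord0 l = t.2 ord0 l + chi l t.1.
Proof. by rewrite mk2. Qed.

Lemma sstr_cst k : sstr (acst m k) = mk (str S x (acst 0 k)) (fun=> 0).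
Proof.
apply: sqz_eq => // l; rewrite !mk2 /= mxE; exact: (rmorph0 (str S x)).
Qed.

Lemma acst0_1 : acst 0 (1 : Cx R) = 1.
Proof. by apply: A0_eq. Qed.

Lemma acst0_0 : acst 0 (0 : Cx R) = 0.
Proof. by apply: A0_eq. Qed.

Lemma sstr_eps l : sstr (aeps R l) = mk 0 (fun k => if k == l then 1 else 0).
Proof.
apply: sqz_eq => [|k]; first by rewrite !mk1 /= acst0_0 rmorph0.
rewrite !mk2 /= mxE eqxx /=; case: eqP => _ /=.
  by rewrite acst0_1 rmorph1.
by rewrite acst0_0 rmorph0.
Qed.

Section OneFrame.
Context (K : stalk P x -> sqz O m) (hK : is_frame K).
Local Notation L := (frinv K).
Local Notation e l := (str P x (aeps R l)).
Implicit Types (a b f : stalk P x) (h : O) (t : sqz O m).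

Lemma frD a b : K (a + b) = K a + K b. Proof. by case: hK. Qed.
Lemma frM a b : K (a * b) = K a * K b. Proof. by case: hK. Qed.
Lemma fr_str k : K (str P x k) = sstr k. Proof. by case: hK. Qed.
Lemma fr_inj : injective K. Proof. by case: hK => _ _ _ /bij_inj. Qed.

Lemma frinvK t : K (L t) = t.
Proof.
have [_ _ _ [g gK Kg]] := hK; rewrite /frinv.
by case: xgetP => [a _ //|/(_ (g t))]; rewrite /= Kg.
Qed.

Lemma frK a : L (K a) = a.
Proof. by apply: fr_inj; rewrite frinvK. Qed.

Lemma fr0 : K 0 = 0.
Proof. by apply: (addrI (K 0)); rewrite -frD !addr0. Qed.

Lemma fr_sum k (F : 'I_k -> stalk P x) : K (\sum_l F l) = \sum_l K (F l).
Proof.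
elim: k F => [|k ih] F; first by rewrite !big_ord0 fr0.
by rewrite !big_ord_recl frD ih.
Qed.

Lemma frE1 l a : (K (e l * a)).1 = 0.
Proof. by rewrite frM fr_str sstr_eps sqzE mk1 mul0r. Qed.

Lemma frE2 l a k : (K (e l * a)).2 ord0 k = if k == l then (K a).1 else 0.
Proof.
rewrite frM fr_str sstr_eps sqzE mk1 mk2 mul0r add0r.
by case: eqP => _; rewrite ?mulr1 ?mulr0.
Qed.

Lemma fr_sumE1 (F : 'I_m -> stalk P x) : (K (\sum_l e l * F l)).1 = 0.
Proof. by rewrite fr_sum sqz1_sum big1 // => l _; exact: frE1. Qed.

Lemma fr_sumE2 (F : 'I_m -> stalk P x) k : (K (\sum_l e l * F l)).2 ord0 k = (K (F k)).1.
Proof.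
rewrite fr_sum sqz2_sum (bigD1 k) //= frE2 eqxx big1 ?addr0 // => l ne.
by rewrite frE2 eq_sym (negbTE ne).
Qed.

Lemma fr_dec a : a = L (mk (K a).1 (fun=> 0)) + \sum_l e l * L (mk ((K a).2 ord0 l) (fun=> 0)).
Proof.
apply: fr_inj; rewrite frD frinvK; apply: sqz_eq => [|l].
  by rewrite sqz1D fr_sumE1 addr0.
by rewrite sqz2D fr_sumE2 frinvK mk2 add0r.
Qed.

(** Derivations are A_m-linear and e_l e_k = 0, so the e_l-part of the argument meets only D_0. *)
Lemma fv_E D a : is_vec D ->
  K (D a) = mk (fv0 K D (K a).1) (fun l => fv1 K D l (K a).1 + fv0 K D ((K a).2 ord0 l)).
Proof.
move=> vD; have [dD dM dK] := vD.
rewrite {1}(fr_dec a) dD (vec_sum _ vD) frD; apply: sqz_eq => [|l].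
  rewrite sqz1D; under eq_bigr do rewrite vec_str //.
  by rewrite fr_sumE1 addr0.
rewrite sqz2D; under eq_bigr do rewrite vec_str //.
by rewrite fr_sumE2 mk2.
Qed.

Lemma frinvD s t : L (s + t) = L s + L t.
Proof. by apply: fr_inj; rewrite frD !frinvK. Qed.

Lemma frinvM s t : L (s * t) = L s * L t.
Proof. by apply: fr_inj; rewrite frM !frinvK. Qed.

Lemma mk0D h h' : mk (m := m) (h + h') (fun=> 0) = mk h (fun=> 0) + mk h' (fun=> 0).
Proof. by apply: sqz_eq => // l; rewrite sqzE !mk2 addr0. Qed.

Lemma mk0M h h' : mk (m := m) (h * h') (fun=> 0) = mk h (fun=> 0) * mk h' (fun=> 0).
Proof. by apply: sqz_eq => // l; rewrite sqzE !mk2 !mulr0 addr0. Qed.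

Lemma frinv_str k : L (mk (str S x k) (fun=> 0)) = str P x (acst m k.1).
Proof.
apply: fr_inj; rewrite frinvK fr_str sstr_cst; congr (mk (str S x _) _); exact: A0_eq.
Qed.

Lemma fv0_vec D : is_vec D -> is_vec (fv0 K D).
Proof.
move=> vD; have [dD dM dK] := vD; split => [a b|a b|k]; rewrite /fv0.
- by rewrite mk0D frinvD dD frD.
- by rewrite mk0M frinvM dM frD !frM !frinvK !sqzE.
- by rewrite frinv_str dK fr0.
Qed.

Lemma fv1_vec D l : is_vec D -> is_vec (fv1 K D l).
Proof.
move=> vD; have [dD dM dK] := vD; split => [a b|a b|k]; rewrite /fv1.
- by rewrite mk0D frinvD dD frD sqzE.
- by rewrite mk0M frinvM dM frD !frM !frinvK !sqzE !mk2 !mk1; ring.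
- by rewrite frinv_str dK fr0 sqzE.
Qed.

Lemma vlift_vec v0 v1 : is_vec v0 -> (forall l, is_vec (v1 l)) -> is_vec (vlift K v0 v1).
Proof.
move=> h0 h1; have [d0 m0 k0] := h0; split => [a b|a b|k]; apply: fr_inj; rewrite /vlift.
- rewrite !frD !frinvK; apply: sqz_eq => [|l]; first by rewrite sqzE !mk1 sqzE d0.
  by have [d1 m1 k1] := h1 l; rewrite !sqzE !mk2 ?sqzE d1 !d0 addrACA.
- rewrite frD !frM !frinvK; apply: sqz_eq => [|l]; first by rewrite !sqzE !mk1 ?sqzE m0.
  by have [d1 m1 k1] := h1 l; rewrite !sqzE !mk2 ?sqzE !mk1 m1 d0 !m0; ring.
- rewrite fr0 frinvK; apply: sqz_eq => [|l]; first by rewrite fr_str mk1 k0.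
  by have [d1 m1 k1] := h1 l; rewrite fr_str mk1 !mk2 k1 k0 sqzE addr0.
Qed.

Lemma vlift0_vec v : is_vec v -> is_vec (vlift0 K v).
Proof. by move=> hv; apply: vlift_vec => // l; exact: is_vec0. Qed.

Lemma fv0_lift v0 v1 : fv0 K (vlift K v0 v1) = v0.
Proof. by apply/funext => h; rewrite /fv0 /vlift !frinvK !mk1. Qed.

Lemma fv1_lift v0 v1 l : is_vec v0 -> fv1 K (vlift K v0 v1) l = v1 l.
Proof.
by move=> h0; apply/funext => h; rewrite /fv1 /vlift !frinvK !mk2 mk1 (vec_0 h0) addr0.
Qed.

Lemma fv1_lift0 v l : is_vec v -> fv1 K (vlift0 K v) l = fun=> 0.
Proof. exact: (@fv1_lift v (fun _ _ => 0)). Qed.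

Lemma fv0D D E : fv0 K (fun a => D a + E a) = fun h => fv0 K D h + fv0 K E h.
Proof. by apply/funext => h; rewrite /fv0 frD. Qed.

Lemma fv1D D E l : fv1 K (fun a => D a + E a) l = fun h => fv1 K D l h + fv1 K E l h.
Proof. by apply/funext => h; rewrite /fv1 frD sqzE. Qed.

Lemma fv0Z f D : fv0 K (fun a => f * D a) = fun h => (K f).1 * fv0 K D h.
Proof. by apply/funext => h; rewrite /fv0 frM. Qed.

Lemma fv1Z f D l : fv1 K (fun a => f * D a) l =
  fun h => (K f).1 * fv1 K D l h + (K f).2 ord0 l * fv0 K D h.
Proof. by apply/funext => h; rewrite /fv1 frM sqzE [X in _ + X]mulrC. Qed.

Lemma vec_dec D : is_vec D ->
  D = fun a => vlift0 K (fv0 K D) a + \sum_l e l * vlift0 K (fv1 K D l) a.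
Proof.
move=> vD; apply/funext => a; apply: fr_inj; rewrite fv_E // frD; apply: sqz_eq => [|l].
  by rewrite sqz1D fr_sumE1 addr0 mk1 /vlift0 /vlift frinvK mk1.
by rewrite sqz2D fr_sumE2 /vlift0 /vlift !frinvK !mk2 mk1 add0r addrC.
Qed.

Lemma fc_E w D : is_cov w -> is_vec D ->
  K (w D) = mk (fc0 K w (fv0 K D)) (fun l => fc1 K w l (fv0 K D) + fc0 K w (fv1 K D l)).
Proof.
move=> hw vD.
have v0 := vlift0_vec (fv0_vec vD); have v1 l := vlift0_vec (fv1_vec l vD).
have ve l : is_vec (fun a => e l * vlift0 K (fv1 K D l) a) by apply: is_vecZ; exact: v1.
rewrite {1}(vec_dec vD) (covD hw v0 (is_vec_sum ve)) (cov_sum hw ve).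
under eq_bigr do rewrite (covZ _ hw) //.
rewrite frD; apply: sqz_eq => [|l]; first by rewrite sqz1D fr_sumE1 addr0.
by rewrite sqz2D fr_sumE2 mk2.
Qed.

Lemma vlift0D v v' : is_vec v -> is_vec v' ->
  vlift0 K (fun h => v h + v' h) = fun a => vlift0 K v a + vlift0 K v' a.
Proof.
move=> hv hv'; apply/funext => a; apply: fr_inj; rewrite frD !frinvK.
by apply: sqz_eq => // l; rewrite sqzE !mk2 !add0r.
Qed.

Lemma vlift0Z h v : vlift0 K (fun h' => h * v h') = fun a => L (mk h (fun=> 0)) * vlift0 K v a.
Proof.
apply/funext => a; apply: fr_inj; rewrite frM !frinvK.
by apply: sqz_eq => // l; rewrite sqzE !mk2 !mk1 !mulr0 !add0r addr0.
Qed.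

Lemma fc0_cov w : is_cov w -> is_cov (fc0 K w).
Proof.
move=> hw; split => [D E vD vE|f D vD]; rewrite /fc0.
- by rewrite vlift0D // (covD hw) ?frD //; exact: vlift0_vec.
- rewrite vlift0Z (covZ _ hw) ?frM ?frinvK //; exact: vlift0_vec.
Qed.

Lemma fc1_cov w l : is_cov w -> is_cov (fc1 K w l).
Proof.
move=> hw; split => [D E vD vE|f D vD]; rewrite /fc1.
- by rewrite vlift0D // (covD hw) ?frD ?sqzE //; exact: vlift0_vec.
- rewrite vlift0Z (covZ _ hw) ?frM ?frinvK ?sqzE ?mk2 ?mk1 ?mulr0 ?addr0 //; exact: vlift0_vec.
Qed.

Lemma clift_cov w0 w1 : is_cov w0 -> (forall l, is_cov (w1 l)) -> is_cov (clift K w0 w1).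
Proof.
move=> h0 h1; split => [D E vD vE|f D vD]; apply: fr_inj; rewrite /clift.
- have u := fv0_vec vD; have u' := fv0_vec vE.
  rewrite frD !frinvK; apply: sqz_eq => [|l]; first by rewrite mk1 fv0D (covD h0).
  have v := fv1_vec l vD; have v' := fv1_vec l vE.
  by rewrite sqzE !mk2 fv0D fv1D (covD h0) // (covD (h1 l)) // addrACA.
- have u := fv0_vec vD.
  rewrite frM !frinvK; apply: sqz_eq => [|l]; first by rewrite mk1 fv0Z (covZ _ h0).
  have v := fv1_vec l vD.
  rewrite sqzE !mk2 fv0Z fv1Z (covZ _ (h1 l)) // mk1.
  rewrite (covD h0); [| exact: is_vecZ | exact: is_vecZ].
  by rewrite !(covZ _ h0) //; ring.
Qed.

Lemma clift0_cov w : is_cov w -> is_cov (clift0 K w).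
Proof. by move=> hw; apply: clift_cov => // l; exact: is_cov0. Qed.

Lemma fc0_lift w0 w1 F : is_vec F -> fc0 K (clift K w0 w1) F = w0 F.
Proof. by move=> vF; rewrite /fc0 /clift frinvK mk1 fv0_lift. Qed.

Lemma fc1_lift w0 w1 l F : is_cov w0 -> is_vec F -> fc1 K (clift K w0 w1) l F = w1 l F.
Proof.
by move=> h0 vF; rewrite /fc1 /clift frinvK mk2 fv0_lift fv1_lift0 // (cov0 h0) addr0.
Qed.

Lemma cov_dec w : is_cov w -> forall D, is_vec D ->
  w D = clift0 K (fc0 K w) D + \sum_l e l * clift0 K (fc1 K w l) D.
Proof.
move=> hw D vD; apply: fr_inj; rewrite fc_E // frD; apply: sqz_eq => [|l].
  by rewrite sqz1D fr_sumE1 addr0 mk1 /clift0 /clift frinvK mk1.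
by rewrite sqz2D fr_sumE2 /clift0 /clift !frinvK !mk2 mk1 add0r addrC.
Qed.

Lemma blift_bil q0 q1 : is_bil q0 -> (forall l, is_bil (q1 l)) -> is_bil (blift K q0 q1).
Proof.
move=> h0 h1 D vD; have u := fv0_vec vD; have u1 l := fv1_vec l vD.
have [a0 b0] := h0 _ u.
split; split => [F E vF vE|f F vF]; apply: fr_inj; rewrite /blift.
- have v := fv0_vec vF; have v' := fv0_vec vE.
  rewrite frD !frinvK fv0D; apply: sqz_eq => [|l]; first by rewrite !mk1 (covD a0).
  have w := fv1_vec l vF; have w' := fv1_vec l vE.
  have [a1 b1] := h1 l _ u; have [a0l b0l] := h0 _ (u1 l).
  by rewrite sqzE !mk2 fv1D (covD a1) // (covD a0) // (covD a0l) //; ring.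
- have v := fv0_vec vF.
  rewrite frM !frinvK fv0Z; apply: sqz_eq => [|l]; first by rewrite !mk1 (covZ _ a0).
  have w := fv1_vec l vF.
  have [a1 b1] := h1 l _ u; have [a0l b0l] := h0 _ (u1 l).
  rewrite sqzE !mk2 mk1 fv1Z (covZ _ a1) // (covZ _ a0l) //.
  rewrite (covD a0); [| exact: is_vecZ | exact: is_vecZ].
  by rewrite !(covZ _ a0) //; ring.
- have v := fv0_vec vF; have v' := fv0_vec vE.
  rewrite frD !frinvK fv0D; apply: sqz_eq => [|l]; first by rewrite !mk1 (covD b0).
  have w := fv1_vec l vF; have w' := fv1_vec l vE.
  have [a1 b1] := h1 l _ u; have [a0l b0l] := h0 _ (u1 l).
  by rewrite sqzE !mk2 fv1D (covD b1) // (covD b0) // (covD b0l) //; ring.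
- have v := fv0_vec vF.
  rewrite frM !frinvK fv0Z; apply: sqz_eq => [|l]; first by rewrite !mk1 (covZ _ b0).
  have w := fv1_vec l vF.
  have [a1 b1] := h1 l _ u; have [a0l b0l] := h0 _ (u1 l).
  rewrite sqzE !mk2 mk1 fv1Z (covZ _ b1) // (covZ _ b0l) //.
  rewrite (covD b0); [| exact: is_vecZ | exact: is_vecZ].
  by rewrite !(covZ _ b0) //; ring.
Qed.

Section Twist.
Context (chi : 'I_m -> vec S x) (hchi : forall l, is_vec (chi l)).
Local Notation K' := (twist chi \o K).

Lemma twist_frame : is_frame K'.
Proof.
split => [a b|a b|k|] /=.
- rewrite frD; apply: sqz_eq => // l; have [dD _ _] := hchi l.
  by rewrite sqzE !mk2 sqz1D sqz2D dD addrACA.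
- rewrite frM; apply: sqz_eq => // l; have [_ dM _] := hchi l.
  by rewrite sqzE !mk2 !mk1 sqz1M sqz2M dM; ring.
- rewrite fr_str; apply: sqz_eq => // l; have [_ _ dK] := hchi l.
  by rewrite mk2 dK addr0.
- apply: bij_comp; last by case: hK.
  exists (twist (fun l h => - chi l h)) => t; apply: sqz_eq => // l.
    by rewrite !mk2 mk1 addrK.
  by rewrite !mk2 mk1 addrNK.
Qed.

Lemma fv0_twist D : is_vec D -> fv0 K' D = fv0 K D.
Proof.
move=> vD; apply/funext => h; rewrite {1}/fv0 /= fv_E //.
set a := frinv K' _; have e : K a = mk h (fun l => - chi l h).
  have := twist_frame => -[_ _ _ /bij_inj inj]; have -> : a = L (mk h (fun l => - chi l h)).
    apply: inj; rewrite /= frinvK /a.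
    have [_ _ _ [g gK Kg]] := twist_frame.
    rewrite /frinv; case: xgetP => [b _ /= ->|/(_ (g (mk h (fun=> 0))))]; last by rewrite /= -/(K' _) Kg.
    by apply: sqz_eq => // l; rewrite !mk2 mk1 addNr.
  by rewrite frinvK.
by rewrite e.
Qed.

End Twist.

End OneFrame.

Section TwistOps.
Context (K : stalk P x -> sqz O m) (hK : is_frame K).
Context (chi : 'I_m -> vec S x) (hchi : forall l, is_vec (chi l)).
Local Notation K' := (twist chi \o K).
Let hK' : is_frame K' := twist_frame hK hchi.

Lemma twist_frinv h : K (frinv K' (mk h (fun=> 0))) = mk h (fun l => - chi l h).
Proof.
rewrite -[LHS](mk_eta); have := frinvK hK' (mk h (fun=> 0)) => /= e.
have e1 : (K (frinv K' (mk h (fun=> 0)))).1 = h by have := congr1 fst e.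
apply: sqz_eq => [|l]; first by rewrite !mk1 e1.
rewrite !mk2; have := congr1 (fun t : sqz O m => t.2 ord0 l) e.
by rewrite !mk2 e1 => /eqP; rewrite addr_eq0 => /eqP.
Qed.

(** Conjugating D_0 + sum e_l D_l by 1 + sum e_l chi_l adds the commutator of chi_l and D_0 to
    D_l. *)
Lemma fv1_twist D l : is_vec D ->
  fv1 K' D l = fun h => fv1 K D l h + bracket (chi l) (fv0 K D) h.
Proof.
move=> vD; apply/funext => h; rewrite {1}/fv1 /= twist2 !(fv_E hK _ vD) twist_frinv !mk1 !mk2.
have v0 := fv0_vec hK vD; rewrite (vec_N _ v0) /fv1 /bracket; ring.
Qed.

(** A lift that is constant in the twisted frame is not constant in the original one; the defect is
    minus the commutator. *)
Lemma twist_lift F l : is_vec F ->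
  fv0 K (vlift0 K' F) = F /\ fv1 K (vlift0 K' F) l = fun h => - bracket (chi l) F h.
Proof.
move=> vF; have vD := vlift0_vec hK' vF.
have e0 : fv0 K (vlift0 K' F) = F by rewrite -(fv0_twist hK hchi vD) (fv0_lift hK').
split; first exact: e0.
apply/funext => h; have /= := congr1 (fun f : vec S x => f h) (fv1_twist l vD).
rewrite (fv1_lift0 hK') // e0 => /esym/eqP; rewrite addr_eq0 => /eqP //.
Qed.

Lemma fc0_twist w F : is_cov w -> is_vec F -> fc0 K' w F = fc0 K w F.
Proof.
move=> hw vF; rewrite {1}/fc0 /= (fc_E hK hw (vlift0_vec hK' vF)) mk1.
have -> // : fv0 K (vlift0 K' F) = F by rewrite -(fv0_twist hK hchi (vlift0_vec hK' vF)) (fv0_lift hK').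
Qed.

(** The change of frame contributes chi_l(w F) and the change of lift contributes -w([chi_l, F]);
    together they form the Lie derivative of w. *)
Lemma fc1_twist w l F : is_cov w -> is_vec F ->
  fc1 K' w l F = fc1 K w l F + lie_cov (chi l) (fc0 K w) F.
Proof.
move=> hw vF; have [e0 e1] := twist_lift l vF.
rewrite {1}/fc1 /= twist2 (fc_E hK hw (vlift0_vec hK' vF)) mk2 mk1 e0 e1.
rewrite (covN (fc0_cov hK hw)); last exact: bracket_vec.
by rewrite /lie_cov; ring.
Qed.

End TwistOps.

End Frames.

(** * Connections in trivialized stalks *)

Section ConnFrames.
Context (R : realType) (X : topologicalType) (n : nat) (c : 'I_n -> X) (m : nat).
Context (S : curve R c 0) (P : curve R c m) (x : X).
Local Notation O := (stalk S x).
Local Notation e l := (str P x (aeps R l)).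
Context (K : stalk P x -> sqz O m) (hK : is_frame K).
Context (nS : cov S x -> bil S x) (hS : is_conn nS).
Context (nP : cov P x -> bil P x).

(** This is (L_v nabla) w as a bilinear form, the right-hand side of [is_lie_nabla] for a connection
    on a single stalk. *)
Definition lie_conn (v : vec S x) (w : cov S x) (D E : vec S x) : O :=
  lie_bil v (nS w) D E - nS (lie_cov v w) D E.

Section Twist.
Context (chi : 'I_m -> vec S x) (hchi : forall l, is_vec (chi l)).
Local Notation K' := (twist chi \o K).
Let hK' : is_frame K' := twist_frame hK hchi.

(** The changes of D, E and w produce one correction each. Together with chi_l applied to the body
    of the connection, they are exactly the terms of L_chi_l nabla. *)
Lemma conn_twist_eq eta : conn_form K nS eta nP ->
  forall w D E, is_cov w -> is_vec D -> is_vec E ->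
  K' (nP w D E) = mk (nS (fc0 K' w) (fv0 K' D) (fv0 K' E))
    (fun l => nS (fc1 K' w l) (fv0 K' D) (fv0 K' E) + nS (fc0 K' w) (fv1 K' D l) (fv0 K' E)
      + nS (fc0 K' w) (fv0 K' D) (fv1 K' E l)
      + (eta l (fv0 K' D) * fc0 K' w (fv0 K' E) + lie_conn (chi l) (fc0 K' w) (fv0 K' D) (fv0 K' E))).
Proof.
move=> hc w D E hw vD vE; rewrite /= hc //.
rewrite !(fv0_twist hK hchi) //.
have vD0 := fv0_vec hK vD; have vE0 := fv0_vec hK vE.
have w0 := fc0_cov hK hw; have w0' := fc0_cov hK' hw.
have w0e F : is_vec F -> fc0 K' w F = fc0 K w F by exact: (fc0_twist hK hchi).
have n0 D' E' : is_vec D' -> is_vec E' -> nS (fc0 K' w) D' E' = nS (fc0 K w) D' E'.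
  by move=> vD' vE'; apply: conn_ext.
apply: sqz_eq => [|l]; first by rewrite twist1 !mk1 n0.
have vD1 := fv1_vec hK l vD; have vE1 := fv1_vec hK l vE.
have vD1' := fv1_vec hK' l vD; have vE1' := fv1_vec hK' l vE.
have bD := bracket_vec (hchi l) vD0; have bE := bracket_vec (hchi l) vE0.
have w1 := fc1_cov hK l hw; have w1' := fc1_cov hK' l hw.
have lw := lie_cov_cov (hchi l) w0.
have e1 : nS (fc1 K' w l) (fv0 K D) (fv0 K E) =
    nS (fc1 K w l) (fv0 K D) (fv0 K E) + nS (lie_cov (chi l) (fc0 K w)) (fv0 K D) (fv0 K E).
  rewrite -(connD hS) //; apply: (conn_ext hS) => // [|F vF]; first exact: is_covD.
  exact: (fc1_twist hK hchi).
have e2 : nS (fc0 K w) (fv1 K' D l) (fv0 K E) =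
    nS (fc0 K w) (fv1 K D l) (fv0 K E) + nS (fc0 K w) (bracket (chi l) (fv0 K D)) (fv0 K E).
  by rewrite (fv1_twist hK hchi l vD) (covD (conn_covl hS w0 vE0)).
have e3 : nS (fc0 K w) (fv0 K D) (fv1 K' E l) =
    nS (fc0 K w) (fv0 K D) (fv1 K E l) + nS (fc0 K w) (fv0 K D) (bracket (chi l) (fv0 K E)).
  by rewrite (fv1_twist hK hchi l vE) (covD (conn_covr hS w0 vD0)).
have e4 : nS (lie_cov (chi l) (fc0 K' w)) (fv0 K D) (fv0 K E) =
    nS (lie_cov (chi l) (fc0 K w)) (fv0 K D) (fv0 K E).
  apply: (conn_ext hS) => // [|F vF]; first exact: lie_cov_cov.
  by rewrite /lie_cov !w0e //; exact: bracket_vec.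
rewrite twist2 !mk2 mk1 !n0 // w0e // e1 e2 e3 /lie_conn e4 /lie_bil !n0 //.
ring.
Qed.

Lemma conn_twist eta eta' : conn_form K nS eta nP ->
  (forall l w D E, is_cov w -> is_vec D -> is_vec E ->
     (eta' l D - eta l D) * w E = lie_conn (chi l) w D E) ->
  conn_form K' nS eta' nP.
Proof.
move=> hc lie w D E hw vD vE; rewrite (conn_twist_eq hc) //; apply: sqz_eq => // l.
have vD0 := fv0_vec hK' vD; have vE0 := fv0_vec hK' vE; have w0 := fc0_cov hK' hw.
by rewrite !mk2 -lie //; congr (_ + _); ring.
Qed.

(** On tensors lifted from S all e_l-components vanish, so two expressions of the same connection
    can be compared in their eta-terms alone. *)
Lemma conn_twist_lie eta eta' : conn_form K nS eta nP -> conn_form K' nS eta' nP ->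
  forall l w D E, is_cov w -> is_vec D -> is_vec E ->
     (eta' l D - eta l D) * w E = lie_conn (chi l) w D E.
Proof.
move=> hc hc' l w D E hw vD vE.
have hw' := clift0_cov hK' hw; have vD' := vlift0_vec hK' vD; have vE' := vlift0_vec hK' vE.
have := congr1 (fun t : sqz O m => t.2 ord0 l) (conn_twist_eq hc hw' vD' vE').
rewrite (hc' _ _ _ hw' vD' vE') !mk2 => /addrI.
rewrite !(fv0_lift hK') (fc0_lift hK') // => e1.
have e2 : lie_conn (chi l) (fc0 K' (clift0 K' w)) D E = lie_conn (chi l) w D E.
  have w0 := fc0_cov hK' hw'.
  have w0e F : is_vec F -> fc0 K' (clift0 K' w) F = w F by exact: (fc0_lift hK').
  have bD := bracket_vec (hchi l) vD; have bE := bracket_vec (hchi l) vE.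
  rewrite /lie_conn /lie_bil !(conn_ext hS w0 hw w0e) //; congr (_ - _).
  apply: (conn_ext hS) => //; [exact: lie_cov_cov | exact: lie_cov_cov |].
  by move=> F vF; rewrite /lie_cov !w0e //; exact: bracket_vec.
by rewrite mulrBl e1 e2 addrC addKr.
Qed.

End Twist.

Section Lift.
Context (hP : is_conn nP).
Variable eta : 'I_m -> cov S x.
Hypothesis lift : forall w D E, is_cov w -> is_vec D -> is_vec E ->
  K (nP (clift0 K w) (vlift0 K D) (vlift0 K E)) = mk (nS w D E) (fun l => eta l D * w E).

(** Bilinearity over A_m and the Leibniz rule, in which the e_l are constants, reduce the formula to
    lifted tensors: E, D and w are decomposed one after the other. *)
Lemma conn_lift : conn_form K nS eta nP.
Proof.
have step1 w D E : is_cov w -> is_vec D -> is_vec E ->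
    K (nP (clift0 K w) (vlift0 K D) E) = mk (nS w D (fv0 K E))
      (fun l => eta l D * w (fv0 K E) + nS w D (fv1 K E l)).
  move=> hw vD vE; have vD' := vlift0_vec hK vD.
  have cw := clift0_cov hK hw.
  rewrite (fc_E hK (conn_covr hP cw vD') vE) /fc0 /fc1.
  apply: sqz_eq => [|l]; rewrite ?mk1 ?mk2 !lift ?mk1 ?mk2 //; exact: fv0_vec || exact: fv1_vec.
have step2 w D E : is_cov w -> is_vec D -> is_vec E ->
    K (nP (clift0 K w) D E) = mk (nS w (fv0 K D) (fv0 K E))
      (fun l => eta l (fv0 K D) * w (fv0 K E) + nS w (fv0 K D) (fv1 K E l)
         + nS w (fv1 K D l) (fv0 K E)).
  move=> hw vD vE; have cw := clift0_cov hK hw.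
  rewrite (fc_E hK (conn_covl hP cw vE) vD) /fc0 /fc1.
  apply: sqz_eq => [|l]; rewrite ?mk1 ?mk2 !step1 ?mk1 ?mk2 //; exact: fv0_vec || exact: fv1_vec.
move=> w D E hw vD vE.
have c0 := clift0_cov hK (fc0_cov hK hw).
have c1 l := clift0_cov hK (fc1_cov hK l hw).
have ce l : is_cov (fun F => e l * clift0 K (fc1 K w l) F) by exact: is_covZ.
have ec := is_cov_sum ce.
rewrite (conn_ext hP hw (is_covD c0 ec) (cov_dec hK hw) vD vE).
rewrite (connD hP c0 ec vD vE) (conn_sum hP ce vD vE).
under eq_bigr do rewrite (conn_str hP _ (c1 _) vD vE).
rewrite (frD hK) step2 //; last exact: fc0_cov.
apply: sqz_eq => [|l].
  by rewrite sqz1D (fr_sumE1 hK) addr0.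
rewrite sqz2D (fr_sumE2 hK) step2 //; last exact: fc1_cov.
by rewrite !mk2 mk1; ring.
Qed.

End Lift.

End ConnFrames.

Section Restrict.
Context (R : realType) (X : topologicalType) (n : nat) (c : 'I_n -> X) (m : nat).
Context (P : curve R c m).
Implicit Types (U V : set X).

Lemma is_vfield_sub U V (v : vfield P) : V `<=` U -> is_vfield U v -> is_vfield V v.
Proof.
move=> sub [h1 h2]; split=> [x /sub|W s oW WV]; first exact: h1.
by apply: h2 => //; exact: subset_trans sub.
Qed.

Lemma is_form1_sub U V (w : form1 P) : V `<=` U -> is_form1 U w -> is_form1 V w.
Proof.
move=> sub [h1 h2]; split=> [x /sub|W s oW WV]; first exact: h1.
by apply: h2 => //; exact: subset_trans sub.
Qed.

Lemma is_form2_sub U V (q : form2 P) : V `<=` U -> is_form2 U q -> is_form2 V q.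
Proof.
move=> sub [h1 h2]; split=> [x /sub|W s t oW WV]; first exact: h1.
by apply: h2 => //; exact: subset_trans sub.
Qed.

Lemma off_sub U V : V `<=` U -> off c V `<=` off c U.
Proof. by move=> sub x [/sub Ux nx]. Qed.

Lemma off_in U : off c U `<=` U. Proof. by move=> x []. Qed.

Lemma is_vfield_zero_sub U V (v : vfield P) :
  V `<=` U -> is_vfield_zero U v -> is_vfield_zero V v.
Proof.
by move=> sub [h1 h2]; split=> [|i /sub]; [exact: is_vfield_sub h1 | exact: h2].
Qed.

Lemma is_form1_pole_sub U V (w : form1 P) : V `<=` U -> is_form1_pole U w -> is_form1_pole V w.
Proof.
move=> sub [h1 h2]; split=> [|W u oW WV]; first exact: is_form1_sub (off_sub sub) h1.
by apply: h2 => //; exact: subset_trans sub.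
Qed.

Lemma is_form1_eq U (w w' : form1 P) :
  (forall x, U x -> forall D, is_vec D -> w x D = w' x D) -> is_form1 U w -> is_form1 U w'.
Proof.
move=> e [h1 h2]; split => [x Ux|V v oV VU hv]; first exact: is_cov_eq (e x Ux) (h1 x Ux).
apply: sect_ext (h2 V v oV VU hv) => x Vx; apply: e; first exact: VU.
by case: hv => + _; exact.
Qed.

Lemma is_form2_eq U (q q' : form2 P) :
  (forall x, U x -> forall D E, is_vec D -> is_vec E -> q x D E = q' x D E) ->
  is_form2 U q -> is_form2 U q'.
Proof.
move=> e [h1 h2]; split => [x Ux|V v v' oV VU hv hv']; first exact: is_bil_eq (e x Ux) (h1 x Ux).
apply: sect_ext (h2 V v v' oV VU hv hv') => x Vx; apply: e; first exact: VU.
  by case: hv => + _; exact.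
by case: hv' => + _; exact.
Qed.

End Restrict.

(** * Trivializations over open sets *)

Section LocalFrames.
Context (R : realType) (X : topologicalType) (n : nat) (c : 'I_n -> X) (m : nat).
Context (S : curve R c 0) (P : curve R c m).
Local Notation ftype := (forall x, stalk P x -> sqz (stalk S x) m).
Implicit Types (U V : set X) (K : ftype).

(** A trivialization of the curve alone; [lframe] also makes the marked sections horizontal. The two
    are separated because a coordinate of the total family gives only the former, and the latter
    needs a correction at the marked points. *)
Definition preframe U K : Prop :=
  [/\ open U, forall x, U x -> is_frame (K x) &
      forall V s, open V -> V `<=` U ->
        (sect P V s <-> sect S V (fun x => (K x (s x)).1) /\
           forall l, sect S V (fun x => (K x (s x)).2 ord0 l))].

(* [along S i] takes values in A_0, whose first component is the complex number. *)
Definition lframe U K : Prop := preframe U K /\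
  forall i, U (c i) -> forall a, along P i a =
    mk (along S i (K (c i) a).1).1 (fun l => (along S i ((K (c i) a).2 ord0 l)).1).

Lemma pf_sub U V K : open V -> V `<=` U -> preframe U K -> preframe V K.
Proof.
move=> oV sub [oU fr se]; split => //.
- by move=> x /sub; exact: fr.
- by move=> W s oW WV; apply: se => //; exact: subset_trans sub.
Qed.

Lemma lf_sub U V K : open V -> V `<=` U -> lframe U K -> lframe V K.
Proof.
move=> oV sub [h al]; split; first exact: pf_sub h.
by move=> i /sub; exact: al.
Qed.

Section One.
Context (U : set X) (K : ftype) (hK : preframe U K).
Arguments K : clear implicits.

Lemma pf_open : open U. Proof. by case: hK. Qed.
Lemma pf_fr x : U x -> is_frame (K x). Proof. by case: hK => _ h _; exact: h. Qed.

Lemma pf_sect1 V s : open V -> V `<=` U -> sect P V s -> sect S V (fun x => (K x (s x)).1).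
Proof. by case: hK => _ _ h oV VU /(h V s oV VU) []. Qed.

Lemma pf_sect2 V s l : open V -> V `<=` U -> sect P V s ->
  sect S V (fun x => (K x (s x)).2 ord0 l).
Proof. by case: hK => _ _ h oV VU /(h V s oV VU) []. Qed.

Lemma pf_mk V a b : open V -> V `<=` U -> sect S V a -> (forall l, sect S V (b l)) ->
  sect P V (fun x => frinv (K x) (mk (a x) (fun l => b l x))).
Proof.
move=> oV VU sa sb; case: (hK) => _ _ h; apply/h => //; split => [|l].
  by apply: sect_ext sa => x /VU/pf_fr hx; rewrite (frinvK hx).
by apply: sect_ext (sb l) => x /VU/pf_fr hx; rewrite (frinvK hx) mk2.
Qed.

Lemma pf_mk0 V a : open V -> V `<=` U -> sect S V a ->
  sect P V (fun x => frinv (K x) (mk (a x) (fun=> 0))).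
Proof. by move=> oV VU sa; apply: (@pf_mk V a (fun _ _ => 0)) => // l; exact: sect0. Qed.

Lemma pf_fv0 V (D : vfield P) : V `<=` U -> is_vfield V D ->
  is_vfield V (fun x => fv0 (K x) (D x)).
Proof.
move=> VU [h1 h2]; split=> [x Vx|W s oW WV ss].
  by apply: fv0_vec; [exact: (pf_fr (VU x Vx)) | exact: h1].
have WU := subset_trans WV VU.
by apply: pf_sect1 => //; apply: h2 => //; exact: pf_mk0.
Qed.

Lemma pf_fv1 V (D : vfield P) l : V `<=` U -> is_vfield V D ->
  is_vfield V (fun x => fv1 (K x) (D x) l).
Proof.
move=> VU [h1 h2]; split=> [x Vx|W s oW WV ss].
  by apply: fv1_vec; [exact: (pf_fr (VU x Vx)) | exact: h1].
have WU := subset_trans WV VU.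
by apply: pf_sect2 => //; apply: h2 => //; exact: pf_mk0.
Qed.

Lemma pf_vlift0 V (D : vfield S) : V `<=` U -> is_vfield V D ->
  is_vfield V (fun x => vlift0 (K x) (D x)).
Proof.
move=> VU [h1 h2]; split=> [x Vx|W s oW WV ss].
  by apply: vlift0_vec; [exact: (pf_fr (VU x Vx)) | exact: h1].
have WU := subset_trans WV VU; apply: (@pf_mk W _ (fun l x => 0 + D x _)) => // [|l].
  by apply: h2 => //; exact: pf_sect1.
by apply: sectD => //; [exact: sect0 | apply: h2 => //; exact: pf_sect2].
Qed.

Lemma pf_fc0 V (w : form1 P) : V `<=` U -> is_form1 V w ->
  is_form1 V (fun x => fc0 (K x) (w x)).
Proof.
move=> VU [h1 h2]; split=> [x Vx|W v oW WV hv].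
  by apply: fc0_cov; [exact: (pf_fr (VU x Vx)) | exact: h1].
have WU := subset_trans WV VU.
by apply: pf_sect1 => //; apply: h2 => //; exact: pf_vlift0.
Qed.

Lemma pf_fc1 V (w : form1 P) l : V `<=` U -> is_form1 V w ->
  is_form1 V (fun x => fc1 (K x) (w x) l).
Proof.
move=> VU [h1 h2]; split=> [x Vx|W v oW WV hv].
  by apply: fc1_cov; [exact: (pf_fr (VU x Vx)) | exact: h1].
have WU := subset_trans WV VU.
by apply: pf_sect2 => //; apply: h2 => //; exact: pf_vlift0.
Qed.

Lemma pf_clift0 V (w : form1 S) : V `<=` U -> is_form1 V w ->
  is_form1 V (fun x => clift0 (K x) (w x)).
Proof.
move=> VU [h1 h2]; split=> [x Vx|W v oW WV hv].
  by apply: clift0_cov; [exact: (pf_fr (VU x Vx)) | exact: h1].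
have WU := subset_trans WV VU; apply: (@pf_mk W _ (fun l x => 0 + w x _)) => // [|l].
  by apply: h2 => //; exact: pf_fv0.
by apply: sectD => //; [exact: sect0 | apply: h2 => //; exact: pf_fv1].
Qed.

Lemma pf_blift V (q0 : form2 S) (q1 : 'I_m -> form2 S) : V `<=` U -> is_form2 V q0 ->
  (forall l, is_form2 V (q1 l)) ->
  is_form2 V (fun x => blift (K x) (q0 x) (fun l => q1 l x)).
Proof.
move=> VU [h1 h2] h; split=> [x Vx|W v v' oW WV hv hv'].
  apply: blift_bil; [exact: (pf_fr (VU x Vx)) | exact: h1 | move=> l; have [h3 _] := h l; exact: h3].
have WU := subset_trans WV VU.
have v0 := pf_fv0 WU hv; have v0' := pf_fv0 WU hv'.
apply: (@pf_mk W _ (fun l x => q1 l x _ _ + q0 x _ _ + q0 x _ _)) => // [|l].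
  exact: h2.
have v1 := pf_fv1 l WU hv; have v1' := pf_fv1 l WU hv'; have [_ h4] := h l.
by apply: sectD => //; [apply: sectD => //; [exact: h4 | exact: h2] | exact: h2].
Qed.

Lemma pf_twist (psi : 'I_m -> vfield S) : (forall l, is_vfield U (psi l)) ->
  preframe U (fun x => twist (fun l => psi l x) \o K x).
Proof.
move=> hpsi; case: (hK) => oU fr se; split => //.
- by move=> x Ux; apply: twist_frame => [|l]; [exact: fr | have [h _] := hpsi l; exact: h].
- move=> V s oV VU; split=> [ss|[s1 s2]].
    split=> [|l]; first exact: pf_sect1.
    have s1 := pf_sect1 oV VU ss; have s2 := pf_sect2 l oV VU ss.
    apply: (@sect_ext _ _ _ _ _ S V (fun x => (K x (s x)).2 ord0 l + psi l x (K x (s x)).1)).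
      by move=> x _; exact/esym/twist2.
    by apply: sectD => //; have [_ h] := hpsi l; exact: h.
  apply/se => //; split => // l.
  apply: (@sect_ext _ _ _ _ _ S V (fun x => ((twist (fun l => psi l x) \o K x) (s x)).2 ord0 l - psi l x (K x (s x)).1)).
    by move=> x _; apply/eqP; rewrite subr_eq; apply/eqP; exact: twist2.
  by apply: sectB => //; have [_ h] := hpsi l; exact: h.
Qed.

End One.

Lemma lf_twist U K (psi : 'I_m -> vfield S) : lframe U K ->
  (forall l, is_vfield_zero U (psi l)) ->
  lframe U (fun x => twist (fun l => psi l x) \o K x).
Proof.
move=> [hK al] hpsi; split; first by apply: pf_twist => // l; have [] := hpsi l.
move=> i Ui a; rewrite al //; apply: sqz_eq => // l; rewrite !mk2 rmorphD.
by have [_ h] := hpsi l; rewrite h // addr0.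
Qed.

Lemma lf_along0 U K i h : lframe U K -> U (c i) ->
  along P i (frinv (K (c i)) (mk h (fun=> 0))) = mk (along S i h).1 (fun=> 0).
Proof.
move=> [hK al] Ui; have fr := pf_fr hK Ui; rewrite al // (frinvK fr).
by apply: sqz_eq => // l; rewrite !mk2 rmorph0.
Qed.


Section Two.
Context (U : set X) (K K' : ftype) (hK : lframe U K) (hK' : lframe U K').
Arguments K : clear implicits.
Arguments K' : clear implicits.

(** The e_l-part of an algebra automorphism which is the identity modulo the e_l is a derivation;
    horizontality in both trivializations forces it to vanish at the marked points. *)
Lemma lf_two_zero (psi : 'I_m -> vfield S) :
  (forall x, U x -> forall a, K' x a = twist (fun l => psi l x) (K x a)) ->
  forall l, is_vfield_zero U (psi l).
Proof.
move=> tr l; have pE x : U x -> forall h, psi l x h = (K' x (frinv (K x) (mk h (fun=> 0)))).2 ord0 l.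
  by move=> Ux h; rewrite tr // twist2 (frinvK (pf_fr hK.1 Ux)) mk2 add0r.
have t1 x : U x -> forall a, (K' x a).1 = (K x a).1 by move=> Ux a; rewrite tr.
split; first split => [x Ux|V s oV VU ss].
- have fr := pf_fr hK.1 Ux; have fr' := pf_fr hK'.1 Ux; split => [a b|a b|k]; rewrite !pE //.
  + by rewrite mk0D (frinvD fr) (frD fr') sqz2D.
  + by rewrite mk0M (frinvM fr) (frM fr') sqz2M !t1 // !(frinvK fr) !mk1; ring.
  + by rewrite (frinv_str fr) (fr_str fr') sstr_cst mk2.
- apply: (@sect_ext _ _ _ _ _ S V (fun x => (K' x (frinv (K x) (mk (s x) (fun=> 0)))).2 ord0 l)).
    by move=> x /VU Ux; rewrite pE.
  by apply: (pf_sect2 hK'.1) => //; exact: (pf_mk0 hK.1).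
- move=> i Ui a; rewrite pE //; apply: A0_eq.
  have := lf_along0 a hK Ui; case: (hK') => _ -> //.
  by move/(congr1 (fun t : A R m => t.2 ord0 l)); rewrite !mk2 => ->.
Qed.

(** By linearity in the e_l it suffices to compare the trivializations on elements without
    e_l-part. *)
Lemma lf_two : (forall x, U x -> forall a, (K' x a).1 = (K x a).1) ->
  exists psi : 'I_m -> vfield S,
    forall x, U x -> forall a, K' x a = twist (fun l => psi l x) (K x a).
Proof.
move=> t1; exists (fun l x h => (K' x (frinv (K x) (mk h (fun=> 0)))).2 ord0 l) => x Ux a.
have fr := pf_fr hK.1 Ux; have fr' := pf_fr hK'.1 Ux.
apply: sqz_eq => [|l]; first by rewrite t1.
rewrite twist2 {1}(fr_dec fr a) (frD fr') sqz2D (fr_sumE2 fr') t1 //.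
by rewrite (frinvK fr) mk1 addrC.
Qed.

End Two.

End LocalFrames.

(** * Local triviality of deformations *)

Section Deformations.
Context (R : realType) (X : topologicalType) (n : nat) (c : 'I_n -> X).
Context (S : affine_family R c 0) (m : nat) (D : deformation S m).
Local Notation e l x := (str D x (aeps R l)).
Local Notation rh x := (@rho _ _ _ _ _ _ D x).
Implicit Types (x y : X) (U V : set X).

Lemma rhoD x a b : rh x (a + b) = rh x a + rh x b.
Proof. by have [[/(_ x I) [h _ _] _ _] _] := rho_mor D; exact: h. Qed.

Lemma rhoM x a b : rh x (a * b) = rh x a * rh x b.
Proof. by have [[/(_ x I) [_ h _] _ _] _] := rho_mor D; exact: h. Qed.

Lemma rho_str x k : rh x (str D x k) = str S x (acst 0 k.1).
Proof.
have [[/(_ x I) [_ _ ->] _ _] _] := rho_mor D; congr (str S x _); exact: A0_eq.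
Qed.

Lemma rho_sect V s : open V -> sect D V s -> sect S V (fun x => rh x (s x)).
Proof. by have [[_ h _] _] := rho_mor D => oV; exact: h. Qed.

Lemma rho_along i a : along S i (rh (c i) a) = acst 0 (along D i a).1.
Proof. have [[_ _ h] _] := rho_mor D; rewrite h //; exact: A0_eq. Qed.

Lemma rho0 x : rh x 0 = 0.
Proof. by apply: (addrI (rh x 0)); rewrite -rhoD !addr0. Qed.

Lemma rhoN x a : rh x (- a) = - rh x a.
Proof. by apply/eqP; rewrite -addr_eq0 -rhoD addNr rho0. Qed.

Lemma rho_eps l x : rh x (e l x) = 0.
Proof. by rewrite rho_str /= acst0_0 rmorph0. Qed.

Lemma rho_sum x k (F : 'I_k -> stalk D x) : rh x (\sum_l F l) = \sum_l rh x (F l).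
Proof.
elim: k F => [|k ih] F; first by rewrite !big_ord0 rho0.
by rewrite !big_ord_recl rhoD ih.
Qed.

Lemma rho_esum x (F : 'I_m -> stalk D x) : rh x (\sum_l e l x * F l) = 0.
Proof. by rewrite rho_sum big1 // => l _; rewrite rhoM rho_eps mul0r. Qed.

Section Chart.
Context (U : set X) (phi : X -> Cx R) (G : forall y, (Cx R -> A R m) -> stalk D y).
Hypothesis ch : is_chart (@str _ _ _ _ _ D) (sect D) U phi G.

Let epsfree_near y (f : Cx R -> A R m) : holoA_near (phi y) f ->
  holoA_near (phi y) (epsfree m (fun z => (f z).1)).
Proof.
move=> [W [oW Wy wf]]; exists W; split; [exact: oW | exact: Wy |].
exact: holoA_on_epsfree (holoA_on1 wf).
Qed.

Lemma chart_esum y (F : 'I_m -> Cx R -> A R m) : U y ->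
  (forall l, holoA_near (phi y) (F l)) ->
  exists f, [/\ holoA_near (phi y) f, \sum_l e l y * G y (F l) = G y f,
    forall z, (f z).1 = 0 & forall z l, (f z).2 ord0 l = (F l z).1].
Proof.
move=> Uy hF; exists (fun z => \sum_l (aeps R l * F l z)).
have h2 l := holoA_nearM (holoA_near_cst (phi y) (aeps R l)) (hF l).
have [h3 e3] := chart_sum ch Uy h2; split.
- exact: h3.
- rewrite e3; apply: eq_bigr => l _.
  by rewrite (chartM ch Uy (holoA_near_cst _ _) (hF l)) (chart_str ch _ Uy).
- by move=> z; rewrite sqz1_sum big1 // => l _; rewrite sqzE mul0r.
- move=> z l; rewrite sqz2_sum (bigD1 l) //= big1 ?addr0 => [|i ne].
    by rewrite !mxE !eqxx /= mulr1 mul0r add0r.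
  by rewrite !mxE eqxx /= eq_sym (negbTE ne) mulr0 mul0r addr0.
Qed.

(** The kernel of the reduction is generated by the e_l, and every function in that ideal has zero
    body; a function without e_l-part that lies in it is therefore zero. *)
Lemma rho_chart0 y (h : Cx R -> Cx R) : U y -> holoA_near (phi y) (epsfree m h) ->
  rh y (G y (epsfree m h)) = 0 -> G y (epsfree m h) = 0.
Proof.
move=> Uy hh /rho_ker [b eb].
have /choice [F hF] l : exists f, holoA_near (phi y) f /\ G y f = b l by exact: (chart_surj ch).
have [f [nf ef f1 _]] := chart_esum Uy (fun l => (hF l).1).
have := eb; under eq_bigr do rewrite -(hF _).2.
rewrite ef => /(chart_eq ch Uy hh nf) eq.
apply/(chart0 ch Uy hh); apply: filterS eq => z /(congr1 fst) /=; rewrite f1 => h0.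
by rewrite /epsfree h0.
Qed.

(** This is flatness over A_m in the form that is needed: a linear relation between the e_l has
    coefficients that reduce to zero. It comes from the charts of the total family. *)
Lemma chart_rho_free y (b : 'I_m -> stalk D y) : U y ->
  \sum_l e l y * b l = 0 -> forall l, rh y (b l) = 0.
Proof.
move=> Uy eb l.
have /choice [F hF] k : exists f, holoA_near (phi y) f /\ G y f = b k by exact: (chart_surj ch).
have [f [nf ef _ f2]] := chart_esum Uy (fun l => (hF l).1).
have := eb; under eq_bigr do rewrite -(hF _).2.
rewrite ef => /(chart0 ch Uy nf) eq.
rewrite -(hF l).2 (chart_decomp ch Uy (hF l).1) rhoD rho_esum addr0.
have -> : G y (epsfree m (fun z => (F l z).1)) = 0; last exact: rho0.
apply/(chart0 ch Uy (epsfree_near (hF l).1)); apply: filterS eq => z fz.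
by rewrite /epsfree -f2 fz sqz20.
Qed.

End Chart.

Lemma rho_free x (b : 'I_m -> stalk D x) :
  \sum_l e l x * b l = 0 -> forall l, rh x (b l) = 0.
Proof.
have [W [phi [G [Wx ch]]]] := curve_chart D x; exact: (chart_rho_free ch Wx).
Qed.

Lemma epsM x l k : e l x * e k x = 0.
Proof.
rewrite -rmorphM (_ : aeps R l * aeps R k = 0) ?rmorph0 //.
by apply: sqz_eq => [|j]; rewrite !sqzE ?mul0r // addr0.
Qed.

Section FrameOfLift.
Context (x : X) (J : stalk S x -> stalk D x).
Hypotheses (JD : forall a b, J (a + b) = J a + J b)
  (JM : forall a b, J (a * b) = J a * J b)
  (Jstr : forall k, J (str S x (acst 0 k)) = str D x (acst m k))
  (rhoJ : forall a, rh x (J a) = a).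

Definition lift_sum (t : sqz (stalk S x) m) : stalk D x :=
  J t.1 + \sum_l e l x * J (t.2 ord0 l).

(** The inverse of the parametrization J t_0 + sum e_l J t_l, taken by choice; the two lemmas on
    [lift_sum] below justify it. *)
Definition lift_frame (a : stalk D x) : sqz (stalk S x) m :=
  xget 0 [set t | a = lift_sum t].

Lemma lift0 : J 0 = 0.
Proof. by apply: (addrI (J 0)); rewrite -JD !addr0. Qed.

Lemma liftN a : J (- a) = - J a.
Proof. by apply/eqP; rewrite -addr_eq0 -JD addNr lift0. Qed.

Lemma lift_sumD s t : lift_sum (s + t) = lift_sum s + lift_sum t.
Proof.
rewrite /lift_sum JD [RHS]addrACA -big_split /=; congr (_ + _).
by apply: eq_bigr => l _; rewrite mxE JD mulrDr.
Qed.

Lemma lift_sumM s t : lift_sum (s * t) = lift_sum s * lift_sum t.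
Proof.
rewrite /lift_sum JM mulrDl !mulrDr -!addrA; congr (_ + _).
have -> : (\sum_l e l x * J (s.2 ord0 l)) * (\sum_l e l x * J (t.2 ord0 l)) = 0.
  rewrite mulr_suml big1 // => l _; rewrite mulr_sumr big1 // => k _.
  by rewrite mulrACA epsM mul0r.
rewrite addr0 mulr_sumr mulr_suml -big_split /=; apply: eq_bigr => l _.
by rewrite sqz2M JD !JM; ring.
Qed.

(** Reduction recovers the body, and then [rho_free] recovers the e_l-parts. *)
Lemma lift_sum_inj : injective lift_sum.
Proof.
move=> s t est; have e1 : s.1 = t.1.
  by have := congr1 (rh x) est; rewrite !rhoD !rho_esum !addr0 !rhoJ.
apply: sqz_eq => // l; apply/eqP; rewrite -subr_eq0; apply/eqP.
have : \sum_l e l x * J (s.2 ord0 l - t.2 ord0 l) = 0.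
  move: est; rewrite /lift_sum e1 => /addrI /eqP; rewrite -subr_eq0 -sumrB => /eqP es; rewrite -[RHS]es.
  by apply: eq_bigr => k _; rewrite JD liftN mulrBr.
by move=> /rho_free /(_ l); rewrite rhoJ.
Qed.

(** An element differs from the lift of its reduction by a combination of the e_l. This is applied
    to a and once more to the coefficients; the second error disappears since e_l e_k = 0. *)
Lemma lift_sum_surj a : exists t, a = lift_sum t.
Proof.
have /rho_ker [b eb] : rh x (a - J (rh x a)) = 0 by rewrite rhoD rhoN rhoJ subrr.
exists (mk (rh x a) (fun l => rh x (b l))); rewrite /lift_sum /=.
rewrite -[LHS](subrK (J (rh x a))) addrC eb; congr (_ + _).
apply: eq_bigr => l _; rewrite mxE.
have /rho_ker [b' eb'] : rh x (b l - J (rh x (b l))) = 0 by rewrite rhoD rhoN rhoJ subrr.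
apply/eqP; rewrite -subr_eq0 -mulrBr eb' mulr_sumr big1 // => k _.
by rewrite mulrA epsM mul0r.
Qed.

Lemma lift_frameK t : lift_frame (lift_sum t) = t.
Proof. by rewrite /lift_frame; case: xgetP => [s _ /lift_sum_inj -> |/(_ t) /(_ erefl)]. Qed.

Lemma lift_sumK a : lift_sum (lift_frame a) = a.
Proof. by have [t ->] := lift_sum_surj a; rewrite lift_frameK. Qed.

Lemma lift_frame1 a : (lift_frame a).1 = rh x a.
Proof. by rewrite -{2}(lift_sumK a) /lift_sum rhoD rho_esum addr0 rhoJ. Qed.

Lemma A_dec (k : A R m) : k = acst m k.1 + \sum_l aeps R l * acst m (k.2 ord0 l).
Proof.
apply: sqz_eq => [|l].
  by rewrite sqz1D sqz1_sum big1 ?addr0 // => l _; rewrite sqzE mul0r.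
rewrite sqz2D sqz2_sum mxE add0r (bigD1 l) //= big1 ?addr0 => [|i ne].
  by rewrite !mxE !eqxx /= mulr1 mul0r add0r.
by rewrite !mxE eqxx /= eq_sym (negbTE ne) !mulr0 addr0.
Qed.

Lemma lift_frameP : is_frame lift_frame.
Proof.
split => [a b|a b|k|].
- by apply: lift_sum_inj; rewrite lift_sumD !lift_sumK.
- by apply: lift_sum_inj; rewrite lift_sumM !lift_sumK.
- apply: lift_sum_inj; rewrite lift_sumK {1}(A_dec k) rmorphD /lift_sum mk1 Jstr.
  congr (_ + _); rewrite rmorph_sum; apply: eq_bigr => l _.
  by rewrite mk2 Jstr rmorphM.
- exists lift_sum; [exact: lift_sumK | exact: lift_frameK].
Qed.

Lemma frinv_lift h : frinv lift_frame (mk h (fun=> 0)) = J h.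
Proof.
apply: (fr_inj lift_frameP); rewrite (frinvK lift_frameP).
apply: lift_sum_inj; rewrite lift_sumK /lift_sum mk1 big1 ?addr0 // => l _.
by rewrite mk2 lift0 mulr0.
Qed.

Lemma lift_frame_J h : lift_frame (J h) = mk h (fun=> 0).
Proof. by rewrite -frinv_lift (frinvK lift_frameP). Qed.

End FrameOfLift.

Section LocalLift.
Context (U : set X) (J : forall x, stalk S x -> stalk D x).
Hypothesis oU : open U.
Hypothesis hJ : forall x, U x -> [/\ forall a b, J (a + b) = J a + J b :> stalk D x,
  forall a b, J (a * b) = J a * J b :> stalk D x,
  forall k, J (str S x (acst 0 k)) = str D x (acst m k) &
  forall a, rh x (J a) = a].
Hypothesis Jsect : forall V s, open V -> V `<=` U -> sect S V s ->
  sect D V (fun x => J (s x)).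

Lemma lift_preframe : preframe U (fun x => lift_frame (@J x)).
Proof.
split => //; first by move=> x /hJ [h1 h2 h3 h4]; exact: lift_frameP.
move=> V s oV VU; split; last first.
  move=> [s1 s2].
  have s3 := sectD oV (Jsect oV VU s1) (sect_sum oV (fun l => sectM oV (sect_str D (aeps R l) oV) (Jsect oV VU (s2 l)))).
  apply: sect_ext s3 => x /VU /hJ [h1 h2 h3 h4]; exact: lift_sumK.
(* The harder direction: the e_l-components of a section s of D must be sections of S. In a chart of
   D the section s - J (rho s) is sum e_l f_l with f_l free of the e's, and [rho_free] identifies
   the l-th component of s with the reduction of f_l. *)
move=> ss; have sr := rho_sect oV ss; split.
  by apply: sect_ext sr => x /VU /hJ [h1 h2 h3 h4]; rewrite lift_frame1.
move=> l; have st := sectB oV ss (Jsect oV VU sr).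
apply: sect_local => // x Vx.
have [W [phi [G [Wx ch]]]] := curve_chart D x.
exists W; split => // [|V' oV' V'W V'V]; first exact: chart_open ch.
have [f [hf ef]] := (chart_sect ch _ oV' V'W).1 (sect_res oV oV' V'V st).
have sf : sect D V' (fun y => G y (epsfree m (fun z => (f z).2 ord0 l))).
  apply/(chart_sect ch) => //; exists (epsfree m (fun z => (f z).2 ord0 l)); split; last by [].
  exact: holoA_on_epsfree (holoA_on2 l hf).
apply: sect_ext (rho_sect oV' sf) => y V'y.
have [h1 h2 h3 h4] := hJ (VU _ (V'V _ V'y)).
have Wy := V'W _ V'y; have nf := chart_near ch oV' V'W V'y hf.
have ty := ef y V'y; rewrite (chart_decomp ch Wy nf) in ty.
have r0 : rh y (s y - J (rh y (s y))) = 0 by rewrite rhoD rhoN h4 subrr.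
have n0 : holoA_near (phi y) (epsfree m (fun z => (f z).1)).
  exists (phi @` V'); split; [exact: (chart_img ch) | by exists y |].
  exact: holoA_on_epsfree (holoA_on1 hf).
have g0 : G y (epsfree m (fun z => (f z).1)) = 0.
  apply: (rho_chart0 ch Wy n0).
  by move: r0; rewrite ty rhoD rho_esum addr0.
rewrite g0 add0r in ty.
have := lift_sumK h1 h4 (s y); rewrite /lift_sum lift_frame1 // => tj.
have : \sum_k e k y * (J ((lift_frame (@J y) (s y)).2 ord0 k) - G y (epsfree m (fun z => (f z).2 ord0 k))) = 0.
  under eq_bigr do rewrite mulrBr.
  by rewrite sumrB -ty -{2}tj addrAC subrr add0r subrr.
by move=> /rho_free /(_ l); rewrite rhoD rhoN h4 => /eqP; rewrite subr_eq0 => /eqP ->.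
Qed.

Lemma lift_lframe : (forall i, U (c i) -> forall a, along D i (J a) = acst m (along S i a).1) ->
  lframe U (fun x => lift_frame (@J x)).
Proof.
move=> al; split; first exact: lift_preframe.
move=> i Ui a; have [h1 h2 h3 h4] := hJ Ui.
rewrite -{1}(lift_sumK h1 h4 a) /lift_sum rmorphD rmorph_sum al //.
rewrite [RHS]A_dec; congr (_ + _).
by apply: eq_bigr => l _; rewrite mk2 -(al i Ui) (rmorphM (along D i)) along_str.
Qed.

End LocalLift.

End Deformations.

Section Separation.
Context (X : topologicalType) (n : nat) (c : 'I_n -> X) (hX : hausdorff_space X).

Lemma closed_pts (A : set X) : A `<=` range c -> closed A.
Proof.
move=> sub; apply: (compact_closed hX); apply: finite_compact.
by apply: (sub_finite_set sub); apply: finite_image; exact: finite_finset.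
Qed.

Lemma open_off (U : set X) : open U -> open (off c U).
Proof. by move=> oU; apply: openI => //; apply: closed_openC; exact: closed_pts. Qed.

(** Finite sets are closed in a Hausdorff space, so the marked points other than x can be
    removed. *)
Lemma sep_nbhd x : exists U, [/\ open U, U x & forall i, U (c i) -> c i = x].
Proof.
exists (~` (range c `\ x)); split.
- by apply: closed_openC; apply: closed_pts => y [].
- by move=> [_]; apply.
- by move=> i h; apply: contrapT => ne; apply: h; split; [exists i | exact: ne].
Qed.

End Separation.

(** * Trivializations from coordinates of the total family *)

Section LocalLifts.
Context (R : realType) (X : topologicalType) (n : nat) (c : 'I_n -> X).
Context (S : affine_family R c 0) (m : nat) (D : deformation S m).
Local Notation e l x := (str D x (aeps R l)).
Local Notation rh x := (@rho _ _ _ _ _ _ D x).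

Section Chart.
Context (U : set X) (phi : X -> Cx R) (G : forall y, (Cx R -> A R m) -> stalk D y).
Hypothesis ch : is_chart (@str _ _ _ _ _ D) (sect D) U phi G.
Implicit Types (h : Cx R -> Cx R).

Lemma epsfree2 h z l : (epsfree m h z).2 ord0 l = 0.
Proof. by rewrite mxE. Qed.

Lemma epsfreeB h1 h2 : epsfree m (fun z => h1 z - h2 z) = fun z => epsfree m h1 z + (fun=> -1) z * epsfree m h2 z.
Proof.
apply/funext => z; apply: sqz_eq => [|l]; first by rewrite !sqzE mulN1r.
by rewrite !sqzE ?epsfree2 oppr0 !mulr0 !addr0.
Qed.

Lemma epsfree_nearB y h1 h2 : U y -> holoA_near (phi y) (epsfree m h1) -> holoA_near (phi y) (epsfree m h2) ->
  holoA_near (phi y) (epsfree m (fun z => h1 z - h2 z)) /\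
  G y (epsfree m (fun z => h1 z - h2 z)) = G y (epsfree m h1) - G y (epsfree m h2).
Proof.
move=> Uy n1 n2; rewrite epsfreeB; have n3 := holoA_nearM (holoA_near_cst (phi y) (-1)) n2.
split; first exact: (holoA_nearD n1 n3).
by rewrite (chartD ch Uy n1 n3) (chartM ch Uy (holoA_near_cst _ _) n2) (chart_str ch _ Uy) rmorphN1 mulN1r.
Qed.

(** The trivialization defined by a coordinate of the total family: a germ of S is lifted to the
    germ without e's that reduces to it, which is unique by [rho_chart0]. *)
Definition chart_lift y (a : stalk S y) : stalk D y :=
  G y (epsfree m (xget (fun=> 0) [set h | holoA_near (phi y) (epsfree m h) /\ rh y (G y (epsfree m h)) = a])).

Lemma rho_germ y (a : stalk S y) : U y ->
  exists h, holoA_near (phi y) (epsfree m h) /\ rh y (G y (epsfree m h)) = a.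
Proof.
move=> Uy; have [b <-] := rho_surj D a; have [f [hf <-]] := chart_surj ch b Uy.
exists (fun z => (f z).1); split.
  have [W [oW Wy wf]] := hf; exists W; split; [exact: oW | exact: Wy |].
  exact: holoA_on_epsfree (holoA_on1 wf).
by rewrite [in RHS](chart_decomp ch Uy hf) rhoD rho_esum addr0.
Qed.

Lemma chart_liftE y h : U y -> holoA_near (phi y) (epsfree m h) ->
  chart_lift (rh y (G y (epsfree m h))) = G y (epsfree m h).
Proof.
move=> Uy nh; rewrite /chart_lift; case: xgetP => [h' _ [nh' eh']|/(_ h)]; last by case.
have [n3 e3] := epsfree_nearB Uy nh' nh.
apply/eqP; rewrite -subr_eq0 -e3; apply/eqP; apply: (rho_chart0 ch Uy n3).
by rewrite e3 rhoD rhoN eh' subrr.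
Qed.

Lemma chart_liftP y : U y -> [/\ forall a b, chart_lift (a + b) = chart_lift a + chart_lift b :> stalk D y,
  forall a b, chart_lift (a * b) = chart_lift a * chart_lift b :> stalk D y,
  forall k, chart_lift (str S y (acst 0 k)) = str D y (acst m k) &
  forall a, rh y (chart_lift a) = a].
Proof.
move=> Uy; split.
- move=> a b; have [f [nf <-]] := rho_germ a Uy; have [g [ng <-]] := rho_germ b Uy.
  have n3 := holoA_nearD nf ng.
  have e3 : (fun z => epsfree m f z + epsfree m g z) = epsfree m (fun z => f z + g z).
    by apply/funext => z; apply: sqz_eq => // l; rewrite sqzE ?epsfree2 addr0.
  rewrite e3 in n3; rewrite -rhoD (chart_liftE Uy nf) (chart_liftE Uy ng).
  by rewrite -(chartD ch Uy nf ng) e3 (chart_liftE Uy n3).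
- move=> a b; have [f [nf <-]] := rho_germ a Uy; have [g [ng <-]] := rho_germ b Uy.
  have n3 := holoA_nearM nf ng.
  have e3 : (fun z => epsfree m f z * epsfree m g z) = epsfree m (fun z => f z * g z).
    by apply/funext => z; apply: sqz_eq => // l; rewrite sqz2M ?epsfree2 !mulr0 addr0.
  rewrite e3 in n3; rewrite -rhoM (chart_liftE Uy nf) (chart_liftE Uy ng).
  by rewrite -(chartM ch Uy nf ng) e3 (chart_liftE Uy n3).
- move=> k; have nk : holoA_near (phi y) (epsfree m (fun=> k)) by exact: holoA_near_cst.
  have ek : G y (epsfree m (fun=> k)) = str D y (acst m k) by exact: (chart_str ch _ Uy).
  by rewrite -ek -(chart_liftE Uy nk) ek rho_str.
- by move=> a; have [f [nf <-]] := rho_germ a Uy; rewrite chart_liftE.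
Qed.

(** Representatives are chosen stalk by stalk, so a common one has to be found near each point;
    [sect_agree] shows that a representative at x still works nearby. *)
Lemma chart_lift_sect V s : open V -> V `<=` U -> sect S V s ->
  sect D V (fun x => chart_lift (s x)).
Proof.
move=> oV VU ss; apply: sect_local => // x Vx; have Ux := VU x Vx.
have [f [[W [oW Wx wf]] ef]] := rho_germ (s x) Ux.
have [V1 [oV1 V1x V1U V1W]] := chart_nbhd ch Ux oW Wx.
have sf : sect D V1 (fun y => G y (epsfree m f)).
  apply/(chart_sect ch) => //; exists (epsfree m f); split; last by [].
  exact: holoA_on_sub V1W wf.
have oV2 : open (V `&` V1) by exact: openI.
have sub1 : V `&` V1 `<=` V by move=> y [].
have sub2 : V `&` V1 `<=` V1 by move=> y [].
have ss2 := sect_res oV oV2 sub1 ss; have sf2 := sect_res oV1 oV2 sub2 sf.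
have [|V3 [oV3 V3x V3V e3]] := sect_agree oV2 ss2 (rho_sect oV2 sf2) _ (esym ef); first by split.
exists V3; split => // V' oV' V'V3 V'V.
have V'V1 : V' `<=` V1 by move=> y /V'V3/V3V [].
apply: sect_ext (sect_res oV1 oV' V'V1 sf) => y V'y.
rewrite (e3 y (V'V3 y V'y)) chart_liftE //; first exact: VU (V'V y V'y).
exists W; split; [exact: oW | by apply: V1W; exists y; [exact: V'V1 |] | exact: wf].
Qed.

End Chart.

Lemma preframe_ex x : exists U (K : forall y, stalk D y -> sqz (stalk S y) m),
  [/\ U x, preframe U K & forall y, U y -> forall a, (K y a).1 = rh y a].
Proof.
have [U [phi [G [Ux ch]]]] := curve_chart D x.
exists U, (fun y => lift_frame (@chart_lift phi G y)); split => //.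
  apply: lift_preframe; [exact: chart_open ch | exact: (chart_liftP ch) | exact: (chart_lift_sect ch)].
by move=> y Uy a; have [h1 h2 h3 h4] := chart_liftP ch Uy; rewrite lift_frame1.
Qed.

Context (hX : hausdorff_space X) (c_inj : injective c).

(** A twist of the coordinate trivialization by a constant multiple of d/dz, one for each e_l,
    straightens the section through x, if there is one. *)
Lemma frame_ex x : exists U (K : forall y, stalk D y -> sqz (stalk S y) m),
  [/\ U x, lframe U K & forall y, U y -> forall a, (K y a).1 = rh y a].
Proof.
have [U0 [K0 [U0x pf0 k0]]] := preframe_ex x.
have [W [phi [z [d [Wx cW]]]]] := coord_ex S x.
have [N [oN Nx Nc]] := sep_nbhd c hX x.
pose U := U0 `&` W `&` N.
have oU : open U by apply: openI => //; apply: openI; [exact: (pf_open pf0) | case: cW].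
have UU0 : U `<=` U0 by move=> y [[]].
have UW : U `<=` W by move=> y [[]].
have Ux : U x by split.
have pf := pf_sub oU UU0 pf0.
have [_ sz vd dd al] := is_coord_sub oU UW cW.
pose J i (a : stalk S (c i)) := frinv (K0 (c i)) (mk a (fun=> 0)).
(* The e_l-part of the coordinate along the marked section. As c is injective, at most one label
   meets U, so one constant per e_l is enough. *)
have [tau htau] : exists tau : 'I_m -> Cx R, forall i l, U (c i) ->
    (along D i (J i (z (c i)))).2 ord0 l = tau l.
  case: (pselect (exists i, c i = x)) => [[i ci]|nc].
    exists (fun l => (along D i (J i (z (c i)))).2 ord0 l) => i' l [_ Ni'].
    by have /c_inj -> : c i' = c i by rewrite Nc.
  by exists (fun=> 0) => i l [_ /Nc ci]; case: nc; exists i.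
pose psi l : vfield S := fun y a => str S y (acst 0 (tau l)) * d y a.
have vpsi l : is_vfield U (psi l).
  split => [y Uy|V s oV VU ss].
    by apply: is_vecZ; case: vd => + _; exact.
  by apply: sectM => //; [exact: sect_str | case: vd => _; exact].
exists U, (fun y => twist (fun l => psi l y) \o K0 y); split => //; last first.
  by move=> y Uy a; rewrite /= k0 //; exact: UU0.
split; first exact: pf_twist.
move=> i Ui a; have fr := pf_fr pf Ui; have U0i := UU0 _ Ui.
have a1 b : (along D i b).1 = (along S i (rh (c i) b)).1 by rewrite rho_along.
have rJ h : rh (c i) (J i h) = h by rewrite -k0 // (frinvK fr) mk1.
have JD h h' : J i (h + h') = J i h + J i h' by rewrite /J mk0D (frinvD fr).
have JM h h' : J i (h * h') = J i h * J i h' by rewrite /J mk0M (frinvM fr).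
have Jk k : J i (str S (c i) k) = str D (c i) (acst m k.1) by exact: (frinv_str fr).
(* Only first order matters: h = k + (z - z(c_i)) b, and the lift of z - z(c_i) restricts to the
   section with zero body, so b contributes only through its value at c_i. *)
have key h l : (along D i (J i h)).2 ord0 l = tau l * (along S i (d (c i) h)).1.
  have [dz _ div] := dd _ Ui; have [k [b ->]] := div h.
  have [vD vM vK] := vd.1 _ Ui.
  set p := phi (c i); set zp := z (c i) - _.
  have azp : along S i zp = 0 by rewrite rmorphB along_str al // subrr.
  have dzp : d (c i) zp = 1 by rewrite /zp -rmorphN vD vK addr0 dz.
  have tzp : (along D i (J i zp)).2 ord0 l = tau l.
    by rewrite /zp -rmorphN JD rmorphD Jk along_str sqzE mxE addr0 htau.
  have tzp1 : (along D i (J i zp)).1 = 0 by rewrite a1 rJ azp.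
  rewrite JD rmorphD Jk along_str sqzE mxE add0r JM rmorphM sqz2M tzp tzp1 mul0r add0r.
  rewrite vD vK add0r vM dzp mul1r rmorphD rmorphM azp mul0r addr0 a1 rJ mulrC //.
rewrite {1}(fr_dec fr a) rmorphD rmorph_sum.
under eq_bigr do rewrite rmorphM along_str.
apply: sqz_eq => [|l].
  rewrite sqz1D sqz1_sum big1 ?addr0 => [|l _]; last by rewrite sqzE mul0r.
  by rewrite a1 rJ mk1.
rewrite sqz2D sqz2_sum (bigD1 l) //= big1 ?addr0 => [|k ne]; last first.
  by rewrite !mxE eqxx /= eq_sym (negbTE ne) mulr0 mul0r addr0.
rewrite key [in RHS]mxE.
rewrite [X in _ = (along S i X).1](_ : _ = (K0 (c i) a).2 ord0 l + psi l (c i) (K0 (c i) a).1); last exact: (twist2 (fun l => psi l (c i)) (K0 (c i) a) l).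
rewrite !mxE !eqxx /= mul0r add0r mulr1 a1 rJ.
rewrite rmorphD sqz1D addrC; congr (_ + _).
by rewrite /psi rmorphM along_str sqzE.
Qed.

End LocalLifts.

Lemma open_forall_ord (X : topologicalType) k (F : 'I_k -> set X) :
  (forall l, open (F l)) -> open [set x | forall l, F l x].
Proof.
elim: k F => [|k ih] F oF.
  by rewrite (_ : [set x | _] = setT); [exact: openT | apply/seteqP; split => // x _ []].
rewrite (_ : [set x | _] = F ord0 `&` [set x | forall l, F (lift ord0 l) x]).
  by apply: openI; [exact: oF | apply: ih => l; exact: oF].
apply/seteqP; split => [x h|x [h0 h] l]; first by split => [|l]; exact: h.
by case: (unliftP ord0 l) => [j ->|->]; [exact: h | exact: h0].
Qed.

(** * Forms with poles along the marked points *)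

Section FormOps.
Context (R : realType) (X : topologicalType) (n : nat) (c : 'I_n -> X) (m : nat).
Context (P : curve R c m).
Implicit Types (U V W : set X).

Lemma is_form1D V (w w' : form1 P) : is_form1 V w -> is_form1 V w' ->
  is_form1 V (fun x F => w x F + w' x F).
Proof.
move=> [h1 h2] [h1' h2']; split=> [x Vx|W v oW WV hv]; first exact: is_covD (h1 x Vx) (h1' x Vx).
by apply: sectD => //; [exact: h2 | exact: h2'].
Qed.

Lemma is_form1Z V s (w : form1 P) : open V -> sect P V s -> is_form1 V w ->
  is_form1 V (fun x F => s x * w x F).
Proof.
move=> oV ss [h1 h2]; split=> [x Vx|W v oW WV hv]; first exact: is_covZ (h1 x Vx).
by apply: sectM => //; [exact: sect_res ss | exact: h2].
Qed.

Lemma is_form1_sum V k (w : 'I_k -> form1 P) : (forall l, is_form1 V (w l)) ->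
  is_form1 V (fun x F => \sum_l w l x F).
Proof.
move=> h; split=> [x Vx|W v oW WV hv]; first by apply: is_cov_sum => l; have [h1 _] := h l; exact: h1.
by apply: sect_sum => // l; have [_ h2] := h l; exact: h2.
Qed.

Lemma is_form2D V (w w' : form2 P) : is_form2 V w -> is_form2 V w' ->
  is_form2 V (fun x F G => w x F G + w' x F G).
Proof.
move=> [h1 h2] [h1' h2']; split=> [x Vx|W v v' oW WV hv hv']; first exact: is_bilD (h1 x Vx) (h1' x Vx).
by apply: sectD => //; [exact: h2 | exact: h2'].
Qed.

Lemma is_form2_prod V (w w' : form1 P) : is_form1 V w -> is_form1 V w' ->
  is_form2 V (fun x F G => w x F * w' x G).
Proof.
move=> [h1 h2] [h1' h2']; split=> [x Vx|W v v' oW WV hv hv']; first exact: is_bil_prod (h1 x Vx) (h1' x Vx).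
by apply: sectM => //; [exact: h2 | exact: h2'].
Qed.

Lemma is_form2_contr V (q : form2 P) (v : vfield P) : is_form2 V q -> is_vfield V v ->
  is_form1 V (fun x F => q x F (v x)).
Proof.
move=> [h1 h2] hv; split=> [x Vx|W v' oW WV hv'].
  by have [h _] := hv; have [_] := h1 x Vx (v x) (h x Vx).
by apply: h2 => //; exact: is_vfield_sub hv.
Qed.

Lemma is_form1_local U (w : form1 P) : open U ->
  (forall x, U x -> exists W, [/\ open W, W x & is_form1 (U `&` W) w]) -> is_form1 U w.
Proof.
move=> oU h; split=> [x Ux|V v oV VU hv].
  by have [W [_ Wx [h1 _]]] := h x Ux; apply: h1; split.
apply: sect_local => // x Vx; have [W [oW Wx [_ h2]]] := h x (VU x Vx).
exists W; split => // V' oV' V'W V'V; apply: h2 => //.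
  by move=> y V'y; split; [exact/VU/V'V | exact: V'W].
exact: is_vfield_sub hv.
Qed.

Lemma is_form2_local U (q : form2 P) : open U ->
  (forall x, U x -> exists W, [/\ open W, W x & is_form2 (U `&` W) q]) -> is_form2 U q.
Proof.
move=> oU h; split=> [x Ux|V v v' oV VU hv hv'].
  by have [W [_ Wx [h1 _]]] := h x Ux; apply: h1; split.
apply: sect_local => // x Vx; have [W [oW Wx [_ h2]]] := h x (VU x Vx).
exists W; split => // V' oV' V'W V'V; apply: h2 => //.
- by move=> y V'y; split; [exact/VU/V'V | exact: V'W].
- exact: is_vfield_sub hv.
- exact: is_vfield_sub hv'.
Qed.

End FormOps.

Section Glue.
Context (R : realType) (X : topologicalType) (n : nat) (c : 'I_n -> X) (m : nat).
Context (P : curve R c m) (hX : hausdorff_space X).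
Implicit Types (U V W : set X).

(* The value of an extension is forced off the marked points, so local extensions
   glue once one of them is chosen at each marked point. *)
Lemma glue_off (T : X -> Type) (eqv : forall x, T x -> T x -> Prop)
    (Q : set X -> (forall x, T x) -> Prop) (s0 : forall x, T x) V :
  (forall x (t : T x), eqv x t t) ->
  (forall U s s', (forall x, U x -> eqv x (s x) (s' x)) -> Q U s -> Q U s') ->
  (forall U W s, W `<=` U -> Q U s -> Q W s) ->
  (forall U s, open U -> (forall x, U x -> exists W, [/\ open W, W x & Q (U `&` W) s]) -> Q U s) ->
  open V ->
  (forall x, V x -> exists W s, [/\ open W, W x, Q (V `&` W) s &
     forall y, off c (V `&` W) y -> eqv y (s y) (s0 y)]) ->
  exists s, Q V s /\ forall y, off c V y -> eqv y (s y) (s0 y).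
Proof.
move=> er Qe Qr Ql oV loc.
have /choice [W hW] x : exists W, V x -> exists s, [/\ open W, W x, Q (V `&` W) s &
    forall y, off c (V `&` W) y -> eqv y (s y) (s0 y)].
  by case: (pselect (V x)) => [/loc [W h]|nV]; [exists W | exists setT].
have /choice [s hs] x : exists s, V x -> [/\ open (W x), W x x, Q (V `&` W x) s &
    forall y, off c (V `&` W x) y -> eqv y (s y) (s0 y)].
  by case: (pselect (V x)) => [/hW [s h]|nV]; [exists s | exists s0].
exists (fun y => if pselect (range c y) then s y y else s0 y); split; last first.
  by move=> y [Vy ny]; case: pselect => //= _; exact: er.
apply: Ql => // x Vx; have [oW Wx Qx ex] := hs x Vx; have [N [oN Nx Nc]] := sep_nbhd c hX x.
exists (W x `&` N); split; [exact: openI | by split |].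
apply: (Qe _ (s x)); last by apply: Qr Qx => y [Vy [Wy _]].
move=> y [Vy [Wy Ny]]; case: pselect => [[i _ ci]|ny] /=.
  have -> : y = x by rewrite -ci; apply: Nc; rewrite ci.
  exact: er.
exact: ex.
Qed.

Lemma is_form1_pole_local U (w : form1 P) : open U ->
  (forall x, U x -> exists W, [/\ open W, W x & is_form1_pole (U `&` W) w]) ->
  is_form1_pole U w.
Proof.
move=> oU loc; split.
  apply: is_form1_local => [|x [Ux nx]]; first exact: open_off.
  have [W [oW Wx [h _]]] := loc x Ux; exists W; split => //.
  by apply: is_form1_sub h => y [[Uy ny] Wy]; split.
move=> V u oV VU su vu.
apply: (@glue_off (fun x => cov P x) (fun x w w' => forall D, is_vec D -> w D = w' D)
  (is_form1 (P := P)) (fun x F => u x * w x F)) => //.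
- exact: is_form1_eq.
- by move=> U' W s; exact: is_form1_sub.
- exact: is_form1_local.
move=> x Vx; have [W [oW Wx [_ h]]] := loc x (VU x Vx).
have oVW : open (V `&` W) by exact: openI.
have sub1 : V `&` W `<=` U `&` W by move=> y [/VU].
have sub2 : V `&` W `<=` V by move=> y [].
have vu' : vanishes_along (V `&` W) u by move=> i [Vi _]; exact: vu.
have [w' [h1 h2]] := h (V `&` W) u oVW sub1 (sect_res oV oVW sub2 su) vu'.
by exists W, w'.
Qed.

Lemma is_form2_pole_local U (q : form2 P) : open U ->
  (forall x, U x -> exists W, [/\ open W, W x & is_form2_pole (U `&` W) q]) ->
  is_form2_pole U q.
Proof.
move=> oU loc; split.
  apply: is_form2_local => [|x [Ux nx]]; first exact: open_off.
  have [W [oW Wx [h _]]] := loc x Ux; exists W; split => //.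
  by apply: is_form2_sub h => y [[Uy ny] Wy]; split.
move=> V u oV VU su vu.
apply: (@glue_off (fun x => bil P x) (fun x q q' => forall D E, is_vec D -> is_vec E -> q D E = q' D E)
  (is_form2 (P := P)) (fun x F G => u x * q x F G)) => //.
- exact: is_form2_eq.
- by move=> U' W s; exact: is_form2_sub.
- exact: is_form2_local.
move=> x Vx; have [W [oW Wx [_ h]]] := loc x (VU x Vx).
have oVW : open (V `&` W) by exact: openI.
have sub1 : V `&` W `<=` U `&` W by move=> y [/VU].
have sub2 : V `&` W `<=` V by move=> y [].
have vu' : vanishes_along (V `&` W) u by move=> i [Vi _]; exact: vu.
have [q' [h1 h2]] := h (V `&` W) u oVW sub1 (sect_res oV oVW sub2 su) vu'.
by exists W, q'.
Qed.

End Glue.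

(** * Connections at a point off the marked points *)

Section StalkConnections.
Context (R : realType) (X : topologicalType) (n : nat) (c : 'I_n -> X).

(** Bilinearity of nabla w is a statement about sections, so the covector w is first extended to a
    one-form near x. *)
Lemma nabla_conn (m : nat) (T : affine_family R c m) x : off c setT x ->
  (forall w : cov T x, is_cov w -> exists V Om, [/\ open V, V x, is_form1 V Om &
     forall F, is_vec F -> Om x F = w F]) ->
  is_conn (nabla T x).
Proof.
move=> ox ext; split.
- move=> w w' hw hw' e D E vD vE; exact: nabla_ext.
- move=> w w' hw hw' D E vD vE; exact: nablaD.
- move=> f w hw D E vD vE; exact: nabla_leibniz.
- move=> w hw; have [V [Om [oV Vx hO e]]] := ext w hw.
  have [[h _] _] := nabla_sect oV hO.
  have hx : off c V x by split => //; case: ox.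
  have [hcov _] := hO.
  by apply: is_bil_eq (h x hx) => D E vD vE; apply: nabla_ext => //; exact: hcov.
Qed.

Section Base.
Context (S : curve R c 0) (W : set X) (phi : X -> Cx R) (z : forall y, stalk S y) (d : vfield S).
Hypothesis cW : is_coord W phi z d.
Arguments d : clear implicits.

Definition dform : form1 S := fun y F => F (z y).

Lemma dform_cov y : is_cov (@dform y).
Proof. by split. Qed.

Lemma dform_form1 : is_form1 W (@dform).
Proof.
case: cW => oW sz vd dd al; split=> [y _|V v oV VW [_ hv]]; first exact: dform_cov.
by apply: hv => //; exact: sect_res sz.
Qed.

Lemma coord_vec y (F : vec S y) : W y -> is_vec F -> F = fun a => F (z y) * d y a.
Proof. by case: cW => _ _ _ dd _ /dd [_ h _] vF; apply/funext => a; exact: h. Qed.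

Lemma coord_dz y : W y -> d y (z y) = 1.
Proof. by case: cW => _ _ _ dd _ /dd []. Qed.

Lemma coord_dvec y : W y -> is_vec (d y).
Proof. by case: cW => _ _ [h _] _ _; exact: h. Qed.

Lemma coord_cov y (w : cov S y) F : W y -> is_cov w -> is_vec F -> w F = w (d y) * F (z y).
Proof.
move=> Wy hw vF; rewrite {1}(coord_vec Wy vF) (covZ _ hw) 1?mulrC //.
exact: coord_dvec.
Qed.

End Base.
Arguments dform {S} z x f : rename.

(** In a coordinate w = w(d/dz) dz, and the coefficient is a germ of a section. *)
Lemma cov_ext_base (S : curve R c 0) x (w : cov S x) : is_cov w ->
  exists V Om, [/\ open V, V x, is_form1 V Om & forall F, is_vec F -> Om x F = w F].
Proof.
move=> hw; have [W [phi [z [d [Wx cW]]]]] := coord_ex S x.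
have [V [s [oV Vx ss es]]] := germ_ext (w (d x)).
have oW : open W by case: cW.
have oVW : open (V `&` W) by exact: openI.
exists (V `&` W), (fun y F => s y * dform z y F); split => //.
- apply: is_form1Z => //; first by apply: sect_res ss => // y [].
  by apply: is_form1_sub (dform_form1 cW) => y [].
- by move=> F vF; rewrite es /dform -(coord_cov cW).
Qed.

Lemma conn_base (S : affine_family R c 0) x : off c setT x -> is_conn (nabla S x).
Proof. by move=> ox; apply: nabla_conn => // w; exact: cov_ext_base. Qed.

Section Total.
Context (S : affine_family R c 0) (m : nat) (D : deformation S m).

(** Coordinates in the sense of [is_coord] exist only on S, so the components of w in a frame are
    extended over S and reassembled. *)
Lemma conn_total x : off c setT x -> is_conn (nabla D x).
Proof.
move=> ox; apply: nabla_conn => // w hw.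
have [U [K [Ux pf _]]] := preframe_ex D x; have fr := pf_fr pf Ux.
have [V0 [O0 [oV0 V0x f0 e0]]] := cov_ext_base (fc0_cov fr hw).
have /choice [V1 /choice [O1 h1]] l := cov_ext_base (fc1_cov fr l hw).
pose V := V0 `&` [set y | forall l, V1 l y] `&` U.
have oV : open V.
  apply: openI; last exact: pf_open pf.
  apply: openI => //; apply: open_forall_ord => l; by have [] := h1 l.
have Vx : V x by split => //; split => // l; have [] := h1 l.
have VU : V `<=` U by move=> y [].
exists V, (fun y F => clift0 (K y) (O0 y) F + \sum_l str D y (aeps R l) * clift0 (K y) (O1 l y) F).
split => //.
- apply: is_form1D.
    by apply: (pf_clift0 pf VU); apply: is_form1_sub f0 => y [[]].
  apply: is_form1_sum => l; apply: is_form1Z => //; first exact: sect_str.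
  apply: (pf_clift0 pf VU); have [_ _ f1 _] := h1 l; apply: is_form1_sub f1 => y [[_ h] _].
  exact: h.
- move=> F vF; rewrite (cov_dec fr hw vF).
  have v0 := fv0_vec fr vF.
  have e1 : clift0 (K x) (O0 x) F = clift0 (K x) (fc0 (K x) w) F.
    rewrite /clift0 /clift e0 //; congr (frinv _ (mk _ _)); apply/funext => l.
    by rewrite e0 //; exact: fv1_vec.
  rewrite e1; congr (_ + _); apply: eq_bigr => l _; congr (_ * _).
  have [_ _ _ e2] := h1 l.
  rewrite /clift0 /clift e2 //; congr (frinv _ (mk _ _)); apply/funext => k.
  by rewrite e2 //; exact: fv1_vec.
Qed.

Section AtPoint.
Context (x : X) (ox : off c setT x) (K : stalk D x -> sqz (stalk S x) m) (fr : is_frame K).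
Hypothesis K1 : forall a, (K a).1 = rho a.

(** The reduction is a morphism of affine families, and lifted tensors are related by it to the
    tensors they lift. *)
Lemma conn_lift1 w F G : is_cov w -> is_vec F -> is_vec G ->
  (K (nabla D x (clift0 K w) (vlift0 K F) (vlift0 K G))).1 = nabla S x w F G.
Proof.
move=> hw vF vG; have [_ h] := rho_mor D.
have rel F' : is_vec F' -> rel_vec (@rho _ _ _ _ _ _ D x) (vlift0 K F') F'.
  by move=> vF' a; rewrite -!K1 /vlift0 /vlift (frinvK fr) mk1.
have hw' := clift0_cov fr hw.
rewrite K1; apply/esym/(h x ox _ _ hw' hw) => //; try exact: vlift0_vec.
- move=> E E' vE vE' hE; rewrite -K1 /clift0 /clift (frinvK fr) mk1; congr w.
  apply/funext => h'; rewrite /fv0 K1 -hE -K1 (frinvK fr) mk1 //.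
- exact: rel.
- exact: rel.
Qed.

Lemma conn_ex : exists eta : 'I_m -> cov S x, (forall l, is_cov (eta l)) /\
  conn_form K (nabla S x) eta (nabla D x).
Proof.
have [W [phi [z [d [Wx cW]]]]] := coord_ex S x.
have cD := conn_total ox; have vd := coord_dvec cW Wx; have vd' := vlift0_vec fr vd.
have hz := dform_cov z x; have hz' := clift0_cov fr hz.
(* The form eta_l is read off from dz and d/dz. A general w is u dz with u a germ of S; the lift of
   u has no e_l-part, so the Leibniz rule creates no further e_l-terms. *)
pose eta l := fc1 K (fun F => nabla D x (clift0 K (dform z x)) F (vlift0 K (d x))) l.
have heta l : is_cov (eta l) by apply: (fc1_cov fr); exact: (conn_covl cD).
exists eta; split => //; apply: conn_lift => // w F G hw vF vG.
apply: sqz_eq => [|l]; first by rewrite conn_lift1.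
rewrite mk2.
have vF' := vlift0_vec fr vF; have vG' := vlift0_vec fr vG; have hw' := clift0_cov fr hw.
pose u := w (d x); pose L h := frinv K (mk h (fun=> 0)).
have eG : vlift0 K G = fun a => L (G (z x)) * vlift0 K (d x) a.
  by rewrite {1}(coord_vec cW Wx vG) (vlift0Z fr).
have ew E : is_vec E -> clift0 K w E = L u * clift0 K (dform z x) E.
  move=> vE; apply: (fr_inj fr); rewrite (frM fr) !(frinvK fr).
  have v0 := fv0_vec fr vE; have v1 k := fv1_vec fr k vE.
  apply: sqz_eq => [|k]; first by rewrite !mk1 (coord_cov cW).
  by rewrite sqz2M !mk2 !mk1 mulr0 addr0 !add0r (coord_cov cW).
rewrite eG (covZ _ (conn_covr cD hw' vF') vd').
rewrite (conn_ext cD hw' (is_covZ (L u) hz') ew vF' vd') (connZ cD _ hz' vF' vd').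
have dz1 : clift0 K (dform z x) (vlift0 K (d x)) = 1.
  apply: (fr_inj fr); rewrite (frinvK fr) (fv0_lift fr) /dform (coord_dz cW Wx).
  rewrite -(rmorph1 (str D x)) (fr_str fr); apply: sqz_eq => [|k].
    by rewrite !mk1 -(rmorph1 (str S x)); congr (str S x _); apply: A0_eq.
  rewrite !mk2 (fv1_lift0 fr) // /= mxE acst0_0 rmorph0 addr0 //.
have F1 : (K (vlift0 K F (L u))).2 ord0 l = 0.
  rewrite /vlift0 /vlift (frinvK fr) mk2 (frinvK fr) mk2 (vec_0 vF) addr0 //.
rewrite dz1 mulr1 (frM fr) sqz2M (frD fr) sqz2D F1 add0r (frinvK fr) mk1 mk2 mulr0 addr0.
rewrite (frM fr) sqz2M (frinvK fr) mk1 mk2 mulr0 addr0 (coord_cov cW Wx hw vG) /eta /fc1 /u.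
by rewrite [in RHS]mulrCA mulrA mulrC mulrA; ring.
Qed.

End AtPoint.

End Total.

End StalkConnections.
Arguments dform {R X n c S} z x f : rename.

Section StalkExtras.
Context (R : realType) (X : topologicalType) (n : nat) (c : 'I_n -> X) (m : nat).
Context (S : curve R c 0) (P : curve R c m) (x : X).

Lemma frame_twist (K K' : stalk P x -> sqz (stalk S x) m) (psi : 'I_m -> vec S x) :
  is_frame K -> is_frame K' -> (forall a, (K' a).1 = (K a).1) ->
  (forall h l, (K' (frinv K (mk h (fun=> 0)))).2 ord0 l = psi l h) ->
  forall a, K' a = twist psi (K a).
Proof.
move=> fr fr' t1 e a; apply: sqz_eq => [|l]; first by rewrite t1.
rewrite twist2 {1}(fr_dec fr a) (frD fr') sqz2D (fr_sumE2 fr') t1 e.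
by rewrite (frinvK fr) mk1 addrC.
Qed.

(** Converse of [conn_lift]: on lifts the e_l-components vanish and only the eta-term survives. *)
Lemma conn_form_lift (K : stalk P x -> sqz (stalk S x) m) nS eta nP : is_frame K -> is_conn nS ->
  conn_form K nS eta nP -> (forall l, is_cov (eta l)) ->
  forall w F G, is_cov w -> is_vec F -> is_vec G ->
  K (nP (clift0 K w) (vlift0 K F) (vlift0 K G)) = mk (nS w F G) (fun l => eta l F * w G).
Proof.
move=> fr hS hc heta w F G hw vF vG.
have hw' := clift0_cov fr hw; have vF' := vlift0_vec fr vF; have vG' := vlift0_vec fr vG.
have e0 E : is_vec E -> fc0 K (clift0 K w) E = w E by exact: (fc0_lift fr).
have e1 l E : is_vec E -> fc1 K (clift0 K w) l E = 0 by exact: (fc1_lift fr).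
rewrite hc // !(fv0_lift fr); apply: sqz_eq => [|l].
  by rewrite !mk1; apply: (conn_ext hS) => //; exact: fc0_cov.
rewrite !mk2 !(fv1_lift0 fr) // e0 //.
have w0 := fc0_cov fr hw'.
rewrite (cov0 (conn_covl hS w0 vG)) (cov0 (conn_covr hS w0 vF)).
rewrite (conn_ext hS (fc1_cov fr l hw') (is_cov0 S x) (e1 l) vF vG) (conn0 hS vF vG).
by rewrite !add0r.
Qed.

End StalkExtras.

(** * Morphisms and base change in trivializations *)

Section MorphismsInFrames.
Context (R : realType) (X : topologicalType) (n : nat) (c : 'I_n -> X) (m m' : nat).
Context (S : curve R c 0) (P : curve R c m) (P' : curve R c m') (x : X).
Context (M : 'M[Cx R]_(m, m')).
Local Notation O := (stalk S x).
Local Notation kap a := (str S x (acst 0 a)).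

Definition mxcomb (b : 'I_m -> O) (k : 'I_m') : O := \sum_l kap (M l k) * b l.

(** The O-linear extension of the base change e_l |-> sum_k M_lk e_k. *)
Definition sqz_map (t : sqz O m) : sqz O m' := mk t.1 (mxcomb (fun l => t.2 ord0 l)).

Lemma mxcomb0 k : mxcomb (fun=> 0) k = 0.
Proof. by rewrite /mxcomb big1 // => l _; rewrite mulr0. Qed.

Lemma sqz_map_mk h b : sqz_map (mk h b) = mk h (mxcomb b).
Proof.
apply: sqz_eq => // k; rewrite !mk2 /mxcomb; apply: eq_bigr => l _; by rewrite mk2.
Qed.

Lemma sqz_map_mk0 h : sqz_map (mk h (fun=> 0)) = mk h (fun=> 0).
Proof. by rewrite sqz_map_mk; apply: sqz_eq => // k; rewrite !mk2 mxcomb0. Qed.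

Lemma sqz_mapD s t : sqz_map (s + t) = sqz_map s + sqz_map t.
Proof.
apply: sqz_eq => // k; rewrite sqz2D !mk2 /mxcomb -big_split /=; apply: eq_bigr => l _.
by rewrite mxE mulrDr.
Qed.

Lemma sqz_mapM s t : sqz_map (s * t) = sqz_map s * sqz_map t.
Proof.
apply: sqz_eq => // k; rewrite sqz2M !mk2 !mk1 /mxcomb !mulr_sumr -big_split /=.
by apply: eq_bigr => l _; rewrite !mxE; ring.
Qed.

Lemma sqz_map_str k : sqz_map (sstr S x k) = sstr S x (base_map M k).
Proof.
apply: sqz_eq => // j; rewrite !mk2 /= mxE /mxcomb.
have -> : acst 0 (\sum_j0 k.2 ord0 j0 * M j0 j) = \sum_j0 acst 0 (M j0 j) * acst 0 (k.2 ord0 j0) :> A R 0.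
  by apply: A0_eq; rewrite sqz1_sum; apply: eq_bigr => l _; rewrite sqzE mulrC.
rewrite rmorph_sum; by apply: eq_bigr => l _; rewrite (rmorphM (str S x)) mxE.
Qed.

Lemma sqz_map_twist (chi : 'I_m -> vec S x) t : (forall l, is_vec (chi l)) ->
  sqz_map (twist chi t) = twist (fun k a => mxcomb (fun l => chi l a) k) (sqz_map t).
Proof.
move=> hc; apply: sqz_eq => // k; rewrite twist2 !mk2 /mxcomb -big_split /=.
by apply: eq_bigr => l _; rewrite twist2 mulrDr.
Qed.

Context (K : stalk P x -> sqz O m) (fr : is_frame K).
Context (K' : stalk P' x -> sqz O m') (fr' : is_frame K').
Context (f : stalk P x -> stalk P' x) (hf : forall a, K' (f a) = sqz_map (K a)).

Lemma mor_frinv h : f (frinv K (mk h (fun=> 0))) = frinv K' (mk h (fun=> 0)).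
Proof. by apply: (fr_inj fr'); rewrite hf (frinvK fr) (frinvK fr') sqz_map_mk0. Qed.

Lemma rel_fv0 F F' : rel_vec f F F' -> fv0 K' F' = fv0 K F.
Proof. by move=> rel; apply/funext => h; rewrite /fv0 -mor_frinv rel hf. Qed.

Lemma rel_fv1 F F' k : rel_vec f F F' -> fv1 K' F' k = fun h => mxcomb (fun l => fv1 K F l h) k.
Proof. by move=> rel; apply/funext => h; rewrite /fv1 -mor_frinv rel hf mk2. Qed.

Lemma rel_vlift0 F : is_vec F -> rel_vec f (vlift0 K F) (vlift0 K' F).
Proof.
move=> vF a; apply: (fr_inj fr'); rewrite hf /vlift0 /vlift (frinvK fr) (frinvK fr') hf.
apply: sqz_eq => // k; rewrite !mk2 add0r /mxcomb (vec_sum _ vF).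
by apply: eq_bigr => l _; rewrite mk2 add0r (vec_str _ _ vF).
Qed.

Lemma rel_clift0 w : is_cov w -> rel_cov f (clift0 K w) (clift0 K' w).
Proof.
move=> hw F F' vF vF' rel; apply: (fr_inj fr'); rewrite hf /clift0 /clift (frinvK fr) (frinvK fr').
rewrite (rel_fv0 rel); apply: sqz_eq => // k; rewrite !mk2 (rel_fv1 _ rel) add0r /mxcomb.
have v1 l := fv1_vec fr l vF.
rewrite (cov_sum hw) => [|l]; last exact: is_vecZ.
by apply: eq_bigr => l _; rewrite (covZ _ hw) // mk2 add0r.
Qed.

Lemma rel_fc0 w w' F : is_vec F -> rel_cov f w w' -> fc0 K' w' F = fc0 K w F.
Proof.
move=> vF rel; rewrite /fc0 (rel (vlift0 K F)) ?hf //.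
- exact: vlift0_vec.
- exact: vlift0_vec.
- exact: rel_vlift0.
Qed.

Lemma rel_fc1 w w' k F : is_vec F -> rel_cov f w w' ->
  fc1 K' w' k F = mxcomb (fun l => fc1 K w l F) k.
Proof.
move=> vF rel; rewrite /fc1 (rel (vlift0 K F)) ?hf ?mk2 //.
- exact: vlift0_vec.
- exact: vlift0_vec.
- exact: rel_vlift0.
Qed.

(** The e-components of related vectors and covectors transform linearly by M while their bodies
    agree, so compatibility of the connections comes down to that of the eta's. *)
Lemma mor_conn nS eta eta' nP nP' : is_conn nS ->
  conn_form K nS eta nP -> conn_form K' nS eta' nP' ->
  (forall k F, is_vec F -> eta' k F = mxcomb (fun l => eta l F) k) ->
  forall w w', is_cov w -> is_cov w' -> rel_cov f w w' ->
  rel_bil f (nP w) (nP' w').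
Proof.
move=> hS hc hc' he w w' hw hw' rw F F' G G' vF vF' vG vG' rF rG.
apply: (fr_inj fr'); rewrite hf hc // hc' // sqz_map_mk.
rewrite !(rel_fv0 rF) !(rel_fv0 rG).
have vF0 := fv0_vec fr vF; have vG0 := fv0_vec fr vG.
have w0 := fc0_cov fr hw; have w0' := fc0_cov fr' hw'.
have e0 E : is_vec E -> fc0 K' w' E = fc0 K w E by move=> vE; exact: rel_fc0.
have n0 E H : is_vec E -> is_vec H -> nS (fc0 K' w') E H = nS (fc0 K w) E H.
  by move=> vE vH; apply: (conn_ext hS).
apply: sqz_eq => [|k]; first by rewrite !mk1 n0.
have vF1 l := fv1_vec fr l vF; have vG1 l := fv1_vec fr l vG.
have vF1' := fv1_vec fr' k vF'; have vG1' := fv1_vec fr' k vG'.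
have w1 l := fc1_cov fr l hw; have w1' := fc1_cov fr' k hw'.
rewrite !mk2 !n0 // e0 // (rel_fv1 _ rF) (rel_fv1 _ rG) he //.
have e1 E : is_vec E -> fc1 K' w' k E = \sum_l kap (M l k) * fc1 K w l E.
  by move=> vE; exact: rel_fc1.
have hs l : is_cov (fun E => kap (M l k) * fc1 K w l E) by exact: is_covZ.
rewrite (conn_ext hS w1' (is_cov_sum hs) e1 vF0 vG0) (conn_sum hS hs vF0 vG0).
rewrite /mxcomb (cov_sum (conn_covl hS w0 vG0)) => [|l]; last exact: is_vecZ.
rewrite (cov_sum (conn_covr hS w0 vF0)) => [|l]; last exact: is_vecZ.
rewrite mulr_suml -!big_split /=; apply: eq_bigr => l _.
rewrite (conn_str hS _ (w1 l) vF0 vG0) (covZ _ (conn_covl hS w0 vG0)) //.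
by rewrite (covZ _ (conn_covr hS w0 vF0)) //; ring.
Qed.

End MorphismsInFrames.

(** * Cocycles of a deformation over B_m *)

Section Rep.
Context (R : realType) (X : topologicalType) (n : nat) (c : 'I_n -> X).
Context (S : affine_family R c 0).
Local Notation kap x a := (str S x (acst 0 a)).

Definition repK (m : nat) (D : deformation S m) (I : Type) (U : I -> set X)
    (chi : 'I_m -> I -> I -> vfield S) (eta : 'I_m -> I -> form1 S)
    (K : I -> forall x, stalk D x -> sqz (stalk S x) m) : Prop :=
  [/\ open_cover U,
      forall i, lframe (U i) (K i),
      forall i x, U i x -> forall a, (K i x a).1 = rho a,
      forall i j x, U i x -> U j x -> forall a, K j x a = twist (fun l => chi l i j x) (K i x a) &
      forall i x, off c (U i) x -> (forall l, is_cov (eta l i x)) /\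
        conn_form (K i x) (nabla S x) (fun l => eta l i x) (nabla D x)].

(* The analogue of [represents] over B_m: the cocycle has one component for each e_l. *)
Definition rep (m : nat) (D : deformation S m) (I : Type) (U : I -> set X)
    (chi : 'I_m -> I -> I -> vfield S) (eta : 'I_m -> I -> form1 S) : Prop :=
  exists K : I -> forall x, stalk D x -> sqz (stalk S x) m, repK U chi eta K.

Lemma off_setT U x : off c U x -> off c setT x.
Proof. by case. Qed.

Section General.
Context (m : nat) (D : deformation S m).

Lemma rep_refine I J (U : I -> set X) chi eta (W : J -> set X) (r : J -> I) :
  rep D U chi eta -> open_cover W -> (forall k, W k `<=` U (r k)) ->
  rep D W (fun l k k' => chi l (r k) (r k')) (fun l k => eta l (r k)).
Proof.
move=> [K [oc lf k1 tr co]] oW sub; exists (fun k => K (r k)); split => //.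
- by move=> k; apply: lf_sub (lf (r k)) => //; case: oW.
- by move=> k x /sub; exact: k1.
- by move=> k k' x /sub h /sub h' a; exact: tr.
- by move=> k x h; apply: co; exact: off_sub h.
Qed.

(** A change of trivializations by 1 + sum e_l psi_l shows that adding a coboundary to the cocycle
    does not change the deformation. *)
Lemma rep_twist I (U : I -> set X) chi eta chi' eta' (psi : 'I_m -> I -> vfield S) :
  rep D U chi eta -> (forall l i, is_vfield_zero (U i) (psi l i)) ->
  (forall l i j x, U i x -> U j x -> forall a : stalk S x,
     chi' l i j x a = chi l i j x a + psi l j x a - psi l i x a) ->
  (forall l i x, off c (U i) x -> is_cov (eta' l i x)) ->
  (forall l i, is_lie_nabla (U i) (psi l i) (fun x F => eta' l i x F - eta l i x F)) ->
  rep D U chi' eta'.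
Proof.
move=> [K [oc lf k1 tr co]] hpsi hchi heta hlie.
exists (fun i x => twist (fun l => psi l i x) \o K i x); split => //.
- by move=> i; apply: (@lf_twist _ _ _ _ _ _ _ _ _ (fun l => psi l i)).
- move=> i j x Ui Uj a; rewrite /= (tr i j) //; apply: sqz_eq => // l.
  by rewrite !twist2 !twist1 hchi //; ring.
- move=> i x oi; have [h1 h2] := co i x oi; split; first by move=> l; exact: heta.
  have fr : is_frame (K i x) by exact: (pf_fr (lf i).1 oi.1).
  have vc l : is_vec (psi l i x) by have [[h _] _] := hpsi l i; apply: h; case: oi.
  have lie l w F G : is_cov w -> is_vec F -> is_vec G ->
      (eta' l i x F - eta l i x F) * w G = lie_conn (nabla S x) (psi l i x) w F G.
    by move=> hw vF vG; exact: hlie.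
  exact: (conn_twist (eta' := fun l => eta' l i x) fr (conn_base S (off_setT oi)) vc h2 lie).
Qed.

Lemma rep_eq I (U : I -> set X) chi eta chi' eta' :
  rep D U chi eta ->
  (forall l i j x, U i x -> U j x -> forall a : stalk S x, chi' l i j x a = chi l i j x a) ->
  (forall l i x, off c (U i) x -> forall F, is_vec F -> eta' l i x F = eta l i x F) ->
  rep D U chi' eta'.
Proof.
move=> [K [oc lf k1 tr co]] hchi heta; exists K; split => //.
- move=> i j x Ui Uj a; rewrite (tr i j) //; apply: sqz_eq => // l; by rewrite !twist2 hchi.
- move=> i x oi; have [h1 h2] := co i x oi.
  have fr : is_frame (K i x) by exact: (pf_fr (lf i).1 oi.1).
  split=> [l|w F G hw vF vG].
    by apply: is_cov_eq (h1 l) => F vF; rewrite heta.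
  by rewrite h2 //; apply: sqz_eq => // l; rewrite !mk2 heta //; exact: fv0_vec.
Qed.

Lemma rep_chi_zero I (U : I -> set X) chi eta : rep D U chi eta ->
  forall l i j, is_vfield_zero (U i `&` U j) (chi l i j).
Proof.
move=> [K [oc lf k1 tr co]] l i j; have oV : open (U i `&` U j) by apply: openI; apply oc.
have s1 : U i `&` U j `<=` U i by move=> x [].
have s2 : U i `&` U j `<=` U j by move=> x [].
have := @lf_two_zero _ _ _ _ _ _ _ _ _ _ (lf_sub oV s1 (lf i)) (lf_sub oV s2 (lf j)) (fun l => chi l i j).
by apply=> x [Ui Uj] a; exact: tr.
Qed.

Lemma rep_chi_cocycle I (U : I -> set X) chi eta : rep D U chi eta ->
  forall l i j k x, U i x -> U j x -> U k x -> forall a : stalk S x,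
  chi l j k x a - chi l i k x a + chi l i j x a = 0.
Proof.
move=> [K [oc lf k1 tr co]] l i j k x Ui Uj Uk a.
have fr := pf_fr (lf i).1 Ui; set b := frinv (K i x) (mk a (fun=> 0)).
have := tr i k x Ui Uk b; rewrite (tr j k x Uj Uk b) (tr i j x Ui Uj b) (frinvK fr).
move/(congr1 (fun t : sqz (stalk S x) m => t.2 ord0 l)); rewrite !twist2 !twist1 mk2 mk1 !add0r => <-.
by ring.
Qed.

Lemma rep_lie I (U : I -> set X) chi eta : rep D U chi eta ->
  forall l i j, is_lie_nabla (U i `&` U j) (chi l i j) (fun x F => eta l j x F - eta l i x F).
Proof.
move=> hr l i j x [[Ui Uj] nx] w hw F G vF vG; have hz := rep_chi_zero hr.
have [K [oc lf k1 tr co]] := hr.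
have oi : off c (U i) x by []. have oj : off c (U j) x by [].
have fr := pf_fr (lf i).1 Ui.
have [h1 h2] := co i x oi; have [h1' h2'] := co j x oj.
have ek : K j x = twist (fun l => chi l i j x) \o K i x by apply/funext => a; exact: tr.
have vc l' : is_vec (chi l' i j x) by have [[h _] _] := hz l' i j; apply: h.
rewrite ek in h2'.
exact: (conn_twist_lie fr (conn_base S (off_setT oi)) vc h2 h2' l hw vF vG).
Qed.

End General.

(* In a coordinate, eta_l is read off the connection of D along dz and d/dz. *)
Lemma conn_form_pole (m : nat) (D : deformation S m) U phi z d
    (K : forall x, stalk D x -> sqz (stalk S x) m) (eta : 'I_m -> form1 S) :
  is_coord (S := S) U phi z d -> lframe U K ->
  (forall x, off c U x -> (forall l, is_cov (eta l x)) /\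
        conn_form (K x) (nabla S x) (fun l => eta l x) (nabla D x)) ->
  forall l, is_form1_pole U (eta l).
Proof.
move=> cU lf co l; have oU := pf_open lf.1; have sUU : U `<=` U by [].
pose om : form1 D := fun x => clift0 (K x) (dform z x).
pose dh : vfield D := fun x => vlift0 (K x) (d x).
have vd : is_vfield U d by case: cU.
have hom : is_form1 U om by apply: (pf_clift0 lf.1) => //; exact: dform_form1 cU.
have hdh : is_vfield U dh by exact: (pf_vlift0 lf.1).
have [hn hp] := nabla_sect oU hom.
have key x F : off c U x -> is_vec F ->
    (K x (nabla D x (om x) (vlift0 (K x) F) (dh x))).2 ord0 l = eta l x F.
  move=> ox vF; have [h1 h2] := co x ox; have [Ux _] := ox.
  rewrite (conn_form_lift (pf_fr lf.1 Ux) (conn_base S (off_setT ox)) h2 h1 (dform_cov z x) vF (coord_dvec cU Ux)).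
  by rewrite mk2 /dform (coord_dz cU Ux) mulr1.
split.
  have f1 := pf_fc1 lf.1 l (@off_in _ _ c U) (is_form2_contr hn (is_vfield_sub (@off_in _ _ c U) hdh)).
  apply: is_form1_eq f1 => x ox F vF; exact: key.
move=> V u oV VU su vu.
pose uh x := frinv (K x) (mk (u x) (fun=> 0)).
have suh : sect D V uh by exact: (pf_mk0 lf.1).
have vuh : vanishes_along V uh.
  move=> i Vi; rewrite /uh (lf_along0 _ lf) ?vu //; last exact: VU.
  by apply: sqz_eq => // k; rewrite mk2 sqz20.
have [q' [hq eq]] := hp V uh oV VU suh vuh.
have f1 := pf_fc1 lf.1 l VU (is_form2_contr hq (is_vfield_sub VU hdh)).
eexists; split; first exact: f1.
move=> x ox F vF; have ox' := off_sub VU ox; have [Ux _] := ox'.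
have fr := pf_fr lf.1 Ux; have [vdx _] := hdh.
rewrite /fc1 eq //; [|exact: vlift0_vec | exact: vdx].
by rewrite (frM fr) sqz2M key // /uh (frinvK fr) mk1 mk2 mulr0 addr0.
Qed.

(** The cover is indexed by the points of X. A coordinate is kept on each member since dz will serve
    as the nowhere-zero form required by [represents]. *)
Lemma rep_ex (hX : hausdorff_space X) (c_inj : injective c) (m : nat) (D : deformation S m) :
  exists (U : X -> set X) chi eta, rep D U chi eta /\
    forall i, exists phi z d, is_coord (S := S) (U i) phi z d.
Proof.
have ex x : exists UK : set X * (forall y, stalk D y -> sqz (stalk S y) m),
    [/\ UK.1 x, lframe UK.1 UK.2, forall y, UK.1 y -> forall a, (UK.2 y a).1 = rho a &
      exists phi z d, is_coord (S := S) UK.1 phi z d].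
  have [U [K [Ux lf k1]]] := frame_ex D hX c_inj x.
  have [W [phi [z [d [Wx cW]]]]] := coord_ex S x.
  have oV : open (U `&` W) by apply: openI; [exact: pf_open lf.1 | case: cW].
  exists (U `&` W, K) => /=; split => //.
  - by apply: lf_sub lf => // y [].
  - by move=> y [Uy _]; exact: k1.
  - by exists phi, z, d; apply: is_coord_sub cW => // y [].
have [UK hUK] := choice ex; pose U x := (UK x).1; pose K x := (UK x).2.
have lf x : lframe (U x) (K x) by have [] := hUK x.
have k1 x y : U x y -> forall a, (K x y a).1 = rho a by have [_ _ h _] := hUK x; exact: h.
have tr i j : exists psi : 'I_m -> vfield S, forall x, U i x -> U j x ->
    forall a, K j x a = twist (fun l => psi l x) (K i x a).
  have oV : open (U i `&` U j) by apply: openI; exact: pf_open (lf _).1.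
  have s1 : U i `&` U j `<=` U i by move=> x [].
  have s2 : U i `&` U j `<=` U j by move=> x [].
  have [|psi h] := lf_two (lf_sub oV s1 (lf i)) (lf_sub oV s2 (lf j)).
    by move=> x [Ui Uj] a; rewrite !k1.
  by exists psi => x Ui Uj a; apply: h.
have tr2 i : exists psi : X -> 'I_m -> vfield S, forall j x, U i x -> U j x ->
    forall a, K j x a = twist (fun l => psi j l x) (K i x a).
  by have [f h] := choice (tr i); exists f.
have [chi hchi] := choice tr2.
have etaex i x : exists et : 'I_m -> cov S x, off c (U i) x ->
    (forall l, is_cov (et l)) /\ conn_form (K i x) (nabla S x) et (nabla D x).
  case: (pselect (off c (U i) x)) => [oi|ni]; last by exists (fun _ _ => 0).
  have [Ui _] := oi.
  have [et [h1 h2]] := conn_ex (off_setT oi) (pf_fr (lf i).1 Ui) (k1 i x Ui).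
  by exists et.
have etaex2 i : exists et : forall x, 'I_m -> cov S x, forall x, off c (U i) x ->
    (forall l, is_cov (et x l)) /\ conn_form (K i x) (nabla S x) (et x) (nabla D x).
  have h x := cid (etaex i x).
  by exists (fun x => sval (h x)) => x; exact: (svalP (h x)).
have [eta heta] := choice etaex2.
exists U, (fun l i j => chi i j l), (fun l i x => eta i x l); split; last first.
  by move=> i; have [_ _ _ h] := hUK i.
exists K; split.
- split; first by move=> i; exact: pf_open (lf i).1.
  by move=> x; exists x; have [] := hUK x.
- exact: lf.
- exact: k1.
- by move=> i j x Ui Uj a; exact: hchi.
- by move=> i x oi; exact: heta.
Qed.

End Rep.

(** * Base change and the action of the matrix on cocycles *)

Section BaseChange.
Context (R : realType) (X : topologicalType) (n : nat) (c : 'I_n -> X).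
Context (S : affine_family R c 0) (m m' : nat) (M : 'M[Cx R]_(m, m')).
Context (D : deformation S m) (D' : deformation S m').
Variables (I : Type) (U : I -> set X).
Variables (chi : 'I_m -> I -> I -> vfield S) (eta : 'I_m -> I -> form1 S).
Arguments chi : clear implicits.
Arguments eta : clear implicits.

Definition chiM (k : 'I_m') (i j : I) : vfield S := fun x a => mxcomb M (fun l => chi l i j x a) k.
Definition etaM (k : 'I_m') (i : I) : form1 S := fun x F => mxcomb M (fun l => eta l i x F) k.

(** In a trivialization the morphism is M acting on coefficients. It does not depend on the
    trivialization, because M carries the transition twists of D to those of D'. *)
Lemma base_change_ex : rep D U chi eta -> rep D' U chiM etaM -> is_base_change M D D'.
Proof.
move=> hr hr'; have hz := rep_chi_zero hr.
have [K [oc lf k1 tr co]] := hr; have [K' [_ lf' k1' tr' co']] := hr'.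
have /choice [ix hix] : forall x, exists i, U i x by case: oc.
pose f x (a : stalk D x) : stalk D' x := frinv (K' (ix x) x) (sqz_map M (K (ix x) x a)).
have fE i x a : U i x -> K' i x (f x a) = sqz_map M (K i x a).
  move=> Ui; have fr' := pf_fr (lf' (ix x)).1 (hix x).
  rewrite (tr (ix x) i) // (tr' (ix x) i) // (frinvK fr') sqz_map_twist // => l.
  by have [[h _] _] := hz l (ix x) i; apply: h.
have fri x := pf_fr (lf (ix x)).1 (hix x).
have fri' x := pf_fr (lf' (ix x)).1 (hix x).
exists f; split; last first.
  by move=> x a; rewrite -(k1' (ix x)) // fE // -(k1 (ix x)).
split.
  split.
  - move=> x _; split => [a b|a b|k]; apply: (fr_inj (fri' x)).
    + by rewrite (frD (fri' x)) !fE // (frD (fri x)) sqz_mapD.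
    + by rewrite (frM (fri' x)) !fE // (frM (fri x)) sqz_mapM.
    + by rewrite fE // (fr_str (fri x)) (fr_str (fri' x)) sqz_map_str.
  - move=> V s oV _ ss; apply: sect_local => // x Vx.
    exists (U (ix x)); split => //; first by case: oc.
    move=> V' oV' V'U V'V; have ss' := sect_res oV oV' V'V ss.
    have [[_ _ h] _] := lf' (ix x); apply/h => //; split => [|k].
      apply: sect_ext (pf_sect1 (lf (ix x)).1 oV' V'U ss') => y V'y; rewrite fE //; exact: V'U.
    have := sect_sum oV' (fun l => sectM oV' (sect_str S (acst 0 (M l k)) oV') (pf_sect2 (lf (ix x)).1 l oV' V'U ss')).
    by apply: sect_ext => y V'y; rewrite fE ?mk2 //; exact: V'U.
  - move=> i _ a; have Ui := hix (c i).
    have [_ al] := lf (ix (c i)); have [_ al'] := lf' (ix (c i)).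
    rewrite al // al' // fE //; apply: sqz_eq => // k.
    rewrite !mk2 [RHS]mxE /mxcomb (rmorph_sum (along S i)) sqz1_sum; apply: eq_bigr => l _.
    by rewrite (rmorphM (along S i)) along_str sqz1M mk2 mulrC.
move=> x ox w w' hw hw' rw.
have oi : off c (U (ix x)) x by split => //; case: ox.
have [_ h] := co _ _ oi; have [_ h'] := co' _ _ oi.
by apply: (mor_conn (fri x) (fri' x) (M := M) _ (conn_base S ox) h h') => // a; exact: fE.
Qed.

(** The trivializations are transported: a lift of functions into D followed by f is a lift into D',
    and in the resulting frame f is M acting on coefficients. *)
Lemma base_change_rep : is_base_change M D D' -> rep D U chi eta -> rep D' U chiM etaM.
Proof.
move=> [f [[[fx fs fal] fn] frho]] hr; have hz := rep_chi_zero hr.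
have [K [oc lf k1 tr co]] := hr.
pose J i x (h : stalk S x) : stalk D' x := f x (frinv (K i x) (mk h (fun=> 0))).
have fD x a b : f x (a + b) = f x a + f x b by have [] := fx x Logic.I.
have fM x a b : f x (a * b) = f x a * f x b by have [] := fx x Logic.I.
have fK x k : f x (str D x k) = str D' x (base_map M k) by have [] := fx x Logic.I.
have hJ i x : U i x -> [/\ forall a b, J i x (a + b) = J i x a + J i x b :> stalk D' x,
    forall a b, J i x (a * b) = J i x a * J i x b :> stalk D' x,
    forall k, J i x (str S x (acst 0 k)) = str D' x (acst m' k) &
    forall a, rho (J i x a) = a].
  move=> Ui; have fr := pf_fr (lf i).1 Ui; split.
  - by move=> a b; rewrite /J mk0D (frinvD fr) fD.
  - by move=> a b; rewrite /J mk0M (frinvM fr) fM.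
  - move=> k; rewrite /J (frinv_str fr) fK; congr (str D' x _).
    by rewrite /base_map /= mul0mx.
  - by move=> a; rewrite /J frho -(k1 i) // (frinvK fr).
pose K' i x := lift_frame (J i x).
have lf' i : lframe (U i) (K' i).
  apply: (lift_lframe (J := J i)); first by case: oc.
  - exact: hJ.
  - by move=> V s oV VU ss; apply: fs => //; exact: (pf_mk0 (lf i).1).
  - move=> k Uk a; rewrite /J fal // (lf_along0 _ (lf i)) //.
    apply: sqz_eq => // l; rewrite /= !mxE big1 // => j _; by rewrite mxE mul0r.
have k1' i x (Ui : U i x) a : (K' i x a).1 = rho a.
  by have [h1 h2 h3 h4] := hJ i x Ui; rewrite /K' lift_frame1.
have KJ i x (Ui : U i x) h : K' i x (J i x h) = mk h (fun=> 0).
  by have [h1 h2 h3 h4] := hJ i x Ui; rewrite /K' lift_frame_J.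
have KJr i x (Ui : U i x) h : frinv (K' i x) (mk h (fun=> 0)) = J i x h.
  by have [h1 h2 h3 h4] := hJ i x Ui; rewrite /K' frinv_lift.
have fE i x (Ui : U i x) a : K' i x (f x a) = sqz_map M (K i x a).
  have fr := pf_fr (lf i).1 Ui; have fr' := pf_fr (lf' i).1 Ui.
  have fsum (F : 'I_m -> stalk D x) : f x (\sum_l F l) = \sum_l f x (F l).
    have f0 : f x 0 = 0 by apply: (addrI (f x 0)); rewrite -fD !addr0.
    have ind k (G : 'I_k -> stalk D x) : f x (\sum_l G l) = \sum_l f x (G l).
      elim: k G => [|k ih] G; first by rewrite !big_ord0.
      by rewrite !big_ord_recl fD ih.
    exact: ind.
  rewrite {1}(fr_dec fr a) fD fsum (frD fr') -/(J i x _) KJ //.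
  rewrite (eq_bigr (fun l => str D' x (base_map M (aeps R l)) * J i x ((K i x a).2 ord0 l))); last first.
    by move=> l _; rewrite fM fK.
  rewrite (fr_sum fr'); apply: sqz_eq => [|k].
    rewrite sqz1D sqz1_sum big1 ?addr0 // => l _.
    by rewrite (frM fr') (fr_str fr') sqzE mk1 acst0_0 rmorph0 mul0r.
  rewrite sqz2D sqz2_sum !mk2 add0r /mxcomb; apply: eq_bigr => l _.
  rewrite (frM fr') (fr_str fr') KJ // sqz2M !mk1 !mk2 mulr0 add0r mulrC.
  congr (str S x (acst 0 _) * _); rewrite /base_map /= mxE (bigD1 l) //= mxE !eqxx mul1r.
  by rewrite big1 ?addr0 // => j ne; rewrite mxE (negbTE ne) andbF mul0r.
exists K'; split => //.
- move=> i j x Ui Uj a; have fr := pf_fr (lf' i).1 Ui; have fr' := pf_fr (lf' j).1 Uj.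
  have fri := pf_fr (lf i).1 Ui.
  apply: frame_twist => // [b|h l]; first by rewrite !k1'.
  rewrite KJr // /J fE // (tr i j) // (frinvK fri) sqz_map_twist => [|k].
    by rewrite twist2 sqz_map_mk0 mk2 mk1 add0r.
  by have [[hv _] _] := hz k i j; apply: hv.
- move=> i x oi; have [Ui _] := oi; have ox := off_setT oi.
  have fr := pf_fr (lf i).1 Ui; have fr' := pf_fr (lf' i).1 Ui.
  have [h1 h2] := co i x oi.
  have cet k : is_cov (@etaM k i x).
    by apply: is_cov_sum => l; apply: is_covZ; exact: h1.
  split => //; apply: (conn_lift fr' (conn_total D' ox)) => w F G hw vF vG.
  have rF := rel_vlift0 fr fr' (fE i x Ui) vF; have rG := rel_vlift0 fr fr' (fE i x Ui) vG.
  have rw := rel_clift0 fr fr' (fE i x Ui) hw.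
  have cw := clift0_cov fr hw; have cw' := clift0_cov fr' hw.
  have vlF := vlift0_vec fr vF; have vlF' := vlift0_vec fr' vF.
  have vlG := vlift0_vec fr vG; have vlG' := vlift0_vec fr' vG.
  rewrite (fn x ox _ _ cw cw' rw _ _ _ _ vlF vlF' vlG vlG' rF rG) fE //.
  rewrite (conn_form_lift fr (conn_base S ox) h2 h1 hw vF vG) sqz_map_mk.
  apply: sqz_eq => // k; rewrite !mk2 /etaM /mxcomb mulr_suml; apply: eq_bigr => l _.
  by rewrite mulrA.
Qed.

End BaseChange.

(** * First-order deformations and their cocycles *)

Section FirstOrder.
Context (R : realType) (X : topologicalType) (n : nat) (c : 'I_n -> X).
Context (S : affine_family R c 0).
Implicit Types (z : cochain S) (D : deformation S 1).

Definition chi1 z (l : 'I_1) (i j : idx z) : vfield S := fun x a => chi i j a.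
Definition eta1 z (l : 'I_1) (i : idx z) : form1 S := fun x F => Defs.eta i F.
(** Unlike [represents], this asks for no nowhere-zero one-forms. A class contains cocycles on
    covers whose members need not carry such forms, so the class of a deformation is described by
    [rep1]. *)
Definition rep1 D z : Prop := rep D (@opens _ _ _ _ _ z) (@chi1 z) (@eta1 z).

Lemma rep_cocycle (hX : hausdorff_space X) D z : rep1 D z -> is_cocycle z.
Proof.
move=> hr; have oc : open_cover (@opens _ _ _ _ _ z) by case: hr => K [].
split.
- exact: oc.
- by move=> i j; exact: (rep_chi_zero hr ord0).
(* The pole condition is local, and on small pieces a coordinate is available for
   [conn_form_pole]. *)
- move=> i; apply: (is_form1_pole_local hX) => [|x Ux]; first by case: oc.
  have [K [_ lf k1 tr co]] := hr.
  have [W [phi [zz [d [Wx cW]]]]] := coord_ex S x.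
  have oW : open W by case: cW.
  exists W; split => //; have oV : open (opens i `&` W) by apply: openI => //; case: oc.
  have sU : opens i `&` W `<=` opens i by move=> y [].
  have sW : opens i `&` W `<=` W by move=> y [].
  apply: (conn_form_pole (eta := fun l => @eta1 z l i) (is_coord_sub oV sW cW) (lf_sub oV sU (lf i)) _ ord0).
  by move=> y oy; apply: co; exact: off_sub oy.
- by move=> i j k x Ui Uj Uk a; exact: (rep_chi_cocycle hr ord0).
- by move=> i j; exact: (rep_lie hr ord0).
Qed.

(** On the cover by intersections of members of the two covers, the two trivializations differ by
    twists psi_p; these form the 0-cochain whose coboundary is the difference of the cocycles. *)
Lemma rep_cohomologous D z z' : rep1 D z -> rep1 D z' -> cohomologous z z'.
Proof.
move=> [K [oc lf k1 tr co]] [K' [oc' lf' k1' tr' co']].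
pose J := (idx z * idx z')%type; pose W (p : J) := opens p.1 `&` opens p.2.
have oW p : open (W p) by apply: openI; [case: oc | case: oc'].
have s1 p : W p `<=` opens p.1 by move=> x [].
have s2 p : W p `<=` opens p.2 by move=> x [].
have ex (p : J) : exists psi : 'I_1 -> vfield S, forall x, W p x ->
    forall a, K' p.2 x a = twist (fun l => psi l x) (K p.1 x a).
  apply: (lf_two (lf_sub (oW p) (@s1 p) (lf p.1)) (lf_sub (oW p) (@s2 p) (lf' p.2))).
  by move=> x [U1 U2] a; rewrite k1 // k1'.
have [psi hpsi] := choice ex.
have zero p : is_vfield_zero (W p) (psi p ord0).
  exact: (lf_two_zero (lf_sub (oW p) (@s1 p) (lf p.1)) (lf_sub (oW p) (@s2 p) (lf' p.2)) (hpsi p)).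
exists J, W, fst, snd, (fun p => psi p ord0); split.
- split => // x; have [_ /(_ x) [i Ui]] := oc; have [_ /(_ x) [j Uj]] := oc'.
  by exists (i, j).
- by move=> p x.
- exact: zero.
- move=> p q x [Up1 Up2] [Uq1 Uq2] a.
  have fr := pf_fr (lf p.1).1 Up1; set b := frinv (K p.1 x) (mk a (fun=> 0)).
  have := tr' p.2 q.2 x Up2 Uq2 b.
  rewrite (hpsi q) // (hpsi p) // (tr p.1 q.1) // (frinvK fr).
  move/(congr1 (fun t : sqz (stalk S x) 1 => t.2 ord0 ord0)).
  rewrite !twist2 !twist1 !mk2 mk1 !add0r /chi1 => e.
  by apply/eqP; rewrite subr_eq addrAC eq_sym subr_eq eq_sym; apply/eqP; rewrite addrC e addrC.
- move=> p x [[Up1 Up2] nx] w hw F G vF vG.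
  have o1 : off c (opens p.1) x by []. have o2 : off c (opens p.2) x by [].
  have fr := pf_fr (lf p.1).1 Up1.
  have [h1 h2] := co _ _ o1; have [h1' h2'] := co' _ _ o2.
  have ek : K' p.2 x = twist (fun l => psi p l x) \o K p.1 x by apply/funext => a; apply: hpsi.
  have vc l : is_vec (psi p l x) by rewrite (ord1 l); have [[h _] _] := zero p; apply: h.
  rewrite ek in h2'.
  exact: (conn_twist_lie fr (conn_base S (off_setT o1)) vc h2 h2' ord0 hw vF vG).
Qed.

Lemma mxcomb_id m (x : X) (b : 'I_m -> stalk S x) k : mxcomb 1%:M b k = b k.
Proof.
rewrite /mxcomb (bigD1 k) //= big1 => [|l ne]; last first.
  by rewrite mxE (negbTE ne) acst0_0 rmorph0 mul0r.
by rewrite mxE eqxx acst0_1 rmorph1 mul1r addr0.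
Qed.

(** Multiplication by e identifies the reduction with the kernel of the reduction map, on both
    sides. A morphism that is the identity on the closed fibre and fixes e is then bijective, as in
    the five lemma. *)
Lemma base_change_iso D D' : is_base_change 1%:M D D' -> iso_def D D'.
Proof.
move=> [f [[[fx fs fal] fn] frho]]; exists f; split => // x.
have fD a b : f x (a + b) = f x a + f x b by have [] := fx x I.
have fM a b : f x (a * b) = f x a * f x b by have [] := fx x I.
have fe l : f x (str D x (aeps R l)) = str D' x (aeps R l).
  have [_ _ ->] := fx x I; congr (str D' x _); rewrite /base_map /= mulmx1 //.
have f0 : f x 0 = 0 by apply: (addrI (f x 0)); rewrite -fD !addr0.
have fN a : f x (- a) = - f x a by apply/eqP; rewrite -addr_eq0 -fD addNr f0.
have ker (D0 : deformation S 1) (a : stalk D0 x) : rho a = 0 -> exists b, a = str D0 x (aeps R ord0) * b.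
  by move=> /rho_ker [b ->]; exists (b ord0); rewrite big_ord1.
have kill (D0 : deformation S 1) (a : stalk D0 x) : rho a = 0 -> str D0 x (aeps R ord0) * a = 0.
  by move=> /ker [b ->]; rewrite mulrA epsM mul0r.
have inj : injective (f x).
  move=> a b eab; apply/eqP; rewrite -subr_eq0; apply/eqP.
  have [d ed] : exists d, a - b = str D x (aeps R ord0) * d.
    by apply: ker; rewrite rhoD rhoN -!frho eab subrr.
  rewrite ed; apply: kill.
  have : \sum_(l < 1) str D' x (aeps R l) * f x d = 0.
    by rewrite big_ord1 -fe -fM -ed fD fN eab subrr.
  by move=> /rho_free /(_ ord0); rewrite frho.
have surj y : exists a, f x a = y.
  have [a ea] := rho_surj D (rho y).
  have [b' eb'] : exists b', y - f x a = str D' x (aeps R ord0) * b'.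
    by apply: ker; rewrite rhoD rhoN frho ea subrr.
  have [b eb] := rho_surj D (rho b').
  exists (a + str D x (aeps R ord0) * b); rewrite fD fM fe.
  apply/eqP; rewrite eq_sym -subr_eq0 opprD addrA eb' -mulrBr; apply/eqP/kill.
  by rewrite rhoD rhoN frho eb subrr.
have [g hg] := choice surj; exists g => a; last exact: hg.
by apply: inj; rewrite hg.
Qed.

Lemma iso_rep D D' z : iso_def D D' -> rep1 D z -> rep1 D' z.
Proof.
move=> [f [h1 h2 _]] hr; have bc : is_base_change 1%:M D D' by exists f.
apply: rep_eq (base_change_rep bc hr) _ _.
- by move=> l i j x _ _ a; rewrite /chiM mxcomb_id.
- by move=> l i x _ F _; rewrite /etaM mxcomb_id.
Qed.

(** Twisting the trivializations of D by psi gives D the very cocycle of D' on the refinement, and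
    equal cocycles yield a morphism over the identity matrix. *)
Lemma cohomologous_iso D D' z z' : rep1 D z -> rep1 D' z' -> cohomologous z z' -> iso_def D D'.
Proof.
move=> hr hr' [J [W [r [r' [psi [oW sub zero hchi hlie]]]]]].
have s1 k : W k `<=` opens (r k) by move=> x /sub[].
have s2 k : W k `<=` opens (r' k) by move=> x /sub[].
have h := rep_refine hr oW s1; have h' := rep_refine hr' oW s2.
apply: base_change_iso; apply: (base_change_ex (U := W)); last first.
  apply: (rep_eq h') => [l i j x _ _ a|l i x _ F _].
    exact: mxcomb_id.
  exact: mxcomb_id.
apply: (rep_twist (psi := fun _ => psi) h) => //.
- move=> l i j x Wi Wj a; have e := hchi i j x Wi Wj a.
  rewrite /chi1; have -> : chi (r' i) (r' j) a = chi (r i) (r j) a + (chi (r' i) (r' j) a - chi (r i) (r j) a).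
    by rewrite addrC subrK.
  by rewrite e addrA.
- move=> l i x oi; have [K [_ _ _ _ co]] := h'; have [h1 _] := co i x oi; exact: h1.
Qed.

End FirstOrder.

(** * Comparison with the cochains of the natural map *)

Section Represents.
Context (R : realType) (X : topologicalType) (n : nat) (c : 'I_n -> X).
Context (S : affine_family R c 0).
Implicit Types (z : cochain S) (D : deformation S 1).

Lemma acst_base k (a : Cx R) : base_map (0 : 'M[Cx R]_(0, k)) (acst 0 a) = acst k a.
Proof. by rewrite /base_map /= mul0mx. Qed.

(** The pullbacks j_i are multiplicative lifts of functions and hence define frames. The connection
    is prescribed only on w_i; as w_i vanishes nowhere, every covector is a multiple of it and the
    Leibniz rule does the rest. *)
Lemma represents_rep D z : represents D z -> rep1 D z.
Proof.
move=> [j [w [y [oc ht hw htr hc]]]].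
have hJ i x : opens i x -> [/\ forall a b, j i x (a + b) = j i x a + j i x b :> stalk D x,
    forall a b, j i x (a * b) = j i x a * j i x b :> stalk D x,
    forall k, j i x (str S x (acst 0 k)) = str D x (acst 1 k) &
    forall a, rho (j i x a) = a].
  move=> Ui; have [[h1 h2 h3] h4] := ht i; have [a1 a2 a3] := h1 x Ui; split => //.
  - by move=> k; rewrite a3 acst_base.
  - by have [] := h4 x Ui.
pose K i x := lift_frame (j i x).
have lf i : lframe (opens i) (K i).
  have [[h1 h2 h3] h4] := ht i.
  apply: (lift_lframe (J := j i)); first by case: oc.
  - exact: hJ.
  - exact: h2.
  - by move=> k Uk a; rewrite h3 // {1}(_ : along S k a = acst 0 (along S k a).1) ?acst_base //; exact: A0_eq.
have k1 i x (Ui : opens i x) a : (K i x a).1 = rho a.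
  by have [h1 h2 h3 h4] := hJ i x Ui; rewrite /K lift_frame1.
have Kj i x (Ui : opens i x) h : K i x (j i x h) = mk h (fun=> 0).
  by have [h1 h2 h3 h4] := hJ i x Ui; rewrite /K lift_frame_J.
have Kjr i x (Ui : opens i x) h : frinv (K i x) (mk h (fun=> 0)) = j i x h.
  by have [h1 h2 h3 h4] := hJ i x Ui; rewrite /K frinv_lift.
exists K; split => //.
- move=> i k x Ui Uk a; have fr := pf_fr (lf i).1 Ui; have fr' := pf_fr (lf k).1 Uk.
  apply: frame_twist => // [b|h l]; first by rewrite !k1.
  rewrite Kjr // (htr i k) // (frD fr') sqz2D (frE2 fr') !Kj // mk2 mk1 (ord1 l) eqxx add0r //.
- move=> i x oi; have [Ui nx] := oi; have ox := off_setT oi; have fr := pf_fr (lf i).1 Ui.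
  have [he hcx] := hc i x oi; split; first by move=> l.
  have [[_ _] nz _ hy] := hw i.
  have [[hwc _] _ [[hyc _] _] _] := hw i.
  have wc := hwc x Ui; have yc := hyc x oi.
  have cD := conn_total D ox.
  have rel (v : cov S x) : is_cov v -> rel_cov (j i x) v (clift0 (K i x) v).
    move=> hv F F' vF vF' rF; apply: (fr_inj fr); rewrite (frinvK fr) Kj //.
    have e0 : fv0 (K i x) F' = F by apply/funext => h; rewrite /fv0 Kjr // rF Kj.
    apply: sqz_eq => [|l]; first by rewrite !mk1 e0.
    have e1 : fv1 (K i x) F' l = fun=> 0 by apply/funext => h; rewrite /fv1 Kjr // rF Kj // mk2.
    by rewrite !mk2 e1 (cov0 hv) addr0.
  apply: (conn_lift fr cD) => v F G hv vF vG.
  apply: sqz_eq => [|l]; first by rewrite (conn_lift1 ox fr (k1 i x Ui)).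
  rewrite mk2.
  have [W [phi [zz [d [Wx cW]]]]] := coord_ex S x.
  have [H [vH wH]] := nz x Ui.
  (* Covectors at x are proportional and w_i H = 1, so v H is the ratio of v to w_i. *)
  pose u := v H; pose L h := frinv (K i x) (mk h (fun=> 0)).
  have ev E : is_vec E -> v E = u * w i x E.
    move=> vE; rewrite /u (coord_cov cW Wx hv vE) (coord_cov cW Wx hv vH) (coord_cov cW Wx wc vE).
    move: wH; rewrite (coord_cov cW Wx wc vH) => e.
    by rewrite -[LHS]mulr1 -e; ring.
  have cw := clift0_cov fr wc; have cv := clift0_cov fr hv.
  have cy := clift0_cov fr yc; have ce := clift0_cov fr he.
  have vF' := vlift0_vec fr vF; have vG' := vlift0_vec fr vG.
  have evl E : is_vec E -> clift0 (K i x) v E = L u * clift0 (K i x) (w i x) E.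
    move=> vE; apply: (fr_inj fr); rewrite (frM fr) !(frinvK fr).
    have v0 := fv0_vec fr vE; have v1 k := fv1_vec fr k vE.
    apply: sqz_eq => [|k]; first by rewrite !mk1 ev.
    by rewrite sqz2M !mk2 !mk1 mulr0 addr0 !add0r ev.
  rewrite (conn_ext cD cv (is_covZ (L u) cw) evl vF' vG') (connZ cD _ cw vF' vG').
  rewrite (hcx _ _ _ cw cy ce (rel _ wc) (rel _ yc) (rel _ he) _ _ vF' vG').
  have Kc (q : cov S x) E : is_cov q -> is_vec E ->
      K i x (clift0 (K i x) q (vlift0 (K i x) E)) = mk (q E) (fun=> 0).
    move=> hq vE; rewrite (frinvK fr) (fv0_lift fr); apply: sqz_eq => // k.
    by rewrite !mk2 (fv1_lift0 fr) // (cov0 hq) addr0.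
  have KL h : K i x (L h) = mk h (fun=> 0) by exact: frinvK.
  have F1 : (K i x (vlift0 (K i x) F (L u))).2 ord0 l = 0.
    by rewrite /vlift0 /vlift (frinvK fr) mk2 KL mk2 (vec_0 vF) addr0.
  rewrite (frD fr) sqz2D !(frM fr) !sqz2M (frD fr) !sqz2D sqz1D F1 !KL !Kc // !mk2 !mk1.
  rewrite (frE1 fr) (frE2 fr) Kc // (ord1 l) eqxx mk1 ev //.
  by rewrite /eta1; ring.
Qed.

(** With a coordinate on each open set, the choices are w_i = dz and y_i = nabla dz contracted with
    d/dz. *)
Lemma rep_represents D z : rep1 D z ->
  (forall i : idx z, exists phi zz d, is_coord (S := S) (opens i) phi zz d) -> represents D z.
Proof.
move=> hr cz; have [K [oc lf k1 tr co]] := hr.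
have ex (i : idx z) : exists zd : (forall x, stalk S x) * vfield S, exists phi, is_coord (S := S) (opens i) phi zd.1 zd.2.
  by have [phi [zz [d h]]] := cz i; exists (zz, d), phi.
have [zd hzd] := choice ex.
pose j (i : idx z) x (h : stalk S x) : stalk D x := frinv (K i x) (mk h (fun=> 0)).
have fr (i : idx z) x (Ui : opens i x) := pf_fr (lf i).1 Ui.
exists j, (fun i => dform (zd i).1), (fun i x F => nabla S x (dform (zd i).1 x) F ((zd i).2 x)).
split => //.
- move=> i; split; first split.
  + move=> x Ui; split => [a b|a b|k]; rewrite /j.
    * by rewrite mk0D (frinvD (fr i x Ui)).
    * by rewrite mk0M (frinvM (fr i x Ui)).
    * have -> : k = acst 0 k.1 by exact: A0_eq.
      by rewrite (frinv_str (fr i x Ui)) acst_base.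
  + by move=> V s oV VU; exact: (pf_mk0 (lf i).1).
  + move=> k Uk a; rewrite /j (lf_along0 _ (lf i)) //.
    have -> : along S k a = acst 0 (along S k a).1 by exact: A0_eq.
    by rewrite acst_base; apply: sqz_eq => // l; rewrite mk2 mxE.
  + move=> x Ui; split; first by move=> h; rewrite /j -(k1 i) // (frinvK (fr i x Ui)).
    have e h : j i x h.1 + str D x (aeps R ord0) * j i x h.2 = frinv (K i x) (mk h.1 (fun=> h.2)).
      apply: (fr_inj (fr i x Ui)); rewrite (frD (fr i x Ui)) (frinvK (fr i x Ui)) /j.
      apply: sqz_eq => [|l]; first by rewrite sqz1D (frE1 (fr i x Ui)) addr0 (frinvK (fr i x Ui)).
      by rewrite sqz2D (frE2 (fr i x Ui)) !(frinvK (fr i x Ui)) !mk2 (ord1 l) eqxx add0r.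
    exists (fun a => ((K i x a).1, (K i x a).2 ord0 ord0)) => [h|a].
      by rewrite e (frinvK (fr i x Ui)) mk2 mk1; case: h.
    rewrite e /= -[RHS](frK (fr i x Ui)); congr (frinv _ _); apply: sqz_eq => // l.
    by rewrite mk2 (ord1 l).
- move=> i; have [phi cU] := hzd i; have sUU : opens i `<=` opens i by [].
  have oU : open (opens i) by case: oc.
  have fz := dform_form1 cU; have [hn hp] := nabla_sect oU fz.
  have vd : is_vfield (opens i) (zd i).2 by case: cU.
  split => //.
  + move=> x Ui; exists ((zd i).2 x); split; first exact: (coord_dvec cU Ui).
    exact: (coord_dz cU Ui).
  + split; first exact: is_form2_contr hn (is_vfield_sub (@off_in _ _ c _) vd).
    move=> V u oV VU su vu; have [q' [hq eq]] := hp V u oV VU su vu.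
    exists (fun x F => q' x F ((zd i).2 x)); split.
      exact: is_form2_contr hq (is_vfield_sub VU vd).
    move=> x ox F vF; rewrite eq //; apply: (coord_dvec cU); apply: VU; by case: ox.
  + move=> x ox F G vF vG; have [Ui _] := ox; have vdx := coord_dvec cU Ui.
    have cc := conn_covr (conn_base S (off_setT ox)) (dform_cov (zd i).1 x) vF.
    by rewrite {1}(coord_vec cU Ui vG) (covZ _ cc vdx) mulrC.
- move=> i k x Ui Uk h; apply: (fr_inj (fr k x Uk)).
  rewrite (tr i k) // (frD (fr k x Uk)) /j (frinvK (fr i x Ui)) (frinvK (fr k x Uk)).
  apply: sqz_eq => [|l].
    by rewrite twist1 sqz1D (frE1 (fr k x Uk)) addr0.
  by rewrite twist2 sqz2D (frE2 (fr k x Uk)) (frinvK (fr k x Uk)) (ord1 l) eqxx.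
- move=> i x ox; have [Ui _] := ox; have fx := fr i x Ui; have [phi cU] := hzd i.
  have [h1 h2] := co i x ox; split; first exact: (h1 ord0).
  move=> w' y' t' hw' hy' ht' rw ry rt F G vF vG; have cS := conn_base S (off_setT ox).
  have hz := dform_cov (zd i).1 x; have vd := coord_dvec cU Ui.
  have hy : is_cov (fun F => nabla S x (dform (zd i).1 x) F ((zd i).2 x)) by exact: (conn_covl cS).
  (* A covector of D related to v along j_i is the constant lift of v in the frame, so it has no
     e-component. *)
  have rel (v : cov S x) v' E : rel_cov (j i x) v v' -> is_vec E ->
      fc0 (K i x) v' E = v E /\ fc1 (K i x) v' ord0 E = 0.
    move=> rv vE; have vE' := vlift0_vec fx vE.
    have rE : rel_vec (j i x) E (vlift0 (K i x) E).
      move=> a; apply: (fr_inj fx); rewrite /j /vlift0 /vlift !(frinvK fx).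
      by apply: sqz_eq => // l; rewrite !mk2 (vec_0 vE) addr0.
    by rewrite /fc0 /fc1 (rv _ _ vE vE' rE) /j (frinvK fx) mk2.
  apply: (fr_inj fx); rewrite h2 // (frM fx) (frD fx).
  rewrite !(fc_E fx) //.
  have vF0 := fv0_vec fx vF; have vF1 := fv1_vec fx ord0 vF.
  have vG0 := fv0_vec fx vG; have vG1 := fv1_vec fx ord0 vG.
  have w0 := fc0_cov fx hw'; have w1 := fc1_cov fx ord0 hw'.
  have e0 E : is_vec E -> fc0 (K i x) w' E = dform (zd i).1 x E by move=> vE; have [] := rel _ _ E rw vE.
  have e1 E : is_vec E -> fc1 (K i x) w' ord0 E = 0 by move=> vE; have [] := rel _ _ E rw vE.
  have nE E H : is_vec E -> is_vec H -> nabla S x (fc0 (K i x) w') E H =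
      nabla S x (dform (zd i).1 x) E ((zd i).2 x) * dform (zd i).1 x H.
    move=> vE vH; rewrite (conn_ext cS w0 hz e0) // {1}(coord_vec cU Ui vH).
    by rewrite (covZ _ (conn_covr cS hz vE) vd) mulrC.
  have n1 : nabla S x (fc1 (K i x) w' ord0) (fv0 (K i x) F) (fv0 (K i x) G) = 0.
    by rewrite (conn_ext cS w1 (is_cov0 S x) e1) // (conn0 cS).
  have [y0 y1] := rel _ _ _ ry vF0; have [y0' _] := rel _ _ _ ry vF1.
  have [t0 _] := rel _ _ _ rt vF0.
  apply: sqz_eq => [|l].
    by rewrite sqz1M sqz1D (frE1 fx) !mk1 addr0 nE // y0 e0.
  rewrite (ord1 l) sqz2M sqz1D sqz2D (frE1 fx) (frE2 fx) eqxx (fc_E fx) // !mk1 !mk2.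
  rewrite n1 !nE // !e0 // e1 // y0 y1 y0' t0 /eta1; ring.
Qed.

Lemma represents_ex (hX : hausdorff_space X) (c_inj : injective c) D :
  exists z, represents D z.
Proof.
have [U [chi [eta [hr hc]]]] := rep_ex hX c_inj D.
exists (Cochain U (chi ord0) (eta ord0)); apply: rep_represents => //.
apply: rep_eq hr _ _.
- by move=> l i j x _ _ a; rewrite (ord1 l).
- by move=> l i x _ F _; rewrite (ord1 l).
Qed.

End Represents.

(** * The deformation defined by a cocycle *)

Definition rmorph_of (A B : comNzRingType) (f : A -> B) (fa : zmod_morphism f)
    (fm : monoid_morphism f) : {rmorphism A -> B} :=
  HB.pack f (GRing.isZmodMorphism.Build A B f fa) (GRing.isMonoidMorphism.Build A B f fm).

Section Construction.
Context (R : realType) (X : topologicalType) (n : nat) (c : 'I_n -> X).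
Context (S : affine_family R c 0) (m : nat) (hX : hausdorff_space X).
Variables (I : Type) (U : I -> set X).
Variables (chi : 'I_m -> I -> I -> vfield S) (eta : 'I_m -> I -> form1 S).
Arguments chi : clear implicits.
Arguments eta : clear implicits.
Hypothesis Hoc : open_cover U.
Hypothesis Hz : forall l i j, is_vfield_zero (U i `&` U j) (chi l i j).
Hypothesis Hpole : forall l i, is_form1_pole (U i) (eta l i).
Hypothesis Hcc : forall l i j k x, U i x -> U j x -> U k x -> forall a : stalk S x,
  chi l j k x a - chi l i k x a + chi l i j x a = 0.
Hypothesis Hlie : forall l i j,
  is_lie_nabla (U i `&` U j) (chi l i j) (fun x F => eta l j x F - eta l i x F).
Variables (ix : X -> I) (Hix : forall x, U (ix x) x).

Local Notation O x := (stalk S x).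

(** The stalks are those of the trivial family; the cocycle enters only in the condition for being a
    section, through [gK]. *)
Definition gstk (x : X) : comNzRingType := sqz (stalk S x) m.

(* An element of the glued stalk is written in the trivialization ix x;
   [gK i x] rewrites it in the trivialization i. *)
Definition gK (i : I) (x : X) : sqz (O x) m -> sqz (O x) m :=
  twist (fun l => chi l (ix x) i x).

Lemma Hvec l i j x : U i x -> U j x -> is_vec (chi l i j x).
Proof. by move=> Ui Uj; have [[h _] _] := Hz l i j; apply: h. Qed.

(** The cocycle identity for the three indices ix x, i and j. *)
Lemma gK_tr i j x t : U i x -> U j x -> gK j t = twist (fun l => chi l i j x) (gK i t).
Proof.
move=> Ui Uj; apply: sqz_eq => // l; rewrite /gK !twist2 !twist1.
have := Hcc l (Hix x) Ui Uj t.1 => e.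
by rewrite -addrA; congr (_ + _); apply/eqP; rewrite -subr_eq0 opprD addrA addrC addrA -[X in X == _]opprK -oppr0 -e; apply/eqP; ring.
Qed.

Lemma sstr_zmod x : zmod_morphism (fun k : A R m => sstr S x k : gstk x).
Proof.
have eB (a b : Cx R) : acst 0 (a - b) = acst 0 a - acst 0 b :> A R 0 by exact: A0_eq.
move=> a b; apply: sqz_eq => [|l].
  by rewrite !sqzE !mk1 sqzE -rmorphB -eB.
by rewrite !sqzE !mk2 !sqzE -(rmorphB (str S x)) -eB.
Qed.

Lemma sstr_monoid x : monoid_morphism (fun k : A R m => sstr S x k : gstk x).
Proof.
split=> [|a b].
  apply: sqz_eq => [|l]; first by rewrite mk1 acst0_1 rmorph1.
  by rewrite mk2 !sqzE acst0_0 rmorph0.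
apply: sqz_eq => [|l].
  rewrite !sqzE !mk1 -rmorphM; congr (str S x _); exact: A0_eq.
rewrite !sqzE !mk2 !mk1 -!rmorphM -rmorphD; congr (str S x _); apply: A0_eq.
by rewrite /= !mxE.
Qed.

Definition gstr (x : X) : {rmorphism A R m -> gstk x} := rmorph_of (@sstr_zmod x) (@sstr_monoid x).

Definition gsect (V : set X) (s : forall x, gstk x) : Prop := forall i,
  sect S (V `&` U i) (fun x => (gK i (s x)).1) /\
  forall l, sect S (V `&` U i) (fun x => (gK i (s x)).2 ord0 l).

(** Evaluation in the trivialization ix (c i) agrees with evaluation in any other, as chi vanishes
    at the marked points; [gK_lframe] relies on this. *)
Definition galong_fun (i : 'I_n) (t : gstk (c i)) : A R m :=
  mk (along S i t.1).1 (fun l => (along S i (t.2 ord0 l)).1).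

Lemma galong_zmod i : zmod_morphism (@galong_fun i).
Proof.
move=> a b; rewrite /galong_fun; apply: sqz_eq => [|l].
  by rewrite !sqzE !mk1 ?sqzE (rmorphB (along S i)).
by rewrite !sqzE !mk2 ?sqzE (rmorphB (along S i)).
Qed.

Lemma galong_monoid i : monoid_morphism (@galong_fun i).
Proof.
rewrite /galong_fun; split=> [|a b].
  apply: sqz_eq => [|l]; first by rewrite mk1 ?sqzE (rmorph1 (along S i)).
  by rewrite mk2 ?sqzE (rmorph0 (along S i)).
apply: sqz_eq => [|l]; first by rewrite !sqzE !mk1 ?sqzE (rmorphM (along S i)).
by rewrite !sqzE !mk2 !mk1 ?sqzE (rmorphD (along S i)) !(rmorphM (along S i)).
Qed.

Definition galong (i : 'I_n) : {rmorphism gstk (c i) -> A R m} :=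
  rmorph_of (@galong_zmod i) (@galong_monoid i).

Lemma oU i : open (U i). Proof. by case: Hoc. Qed.

Lemma gsect_ext V s s' : (forall x, V x -> s x = s' x) -> gsect V s -> gsect V s'.
Proof.
move=> e h i; have [h1 h2] := h i; split=> [|l].
  by apply: sect_ext h1 => x [Vx _]; rewrite e.
by apply: sect_ext (h2 l) => x [Vx _]; rewrite e.
Qed.

Lemma gsect_res V W s : open V -> open W -> W `<=` V -> gsect V s -> gsect W s.
Proof.
move=> oV oW sub h i; have [h1 h2] := h i.
have sub' : W `&` U i `<=` V `&` U i by move=> x [/sub].
have o1 := openI oV (oU i); have o2 := openI oW (oU i).
by split=> [|l]; [exact: sect_res h1 | exact: sect_res (h2 l)].
Qed.

Lemma gsect_glue V s : open V ->
  (forall x, V x -> exists W, [/\ open W, W x, W `<=` V & gsect W s]) -> gsect V s.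
Proof.
move=> oV h i; have oVi := openI oV (oU i).
have loc x : (V `&` U i) x -> exists W, [/\ open (W `&` U i), (W `&` U i) x,
    W `&` U i `<=` V `&` U i & gsect W s].
  move=> [Vx Ux]; have [W [oW Wx WV hW]] := h x Vx; exists W; split => //.
    exact: (openI oW (oU i)).
  by move=> y [/WV].
split=> [|l]; apply: sect_glue => // x /loc [W [h1 h2 h3 h4]]; have [s1 s2] := h4 i.
  by exists (W `&` U i).
by exists (W `&` U i).
Qed.

Lemma galong_str i a : galong i (gstr (c i) a) = a.
Proof.
change (galong_fun (sstr S (c i) a : gstk (c i)) = a); rewrite /galong_fun.
apply: sqz_eq => [|l]; first by rewrite !mk1 along_str.
by rewrite !mk2 along_str.
Qed.

(** The twist by -chi undoes [gK], so that in the trivialization i the chart of S is applied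
    component by component. *)
Definition gchart i (G : forall y, (Cx R -> A R 0) -> stalk S y) y (f : Cx R -> A R m) : gstk y :=
  twist (fun l a => - chi l (ix y) i y a)
    (mk (G y (epsfree 0 (fun z => (f z).1))) (fun l => G y (epsfree 0 (fun z => (f z).2 ord0 l)))).

Lemma gK_chart i G y f : gK i (gchart i G y f) =
  mk (G y (epsfree 0 (fun z => (f z).1))) (fun l => G y (epsfree 0 (fun z => (f z).2 ord0 l))).
Proof. by apply: sqz_eq => // l; rewrite /gK !twist2 !mk2 mk1 addrNK. Qed.

Lemma gK_inj i y : injective (@gK i y).
Proof.
move=> s t e; have e1 : s.1 = t.1 by have := congr1 fst e.
apply: sqz_eq => // l; have := congr1 (fun t : sqz (O y) m => t.2 ord0 l) e.
by rewrite /gK !twist2 e1 => /addIr.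
Qed.

Lemma gKD i y s t : U i y -> @gK i y (s + t) = gK i s + gK i t.
Proof.
move=> Ui; apply: sqz_eq => // l; rewrite /gK !sqzE !twist2 sqz2D sqz1D.
by have [-> _ _] := Hvec l (Hix y) Ui; rewrite addrACA.
Qed.

Lemma gKM i y s t : U i y -> @gK i y (s * t) = gK i s * gK i t.
Proof.
move=> Ui; apply: sqz_eq => // l; rewrite /gK sqz2M !twist2 !twist1 sqz2M sqz1M.
by have [_ -> _] := Hvec l (Hix y) Ui; ring.
Qed.

Lemma gK_str i y k : U i y -> @gK i y (sstr S y k) = sstr S y k.
Proof.
move=> Ui; apply: sqz_eq => // l; rewrite /gK twist2.
by have [_ _ ->] := Hvec l (Hix y) Ui; rewrite addr0.
Qed.

(** Passing from the trivialization i to another adds chi applied to a section, which is again a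
    section; testing in one trivialization defined on V is therefore enough. *)
Lemma gsect_local i V (s : forall x, gstk x) : open V -> V `<=` U i ->
  (gsect V s <-> sect S V (fun x => (gK i (s x)).1) /\
     forall l, sect S V (fun x => (gK i (s x)).2 ord0 l)).
Proof.
move=> oV VU.
have VE : V `&` U i = V by apply/seteqP; split => y; [case | move=> Vy; split => //; exact: VU].
split; first by move=> /(_ i); rewrite VE.
move=> [s1 s2] k; have oVk := openI oV (oU k); have sVk : V `&` U k `<=` V by move=> y [].
have s1' := sect_res oV oVk sVk s1.
split=> [|l]; first by apply: sect_ext s1' => y _.
have hc : is_vfield (V `&` U k) (chi l i k).
  by have [h _] := Hz l i k; apply: is_vfield_sub h => y [/VU Ui Uk].
have [_ hs] := hc; have s3 := hs _ _ oVk (@subset_refl _ _) s1'.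
apply: sect_ext (sectD oVk (sect_res oV oVk sVk (s2 l)) s3) => y [Vy Uk].
by rewrite (gK_tr _ (VU y Vy) Uk) [in RHS]twist2.
Qed.

Lemma holoA_comps p (f : Cx R -> A R m) : holoA_near p f ->
  holoA_near p (epsfree 0 (fun z => (f z).1)) /\
  forall l, holoA_near p (epsfree 0 (fun z => (f z).2 ord0 l)).
Proof.
move=> [W [oW Wp hf]]; split=> [|l]; exists W; split; [exact: oW | exact: Wp | | exact: oW | exact: Wp |].
  exact: holoA_on_epsfree (holoA_on1 hf).
exact: holoA_on_epsfree (holoA_on2 l hf).
Qed.

(** A chart of S is used componentwise in the trivialization ix x, and the axioms are transferred
    through the injective ring map [gK]. *)
Lemma gcurve_chart x : exists V phi G, V x /\ is_chart (fun x => gstr x) gsect V phi G.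
Proof.
have [W0 [phi [G [W0x ch0]]]] := curve_chart S x; pose i := ix x.
pose W := W0 `&` U i.
have oW : open W by apply: openI; [exact: chart_open ch0 | exact: oU].
have WW0 : W `<=` W0 by move=> y [].
have WU : W `<=` U i by move=> y [].
have ch := chart_sub ch0 oW WW0.
exists W, phi, (gchart i G); split; first by split => //; exact: Hix.
split.
- by case: ch.
- move=> y Wy; have Ui := WU y Wy; split.
  + move=> a; apply: (@gK_inj i); rewrite gK_chart gK_str //; apply: sqz_eq => [|l].
      by rewrite !mk1; exact: (chart_str ch).
    by rewrite !mk2; exact: (chart_str ch).
  + move=> f g hf hg; have [f1 f2] := holoA_comps hf; have [g1 g2] := holoA_comps hg.
    apply: (@gK_inj i); rewrite gKD // !gK_chart; apply: sqz_eq => [|l].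
      rewrite sqz1D !mk1 -(chartD ch Wy f1 g1); congr (G y _); apply/funext => z; exact: A0_eq.
    rewrite sqz2D !mk2 -(chartD ch Wy (f2 l) (g2 l)); congr (G y _); apply/funext => z.
    by apply: A0_eq; rewrite /= mxE.
  + move=> f g hf hg; have [f1 f2] := holoA_comps hf; have [g1 g2] := holoA_comps hg.
    apply: (@gK_inj i); rewrite gKM // !gK_chart; apply: sqz_eq => [|l].
      rewrite sqz1M !mk1 -(chartM ch Wy f1 g1); congr (G y _); apply/funext => z; exact: A0_eq.
    rewrite sqz2M !mk2 !mk1 -(chartM ch Wy f1 (g2 l)) -(chartM ch Wy g1 (f2 l)).
    rewrite -(chartD ch Wy (holoA_nearM f1 (g2 l)) (holoA_nearM g1 (f2 l))).
    by congr (G y _); apply/funext => z; apply: A0_eq; rewrite /= !mxE.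
  + move=> f hf; have [f1 f2] := holoA_comps hf; split.
      move=> g0; have k0 : gK i (gchart i G y f) = 0.
        rewrite g0; apply: sqz_eq => // l; rewrite /gK twist2 sqzE (vec_0 (Hvec l (Hix y) Ui)) addr0 //.
      rewrite gK_chart in k0.
      have n1 : \forall z \near phi y, (f z).1 = 0.
        have := congr1 fst k0 => /= /(chart0 ch Wy f1); by apply: filterS => z /(congr1 fst).
      have n2 : \forall z \near phi y, forall l, (f z).2 ord0 l = 0.
        have n3 l : \forall z \near phi y, (f z).2 ord0 l = 0.
          have := congr1 (fun t : sqz (O y) m => t.2 ord0 l) k0; rewrite mk2 sqzE.
          by move=> /(chart0 ch Wy (f2 l)); apply: filterS => z /(congr1 fst).
        have /choice [V hV] l := (near_openP _ _).1 (n3 l).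
        apply/near_openP; exists [set z | forall l, V l z]; split.
        * by apply: open_forall_ord => l; have [] := hV l.
        * by move=> l; have [] := hV l.
        * by move=> z hz l; have [_ _ h] := hV l; exact: h.
      by apply: filterS2 n1 n2 => z h1 h2; apply: sqz_eq => // l; rewrite h2 sqzE.
    move=> n0; apply: (@gK_inj i); rewrite gK_chart.
    have -> : gK i (0 : sqz (O y) m) = 0.
      by apply: sqz_eq => // l; rewrite /gK twist2 sqzE (vec_0 (Hvec l (Hix y) Ui)) addr0.
    apply: sqz_eq => [|l].
      by apply/(chart0 ch Wy f1); apply: filterS n0 => z fz; rewrite /epsfree fz; exact: A0_eq.
    rewrite mk2 sqz20; apply/(chart0 ch Wy (f2 l)); apply: filterS n0 => z fz.
    by rewrite /epsfree fz; apply: A0_eq; rewrite /= mxE.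
  + move=> t; have [f0 [h0 e0]] := chart_surj ch (gK i t).1 Wy.
    have /choice [f1 h1] l := chart_surj ch ((gK i t).2 ord0 l) Wy.
    exists (fun z => mk (f0 z).1 (fun l => (f1 l z).1)); split.
      have [V0 [oV0 V0y w0]] := h0.
      have /choice [V1 hV1] l : exists V, [/\ open V, V (phi y) & holoA_on V (f1 l)] by have [] := h1 l.
      exists (V0 `&` [set z | forall l, V1 l z]); split.
      * by apply: openI => //; apply: open_forall_ord => l; have [] := hV1 l.
      * by split => // l; have [] := hV1 l.
      * move=> p [V0p V1p]; split; first exact: (holoA_on1 w0).
        move=> l; have [_ _ w1] := hV1 l; have := holoA_on1 w1 (V1p l).
        by under [X in _ -> holo_at X _]eq_fun do rewrite mk2.
    apply: (@gK_inj i); rewrite gK_chart; apply: sqz_eq => [|l].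
      by rewrite mk1 epsfree1 e0.
    rewrite mk2 -(h1 l).2 -[in RHS](epsfree1 (f1 l)); congr (G y _); apply/funext => z.
    by rewrite /epsfree mk2.
- move=> V s oV VW; have VU : V `<=` U i by exact: subset_trans VW WU.
  apply: iff_trans (gsect_local s oV VU) _; split.
    move=> [s1 s2]; have [f0 [h0 e0]] := (chart_sect ch _ oV VW).1 s1.
    have /choice [f1 h1] l := (chart_sect ch _ oV VW).1 (s2 l).
    exists (fun z => mk (f0 z).1 (fun l => (f1 l z).1)); split.
      move=> p Vp; split; first exact: (holoA_on1 h0).
      move=> l; have := holoA_on1 (h1 l).1 Vp.
      by under [X in _ -> holo_at X _]eq_fun do rewrite mk2.
    move=> y Vy; apply: (@gK_inj i); rewrite gK_chart; apply: sqz_eq => [|l].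
      by rewrite mk1 epsfree1 e0.
    rewrite mk2 (h1 l).2 // -[in LHS](epsfree1 (f1 l)); congr (G y _); apply/funext => z.
    by rewrite /epsfree mk2.
  move=> [f [hf ef]]; split=> [|l]; apply/(chart_sect ch) => //.
    exists (epsfree 0 (fun z => (f z).1)); split; first exact: holoA_on_epsfree (holoA_on1 hf).
    by move=> y Vy; rewrite ef // gK_chart mk1.
  exists (epsfree 0 (fun z => (f z).2 ord0 l)); split; first exact: holoA_on_epsfree (holoA_on2 l hf).
  by move=> y Vy; rewrite ef // gK_chart mk2.
Qed.

Definition gcurve : curve R c m :=
  Curve gsect_ext gsect_res gsect_glue gcurve_chart galong_str.

Definition gid x : stalk gcurve x -> sqz (O x) m := id.

Lemma gid_frame x : is_frame (@gid x).
Proof. by split => // ; exists id. Qed.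

Lemma gK_frame i x : U i x -> @is_frame _ _ _ _ _ S gcurve x (@gK i x).
Proof. by move=> Ui; apply: (twist_frame (@gid_frame x)) => l; exact: Hvec. Qed.

Lemma gK_lframe i : @lframe _ _ _ _ _ S gcurve (U i) (@gK i).
Proof.
split; first split.
- exact: oU.
- by move=> x; exact: gK_frame.
- by move=> V s oV VU; exact: gsect_local.
- move=> k Uk t; apply: sqz_eq => [|l]; first by rewrite !mk1.
  rewrite mk2 /gK twist2 (rmorphD (along S k)).
  have [_ h] := Hz l (ix (c k)) i.
  by rewrite h ?addr0; [rewrite [LHS]mk2 | split].
Qed.

(** This is nabla + sum e_l eta_l written in the trivialization ix x. The Lie derivative condition
    of the cocycle gives it the same shape in every trivialization i ([gnabla_gK]). *)
Definition gnabla x : cov gcurve x -> bil gcurve x := fun w =>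
  blift (@gid x) (nabla S x (fc0 (@gid x) w))
    (fun l D E => nabla S x (fc1 (@gid x) w l) D E + eta l (ix x) x D * fc0 (@gid x) w E).

Lemma gnabla_form x : conn_form (@gid x) (nabla S x) (fun l => eta l (ix x) x) (@gnabla x).
Proof.
move=> w D E hw vD vE; rewrite /gnabla /blift (frinvK (@gid_frame x)).
by apply: sqz_eq => // l; rewrite !mk2; ring.
Qed.

Lemma Heta l i x : off c (U i) x -> is_cov (eta l i x).
Proof. by move=> ox; have [[h _] _] := Hpole l i; exact: h. Qed.

Lemma gnabla_gK i x : off c (U i) x ->
  conn_form (P := gcurve) (@gK i x) (nabla S x) (fun l => eta l i x) (@gnabla x).
Proof.
move=> [Ui nx]; have vc l : is_vec (chi l (ix x) i x) by exact: Hvec.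
have lie l w F G : is_cov w -> is_vec F -> is_vec G ->
    (eta l i x F - eta l (ix x) x F) * w G = lie_conn (nabla S x) (chi l (ix x) i x) w F G.
  by move=> hw vF vG; apply: Hlie => //; split.
exact: (conn_twist (eta' := fun l => eta l i x) (@gid_frame x) (conn_base S (off_setT (conj Ui nx))) vc (@gnabla_form x) lie).
Qed.

Lemma gnabla_ext x (w w' : cov gcurve x) : off c setT x ->
    is_cov w -> is_cov w' -> (forall D, is_vec D -> w D = w' D) ->
    forall D E, is_vec D -> is_vec E -> gnabla w D E = gnabla w' D E.
Proof.
move=> ox hw hw' e D E vD vE; have fr := @gid_frame x; have cS := conn_base S ox.
have vD0 := fv0_vec fr vD; have vE0 := fv0_vec fr vE.
have e0 F : is_vec F -> fc0 (@gid x) w F = fc0 (@gid x) w' F.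
  by move=> vF; rewrite /fc0 e //; exact: vlift0_vec.
have e1 l F : is_vec F -> fc1 (@gid x) w l F = fc1 (@gid x) w' l F.
  by move=> vF; rewrite /fc1 e //; exact: vlift0_vec.
have n0 F G : is_vec F -> is_vec G -> nabla S x (fc0 (@gid x) w) F G = nabla S x (fc0 (@gid x) w') F G.
  by move=> vF vG; apply: (conn_ext cS) => //; exact: fc0_cov.
apply: (fr_inj fr); rewrite !(@gnabla_form x) //; apply: sqz_eq => [|l].
  by rewrite !mk1 n0.
have vD1 := fv1_vec fr l vD; have vE1 := fv1_vec fr l vE.
rewrite !mk2 !n0 // e0 // (conn_ext cS (fc1_cov fr l hw) (fc1_cov fr l hw') (e1 l)) //.
Qed.

Lemma gnablaD x (w w' : cov gcurve x) : off c setT x -> is_cov w -> is_cov w' ->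
  forall D E, is_vec D -> is_vec E ->
    gnabla (fun F => w F + w' F) D E = gnabla w D E + gnabla w' D E.
Proof.
move=> ox hw hw' D E vD vE; have fr := @gid_frame x; have cS := conn_base S ox.
have vD0 := fv0_vec fr vD; have vE0 := fv0_vec fr vE; have hs := is_covD hw hw'.
have c0 := fc0_cov fr hw; have c0' := fc0_cov fr hw'.
have e0 : fc0 (@gid x) (fun F => w F + w' F) = fun F => fc0 (@gid x) w F + fc0 (@gid x) w' F.
  by [].
have e1 l : fc1 (@gid x) (fun F => w F + w' F) l = fun F => fc1 (@gid x) w l F + fc1 (@gid x) w' l F.
  by apply/funext => F; rewrite /fc1 (frD fr) sqz2D.
apply: (fr_inj fr); rewrite (frD fr) !(@gnabla_form x) // e0; apply: sqz_eq => [|l].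
  by rewrite sqz1D !mk1 (connD cS).
have vD1 := fv1_vec fr l vD; have vE1 := fv1_vec fr l vE.
have c1 := fc1_cov fr l hw; have c1' := fc1_cov fr l hw'.
rewrite sqz2D !mk2 e1 !(connD cS) //; ring.
Qed.

Lemma gnabla_leibniz x (f : stalk gcurve x) (w : cov gcurve x) : off c setT x -> is_cov w ->
  forall D E, is_vec D -> is_vec E ->
    gnabla (fun F => f * w F) D E = D f * w E + f * gnabla w D E.
Proof.
move=> ox hw D E vD vE; have fr := @gid_frame x; have cS := conn_base S ox.
have vD0 := fv0_vec fr vD; have vE0 := fv0_vec fr vE; have hs := is_covZ f hw.
have c0 := fc0_cov fr hw.
have e0 : fc0 (@gid x) (fun F => f * w F) = fun F => (gid f).1 * fc0 (@gid x) w F by [].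
have e1 l : fc1 (@gid x) (fun F => f * w F) l =
    fun F => (gid f).1 * fc1 (@gid x) w l F + (gid f).2 ord0 l * fc0 (@gid x) w F.
  by apply/funext => F; rewrite /fc1 (frM fr) sqz2M [X in _ + X]mulrC.
apply: (fr_inj fr); rewrite (frD fr) !(frM fr) !(@gnabla_form x) //.
rewrite (fv_E fr _ vD) (fc_E fr hw vE) e0; apply: sqz_eq => [|l].
  by rewrite sqz1D !sqz1M !mk1 (connZ cS).
have vD1 := fv1_vec fr l vD; have vE1 := fv1_vec fr l vE.
have c1 := fc1_cov fr l hw.
rewrite sqz2D !sqz2M !mk2 !mk1 e1 (connD cS (is_covZ _ c1) (is_covZ _ c0)) //.
by rewrite !(connZ cS) //; ring.
Qed.

(** Let u = u_0 + sum e_l u_l vanish along the sections. The e_l-part of u nabla w consists of u_0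
    nabla w_l, u_0 eta_l w_0 and u_l nabla w_0; since u_0 and u_l both vanish at the marked points,
    each of the three extends by itself. *)
Lemma gnabla_sect V (w : form1 gcurve) : open V -> is_form1 V w ->
  is_form2_pole V (fun x => gnabla (w x)).
Proof.
move=> oV hw; apply: (is_form2_pole_local hX) => // x Vx; pose i := ix x.
exists (U i); split; [exact: oU | exact: Hix |].
pose W := V `&` U i; have oW : open W := openI oV (oU i).
have WU : W `<=` U i by move=> y [].
have lf : @lframe _ _ _ _ _ S gcurve W (@gK i) := lf_sub oW WU (@gK_lframe i).
have hwW : is_form1 W w by apply: is_form1_sub hw => y [].
pose w0 : form1 S := fun y => fc0 (P := gcurve) (@gK i y) (w y).
pose w1 l : form1 S := fun y => fc1 (P := gcurve) (@gK i y) (w y) l.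
have f0 : is_form1 W w0 by exact: (pf_fc0 lf.1).
have f1 l : is_form1 W (w1 l) by exact: (pf_fc1 lf.1 l).
have [q0 p0] := nabla_sect oW f0.
have [q1 p1] := (fun l => (nabla_sect oW (f1 l)).1, fun l => (nabla_sect oW (f1 l)).2).
have oWo : off c W `<=` W by move=> y [].
have he l : is_form1_pole W (eta l i) by exact: is_form1_pole_sub (Hpole l i).
have key y : off c W y -> forall D E, is_vec D -> is_vec E -> gnabla (w y) D E =
    blift (P := gcurve) (@gK i y) (nabla S y (w0 y))
      (fun l D E => nabla S y (w1 l y) D E + eta l i y D * w0 y E) D E.
  move=> oy D E vD vE; have [Wy ny] := oy; have Ui := WU y Wy.
  have fr := @gK_frame i y Ui; have [hc _] := hwW.
  apply: (fr_inj fr); rewrite (@gnabla_gK i y (conj Ui ny) _ _ _ (hc y Wy)) // (frinvK fr).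
  by apply: sqz_eq => // l; rewrite !mk2; ring.
split.
  apply: is_form2_eq (fun y oy D E vD vE => esym (key y oy D E vD vE)) _.
  apply: (pf_blift lf.1 (q1 := fun l y D E => nabla S y (w1 l y) D E + eta l i y D * w0 y E) oWo q0) => l.
  apply: is_form2D; first exact: q1.
  apply: is_form2_prod; first by case: (he l).
  exact: is_form1_sub f0.
move=> V' u oV' V'W su vu.
have su0 := pf_sect1 lf.1 oV' V'W su; have su1 l := pf_sect2 lf.1 l oV' V'W su.
have [_ al] := lf.
have vu0 : vanishes_along V' (fun y => (gK i (u y)).1).
  move=> k Vk; have := vu k Vk; rewrite al; last exact: V'W.
  by move=> e; apply: A0_eq; have := congr1 fst e.
have vu1 l : vanishes_along V' (fun y => (gK i (u y)).2 ord0 l).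
  move=> k Vk; have := vu k Vk; rewrite al; last exact: V'W.
  by move=> /(congr1 (fun t : A R m => t.2 ord0 l)); rewrite mk2 sqz20 => e; apply: A0_eq.
have [Q00 [F00 E00]] := p0 V' _ oV' V'W su0 vu0.
have /choice [Q01 h01] l := p1 l V' _ oV' V'W su0 vu0.
have /choice [Q10 h10] l := p0 V' _ oV' V'W (su1 l) (vu1 l).
have /choice [N hN] l := (he l).2 V' _ oV' V'W su0 vu0.
exists (fun y => blift (P := gcurve) (@gK i y) (Q00 y)
  (fun l D E => Q01 l y D E + N l y D * w0 y E + Q10 l y D E)); split.
  apply: (pf_blift lf.1 (q1 := fun l y D E => Q01 l y D E + N l y D * w0 y E + Q10 l y D E) V'W F00) => l.
  apply: is_form2D; last by have [] := h10 l.
  apply: is_form2D; first by have [] := h01 l.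
  apply: is_form2_prod; first by have [] := hN l.
  exact: is_form1_sub f0.
move=> y oy D E vD vE; have [V'y ny] := oy; have Wy := V'W y V'y; have Ui := WU y Wy.
have fr := @gK_frame i y Ui; rewrite key //.
apply: (fr_inj fr); rewrite (frM fr) !(frinvK fr).
have vD0 := fv0_vec fr vD; have vE0 := fv0_vec fr vE.
apply: sqz_eq => [|l]; first by rewrite sqz1M !mk1 E00.
have vD1 := fv1_vec fr l vD; have vE1 := fv1_vec fr l vE.
have [_ e01] := h01 l; have [_ e10] := h10 l; have [_ eN] := hN l.
have u1 : (gK i (u y)).1 = (u y).1 by [].
have u2 : (gK i (u y)).2 ord0 l = (u y).2 ord0 l + chi l (ix y) i y (u y).1 := twist2 _ _ _.
by rewrite sqz2M !mk2 !mk1 !E00 // e01 // e10 // eN // u1 u2; ring.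
Qed.

Definition gfamily : affine_family R c m :=
  AffineFamily gnabla_ext gnablaD gnabla_leibniz gnabla_sect.

Definition grho x : stalk gfamily x -> stalk S x := fun t => (gid t).1.

Lemma grho_rel x (F : vec gfamily x) F' : is_vec F -> rel_vec (@grho x) F F' -> F' = fv0 (@gid x) F.
Proof.
move=> vF rF; apply/funext => h.
have -> : h = grho (frinv (@gid x) (mk h (fun=> 0))).
  by rewrite /grho (frinvK (@gid_frame x)).
by rewrite rF /fv0 /grho (frinvK (@gid_frame x)).
Qed.

Lemma grho_mor : is_affine_mor 0 grho.
Proof.
split; first split.
- move=> x _; split => // k; congr (str S x _); exact: A0_eq.
- move=> V s oV _ h; apply: sect_local => // x Vx; exists (U (ix x)); split => //; first exact: oU.
  move=> V' oV' V'U V'V; have [h1 _] := h (ix x).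
  have oVU := openI oV (oU (ix x)).
  by apply: sect_res oVU oV' _ h1 => y V'y; split; [exact: V'V | exact: V'U].
- by move=> i _ a; apply: A0_eq.
move=> x ox w w' hw hw' rw F F' G G' vF vF' vG vG' rF rG; have fr := @gid_frame x.
have cS := conn_base S ox.
rewrite (grho_rel vF rF) (grho_rel vG rG) /grho (@gnabla_form x) // mk1.
apply: (conn_ext cS) => //; [exact: fc0_cov | | exact: fv0_vec | exact: fv0_vec].
move=> H vH; rewrite /fc0 -/(grho _); apply: rw => //; first exact: vlift0_vec.
by move=> a; rewrite /grho /vlift0 /vlift (frinvK fr) mk1.
Qed.

Lemma grho_surj x b : exists a, grho (x := x) a = b.
Proof. by exists (mk b (fun=> 0)). Qed.

Lemma grho_ker x (a : stalk gfamily x) : grho a = 0 ->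
  exists b : 'I_m -> stalk gfamily x, a = \sum_i str gfamily x (aeps R i) * b i.
Proof.
move=> a0; have fr := @gid_frame x.
exists (fun l => frinv (@gid x) (mk ((gid a).2 ord0 l) (fun=> 0))).
rewrite {1}(fr_dec fr a) [X in mk X]a0 (_ : frinv _ _ = 0) ?add0r //.
by apply: (fr_inj fr); rewrite (frinvK fr); apply: sqz_eq => // l; rewrite mk2 sqz20.
Qed.

Definition gdef : deformation S m := Deformation grho_mor grho_surj grho_ker.

Lemma gdef_rep : rep gdef U chi eta.
Proof.
exists (fun i x => @gK i x); split.
- exact: Hoc.
- exact: gK_lframe.
- by [].
- by move=> i j x Ui Uj a; exact: gK_tr.
- move=> i x ox; split; first by move=> l; exact: Heta.
  exact: gnabla_gK.
Qed.

End Construction.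

Lemma cocycle_deformation (R : realType) (X : topologicalType) (n : nat) (c : 'I_n -> X)
    (S : affine_family R c 0) (m : nat) (hX : hausdorff_space X) (I : Type) (U : I -> set X)
    (chi : 'I_m -> I -> I -> vfield S) (eta : 'I_m -> I -> form1 S) :
  open_cover U ->
  (forall l i j, is_vfield_zero (U i `&` U j) (chi l i j)) ->
  (forall l i, is_form1_pole (U i) (eta l i)) ->
  (forall l i j k x, U i x -> U j x -> U k x -> forall a : stalk S x,
     chi l j k x a - chi l i k x a + chi l i j x a = 0) ->
  (forall l i j, is_lie_nabla (U i `&` U j) (chi l i j) (fun x F => eta l j x F - eta l i x F)) ->
  exists D : deformation S m, rep D U chi eta.
Proof.
move=> oc hz hp hcc hl; have /choice [ix hix] := oc.2.
by exists (gdef hX oc hz hp hcc hl hix); exact: gdef_rep.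
Qed.

(** * Tangent vectors and hypercohomology classes *)

Section Classes.
Context (R : realType) (X : topologicalType) (n : nat) (c : 'I_n -> X).
Context (S : affine_family R c 0) (hX : hausdorff_space X) (c_inj : injective c).
Implicit Types (z : cochain S) (D : deformation S 1) (t : tangent S) (h : H1 S).

Lemma rep1_deformation z : is_cocycle z -> exists D, rep1 D z.
Proof.
by move=> [oc hz hp hcc hl]; apply: (cocycle_deformation hX oc) => //.
Qed.

Lemma rep1_ex D : exists z, rep1 D z.
Proof. by have [z /represents_rep] := represents_ex hX c_inj D; exists z. Qed.

Lemma class_iso t D D' z : t D -> rep1 D z -> rep1 D' z -> t D'.
Proof.
have [D0 hD0] := tclassP t; have [z0 r0] := rep1_ex D0.
move=> /hD0 iD rD rD'; apply/hD0.
exact: (cohomologous_iso r0 rD' (rep_cohomologous (iso_rep iD r0) rD)).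
Qed.

Lemma hclass_rep h D z z' : h z -> rep1 D z -> rep1 D z' -> h z'.
Proof.
have [z0 c0 hz0] := hclassP h; have [D0 r0] := rep1_deformation c0.
move=> /hz0 [cz e] r r'; apply/hz0; split; first exact: (rep_cocycle hX r').
exact: (rep_cohomologous (iso_rep (cohomologous_iso r0 r e) r0) r').
Qed.

Lemma hclass_cocycle h z : h z -> is_cocycle z.
Proof. by have [z0 _ hz0] := hclassP h; case/hz0. Qed.

Lemma Phi_subproof t : exists2 z, is_cocycle z &
  forall z', (exists D, t D /\ rep1 D z') <-> is_cocycle z' /\ cohomologous z z'.
Proof.
have [D0 hD0] := tclassP t; have [z0 r0] := rep1_ex D0.
exists z0; first exact: (rep_cocycle hX r0).
move=> z'; split=> [[D [/hD0 iD r]]|[cz' e]].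
  by split; [exact: (rep_cocycle hX r) | exact: (rep_cohomologous (iso_rep iD r0) r)].
have [D r] := rep1_deformation cz'; exists D; split => //.
by apply/hD0; exact: (cohomologous_iso r0 r e).
Qed.

Definition Phi t : H1 S := HClass (Phi_subproof t).

Lemma Psi_subproof h : exists D, forall D', (exists z, h z /\ rep1 D' z) <-> iso_def D D'.
Proof.
have [z0 c0 hz0] := hclassP h; have [D0 r0] := rep1_deformation c0.
exists D0 => D'; split=> [[z [/hz0 [_ e] r]]|iD].
  exact: (cohomologous_iso r0 r e).
by exists z0; split; [apply/hz0; split => //; exact: (rep_cohomologous r0 r0) | exact: iso_rep r0].
Qed.

Definition Psi h : tangent S := Tangent (Psi_subproof h).

Lemma tangent_ext t t' : (forall D, t D <-> t' D) -> t = t'.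
Proof.
case: t t' => [p hp] [q hq] /= e.
have epq : p = q by apply/funext => D; apply/propext.
by case: q / epq hq e => hq _; congr Tangent; exact: Prop_irrelevance.
Qed.

Lemma H1_ext h h' : (forall z, h z <-> h' z) -> h = h'.
Proof.
case: h h' => [p hp] [q hq] /= e.
have epq : p = q by apply/funext => z; apply/propext.
by case: q / epq hq e => hq _; congr HClass; exact: Prop_irrelevance.
Qed.

(** The relation [rep1] is total on deformations and on cocycles, and it matches isomorphism with
    cohomology; it therefore descends to a bijection between the classes. *)
Lemma Phi_bij : bijective Phi.
Proof.
exists Psi => [t|h].
  apply: tangent_ext => D; split=> [[z [[D' [tD' r']] r]]|tD].
    exact: (class_iso tD' r' r).
  by have [z r] := rep1_ex D; exists z; split => //; exists D.
apply: H1_ext => z; split=> [[D [[z' [hz' r']] r]]|hz].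
  exact: (hclass_rep hz' r' r).
have [D r] := rep1_deformation (hclass_cocycle hz).
by exists D; split => //; exists z.
Qed.

Lemma mxcomb_delta m (i : 'I_m) x (b : 'I_m -> stalk S x) (k : 'I_1) :
  mxcomb (delta_mx i ord0) b k = b i.
Proof.
rewrite /mxcomb (ord1 k) (bigD1 i) //= big1 => [|l ne]; last first.
  by rewrite mxE (negbTE ne) acst0_0 rmorph0 mul0r.
by rewrite mxE !eqxx acst0_1 rmorph1 mul1r addr0.
Qed.

Lemma mxcomb_sum2 x (b : 'I_2 -> stalk S x) (k : 'I_1) : mxcomb (const_mx 1) b k = b 0 + b 1.
Proof.
rewrite /mxcomb !big_ord_recl big_ord0 !mxE acst0_1 rmorph1 !mul1r addr0.
by congr (_ + b _); apply: val_inj.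
Qed.

Lemma mxcomb_scalar (a : Cx R) x (b : 'I_1 -> stalk S x) (k : 'I_1) :
  mxcomb a%:M b k = str S x (acst 0 a) * b 0.
Proof. by rewrite /mxcomb (ord1 k) big_ord1 mxE eqxx mulr1n. Qed.

(** A family over B_2 carries a pair of cocycles on one cover, and the base change by e_1, e_2 |-> e
    adds them. Conversely a pair of cocycles, moved to the product cover, glues to a family over
    B_2. *)
Lemma tangent_sumP t1 t2 t3 : tangent_sum t1 t2 t3 <-> H1_sum (Phi t1) (Phi t2) (Phi t3).
Proof.
split.
  move=> [D1 [D2 [D3 [tD1 tD2 tD3 [E [b1 b2 b3]]]]]].
  have [U [ch [et [rE _]]]] := rep_ex hX c_inj E.
  have r1 := base_change_rep b1 rE; have r2 := base_change_rep b2 rE; have r3 := base_change_rep b3 rE.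
  pose z1 := Cochain U (ch 0) (et 0); pose z2 := Cochain U (ch 1) (et 1).
  have r1' : rep1 D1 z1.
    by apply: (rep_eq r1) => [l i j x _ _ a|l i x _ F _]; rewrite ?/chiM ?/etaM mxcomb_delta.
  have r2' : rep1 D2 z2.
    by apply: (rep_eq r2) => [l i j x _ _ a|l i x _ F _]; rewrite ?/chiM ?/etaM mxcomb_delta.
  exists z1, z2; split; [by exists D1 | by exists D2 |].
  exists D3; split => //.
  have oc : open_cover U by case: rE => K [].
  pose W (p : X * X) := U p.1 `&` U p.2.
  have oW : open_cover W.
    split=> [p|x]; first by apply: openI; apply oc.
    by have [_ /(_ x) [i Ui]] := oc; exists (i, i).
  have s1 p : W p `<=` U p.1 by move=> x [].
  have s2 p : W p `<=` U p.2 by move=> x [].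
  have rW := rep_refine r3 oW s1.
  have zE := rep_chi_zero rE; have cE := rep_chi_cocycle rE; have lE := rep_lie rE.
  have etE l i x : off c (U i) x -> is_cov (et l i x).
    by move=> oi; have [K [_ _ _ _ co]] := rE; have [h _] := co i x oi.
  (* In [cochain_add] the first cocycle uses the index p.1 and the second uses p.2, whereas here
     both are written with p.1. The field chi_1(p.1, p.2) carries the second one from p.1 to p.2. *)
  apply: (rep_twist (psi := fun _ p => ch 1 p.1 p.2) rW).
  - by move=> l p; exact: zE.
  - move=> l p q x [Up1 Up2] [Uq1 Uq2] a; rewrite /chi1 /= /chiM mxcomb_sum2.
    have := cE 1 _ _ _ _ Up1 Uq1 Uq2 a; have := cE 1 _ _ _ _ Up1 Up2 Uq2 a => e1 e2.
    have {e1} -> : ch 1 p.2 q.2 x a = ch 1 p.1 q.2 x a - ch 1 p.1 p.2 x a.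
      by apply/eqP; rewrite -subr_eq0 opprB addrA addrAC; apply/eqP; rewrite -[RHS]e1; ring.
    have -> : ch 1 p.1 q.2 x a = ch 1 q.1 q.2 x a + ch 1 p.1 q.1 x a.
      by apply/eqP; rewrite eq_sym -subr_eq0; apply/eqP; rewrite -[RHS]e2; ring.
    by ring.
  - move=> l p x [[Up1 Up2] nx]; apply: is_covD; exact: etE.
  - move=> l p x [[Up1 Up2] nx] w hw F G vF vG.
    rewrite -(lE 1 p.1 p.2 x (conj (conj Up1 Up2) nx) w hw F G vF vG) /eta1 /= /etaM mxcomb_sum2.
    by congr (_ * _); ring.
move=> [z1 [z2 [[D1 [tD1 r1]] [D2 [tD2 r2]] [D3 [tD3 r3]]]]].
exists D1, D2, D3; split => //.
pose J := (idx z1 * idx z2)%type.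
pose W (p : J) := opens p.1 `&` opens p.2.
have [oc1 hz1 hp1 hcc1 hl1] := rep_cocycle hX r1.
have [oc2 hz2 hp2 hcc2 hl2] := rep_cocycle hX r2.
have [oW _ _ _ _] := rep_cocycle hX r3.
have s1 (p : J) : W p `<=` opens p.1 by move=> x [].
have s2 (p : J) : W p `<=` opens p.2 by move=> x [].
(* The direction e_1 carries z1 and the direction e_2 carries z2, both pulled back to the product
   cover. *)
pose ch (l : 'I_2) (p q : J) : vfield S := fun x a => if l == 0 then chi p.1 q.1 a else chi p.2 q.2 a.
pose et (l : 'I_2) (p : J) : form1 S := fun x F => if l == 0 then Defs.eta p.1 F else Defs.eta p.2 F.
have [E rE] : exists E : deformation S 2, rep E W ch et.
  apply: (cocycle_deformation hX oW); rewrite /ch /et => l.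
  - move=> p q; case: (l == 0).
      by apply: is_vfield_zero_sub (hz1 p.1 q.1) => x [[? ?] [? ?]].
    by apply: is_vfield_zero_sub (hz2 p.2 q.2) => x [[? ?] [? ?]].
  - move=> p; case: (l == 0).
      by apply: is_form1_pole_sub (hp1 p.1).
    by apply: is_form1_pole_sub (hp2 p.2).
  - move=> p q r x [? ?] [? ?] [? ?] a; case: (l == 0); [exact: hcc1 | exact: hcc2].
  - move=> p q x [[[? ?] [? ?]] nx]; case: (l == 0); [exact: hl1 | exact: hl2].
exists E; split; apply: (base_change_ex rE).
- apply: (rep_eq (rep_refine r1 oW s1)) => [l i j x _ _ a|l i x _ F _].
    by rewrite /chiM mxcomb_delta /ch.
  by rewrite /etaM mxcomb_delta /et.
- apply: (rep_eq (rep_refine r2 oW s2)) => [l i j x _ _ a|l i x _ F _].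
    by rewrite /chiM mxcomb_delta /ch.
  by rewrite /etaM mxcomb_delta /et.
- apply: (rep_eq r3) => [l i j x _ _ a|l i x _ F _].
    by rewrite /chiM mxcomb_sum2 /ch.
  by rewrite /etaM mxcomb_sum2 /et.
Qed.

Lemma tangent_scaleP (a : Cx R) t t' : tangent_scale a t t' <-> H1_scale a (Phi t) (Phi t').
Proof.
split.
  move=> [D [D' [tD tD' bc]]]; have [z r] := rep1_ex D.
  exists z; split; first by exists D.
  exists D'; split => //; apply: (rep_eq (base_change_rep bc r)) => [l i j x _ _ b|l i x _ F _].
    by rewrite /chiM mxcomb_scalar.
  by rewrite /etaM mxcomb_scalar.
move=> [z [[D [tD r]] [D' [tD' r']]]]; exists D, D'; split => //.
apply: (base_change_ex r); apply: (rep_eq r') => [l i j x _ _ b|l i x _ F _].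
  by rewrite /chiM mxcomb_scalar.
by rewrite /etaM mxcomb_scalar.
Qed.

End Classes.

Theorem theorem1p2 (R : realType) (X : topologicalType) (g n : nat)
    (c : 'I_n -> X) (S : affine_family R c 0)
    (X_neq0 : [set: X] !=set0) (X_hausdorff : hausdorff_space X)
    (X_compact : compact [set: X]) (X_connected : connected [set: X])
    (c_inj : injective c) (S_genus : has_genus S g)
    (stable : (2 < 2 * g + n)%N) :
  (forall D : deformation S 1, exists z : cochain S, represents D z) /\
  exists Phi : tangent S -> H1 S,
    [/\ forall (t : tangent S) (D : deformation S 1) (z : cochain S),
          t D -> represents D z -> Phi t z,
        bijective Phi,
        forall t1 t2 t3 : tangent S,
          tangent_sum t1 t2 t3 <-> H1_sum (Phi t1) (Phi t2) (Phi t3) &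
        forall (k : Cx R) (t t' : tangent S),
          tangent_scale k t t' <-> H1_scale k (Phi t) (Phi t')].
Proof.
split; first by move=> D; exact: represents_ex.
exists (Phi X_hausdorff c_inj); split.
- by move=> t D z tD /represents_rep r; exists D.
- exact: Phi_bij.
- exact: tangent_sumP.
- exact: tangent_scaleP.
Qed.
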